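(* Let $L,H,F,G,m_0^*$ satisfy all the assumptions on the data listed in the context, and let $\Delta=(\Delta t,\Delta x,\varepsilon)\in\,]0,\infty[^3$ be as in the context. Then, if $\Delta t/\varepsilon$ is small enough, the discrete mean field games system $(\mathrm{MFG}^\Delta)$ admits at least one solution.
   Context: **General notation.** $d\in\mathbb N$, $d\ge1$, $T>0$; $|\cdot|$ is the Euclidean norm, $|\cdot|_\infty$ the maximum norm on $\mathbb R^d$; $\overline B(0,r)$, $\overline B_\infty(0,r)$ are the corresponding closed balls. $\mathcal P_1(\mathbb R^d)$ is the set of Borel probability measures with finite first moment, with the 1-Wasserstein distance $d_1$; $C([0,T];\mathcal P_1(\mathbb R^d))$ carries the uniform distance. **Assumptions on the data.** (1) $L:\mathbb R^d\times\mathbb R^d\to\mathbb R$ is $C^2$, bounded from below, and for some constants $C_{L,i}>0$ and all $x,a,b,y\in\mathbb R^d$: $L(x,a)\le C_{L,1}|a|^2+C_{L,2}$; $|D_xL(x,a)|\le C_{L,3}(1+|a|^2)$; $C_{L,4}|b|^2\le\langle D^2_{aa}L(x,a)b,b\rangle$; $\langle D^2_{xx}L(x,a)y,y\rangle\le C_{L,5}(1+|a|^2)|y|^2$. $H(x,p)=\sup_{a\in\mathbb R^d}(\langle a,p\rangle-L(x,a))$ (which is then finite and of class $C^2$). (2) $F,G:\mathbb R^d\times\mathcal P_1(\mathbb R^d)\to\mathbb R$ are continuous and, for $h\in\{F,G\}$, there are constants $C_{h,i}>0$ such that for all $x,y\in\mathbb R^d$, $\nu\in\mathcal P_1(\mathbb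 R^d)$: $|h(x,\nu)|\le C_{h,1}$; $|h(x,\nu)-h(y,\nu)|\le C_{h,2}|x-y|$; $h(x+y,\nu)-2h(x,\nu)+h(x-y,\nu)\le C_{h,3}|y|^2$. (3) $m_0^*\in\mathcal P_1(\mathbb R^d)$ is absolutely continuous, with density (still denoted $m_0^*$) in $L^{\mathsf p}(\mathbb R^d)$ for a fixed $\mathsf p\in\,]1,\infty]$, and $\mathrm{supp}(m_0^* )\subset\overline B_\infty(0,C^* )$ for some $C^*>0$. **Semi-Lagrangian scheme.** Let $\mu\in C([0,T];\mathcal P_1(\mathbb R^d))$. With $X^{t,x,\alpha}(s)=x-\int_t^s\alpha(r)\,dr$ and $J^{t,x}[\mu](\alpha)=\int_t^T\big(L(X^{t,x,\alpha}(s),\alpha(s))+F(X^{t,x,\alpha}(s),\mu(s))\big)ds+G(X^{t,x,\alpha}(T),\mu(T))$, $C_{\rm b}>0$ is a fixed constant such that for every $\mu,t,x$ the infimum of $J^{t,x}[\mu]$ over $L^2([t,T];\mathbb R^d)$ is attained by some $\alpha$ with $\|\alpha\|_{L^\infty}\le C_{\rm b}$ (such a constant exists). $\Delta t=T/N$, $N\in\mathbb N^*$, $t_k=k\Delta t$, $\mathcal I_{\Delta t}=\{0,\dots,N\}$, $\mathcal I^*_{\Delta t}=\{0,\dots,N-1\}$; $\Delta x>0$, $x_i=i\Delta x$ for $i\in\mathbb Z^d$. $\beta^1_i(z)=\prod_{l=1}^d\max\{0,1-|z_l/\Delta x-i_l|\}$, and $I^1[\phi](x)=\sum_{i\in\mathbb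 Z^d}\phi_i\beta_i^1(x)$ for $\phi=(\phi_i)_{i\in\mathbb Z^d}$. Define $v_{N,i}=G(x_i,\mu(T))$ and, for $k\in\mathcal I^*_{\Delta t}$, $v_{k,i}=\inf_{a\in\overline B(0,C_{\rm b})}\big[\Delta tL(x_i,a)+I^1[v_{k+1}](x_i-\Delta t\,a)\big]+\Delta tF(x_i,\mu(t_k))$. Set $v^{\Delta t,\Delta x}[\mu](t,x)=I^1[v_k](x)$ for $t\in[t_k,t_{k+1}[$, $k\in\mathcal I_{\Delta t}^*$, and $v^{\Delta t,\Delta x}[\mu](T,x)=I^1[v_N](x)$. **Mollification.** $\rho\in C^\infty(\mathbb R^d)$ is a fixed function with bounded derivatives of any order, $\rho\ge0$ and $\int_{\mathbb R^d}\rho(x)dx=1$; $\rho_\varepsilon(x)=\varepsilon^{-d}\rho(x/\varepsilon)$. For $\Delta=(\Delta t,\Delta x,\varepsilon)\in\,]0,\infty[^3$, $v^\Delta[\mu](t,\cdot)=\rho_\varepsilon*v^{\Delta t,\Delta x}[\mu](t,\cdot)$. **Lagrange–Galerkin scheme.** $\mathsf\Phi^\Delta_k[\mu](x)=x-\Delta t\,D_pH(x,D_xv^\Delta[\mu](t_k,x))$; $E_i=\{x\in\mathbb R^d: |x-x_i|_\infty\le\Delta x/2\}$, $\beta_i^0=\mathbb I_{E_i}$ (indicator function). $m_{0,i}=(\Delta x)^{-d}\int_{E_i}m_0^*(x)dx$, $m_{k+1,i}=(\Delta x)^{-d}\sum_{j\in\mathbb Z^d}m_{k,j}\int_{E_j}\beta_i^0(\mathsf\Phi_k^\Delta[\mu](x))dx$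 for $k\in\mathcal I_{\Delta t}^*$. $\mathsf m^\Delta[\mu](t_k,x)=\sum_jm_{k,j}\beta_j^0(x)$, extended to $t\in[0,T]$ by affine interpolation in time on each $[t_k,t_{k+1}]$. **Discrete MFG system.** Fix $c>0$ and let $\Delta x\le c\Delta t$. There is a constant $\widetilde C^*>0$, independent of $\mu$ and $\Delta$, such that $\Delta x\le c\Delta t$ implies that $m_{k,i}=0$ for all $k\in\mathcal I_{\Delta t}$ whenever $x_i\notin\overline B_\infty(0,\widetilde C^* )$; fix such a constant and let $\mathcal I_{\Delta x}=\{i\in\mathbb Z^d: x_i\in\overline B_\infty(0,\widetilde C^* )\}$. $\mathfrak D^{\Delta t,\Delta x}$ is the set of $\mu=(\mu_{k,i})_{k\in\mathcal I_{\Delta t},i\in\mathcal I_{\Delta x}}$ with $\mu_{k,i}\ge0$ and $\sum_{j\in\mathcal I_{\Delta x}}\mu_{k,j}(\Delta x)^d=1$ for every $k$. For such $\mu$, its extension $\tilde\mu\in C([0,T];\mathcal P_1(\mathbb R^d))$ is the measure-valued curve with density $\frac{t-t_k}{\Delta t}\sum_{i\in\mathcal I_{\Delta x}}\mu_{k+1,i}\beta_i^0(x)+\frac{t_{k+1}-t}{\Delta t}\sum_{i\in\mathcal I_{\Delta x}}\mu_{k,i}\beta_i^0(x)$ for $t\in[t_k,t_{k+1}]$. $(\mathrm{MFG}^\Delta)$ is the problem: find $\mu\in\mathfrak D^{\Delta t,\Delta x}$ such that $\mu_{k,i}=\mathsf m^\Delta[\tilde\mu](t_k,x_i)$ for all $k\in\mathcal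 I_{\Delta t}$, $i\in\mathcal I_{\Delta x}$.
   Formalization: The first partial derivatives of ρ are additionally assumed integrable, and ε is bounded by an arbitrary fixed ε_max on which the threshold for Δt/ε may depend; without these two conditions the claim fails for some data. *)

(* Defs.v *)
From HB Require Import structures.
From mathcomp Require Import all_boot all_order all_algebra.
From mathcomp Require Import all_classical all_reals all_analysis.
From mathcomp Require Import measurable_realfun.
Set Implicit Arguments.
Unset Strict Implicit.
Unset Printing Implicit Defensive.
Import Order.TTheory GRing.Theory Num.Theory.
Import numFieldNormedType.Exports.
Local Open Scope classical_set_scope.
Local Open Scope ring_scope.

(* R^d is 'rV[R]_d: there `|x| is the maximum norm; the Euclidean norm is enorm
   below. *)

Definition borel_mx_display : measure_display.
Proof. by constructor. Qed.

Section borel_mx.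
Context (R : realType) (m n : nat).

Definition borel_mx : set (set 'M[R]_(m, n)) :=
  <<s [set A : set 'M[R]_(m, n) | open A] >>.

Let borel_mx0 : borel_mx set0. Proof. exact: sigma_algebra0. Qed.

Let borel_mxC A : borel_mx A -> borel_mx (~` A).
Proof. exact: sigma_algebraC. Qed.

Let borel_mx_bigcup (F : (set 'M[R]_(m, n))^nat) :
  (forall i, borel_mx (F i)) -> borel_mx (\bigcup_i F i).
Proof. exact: sigma_algebra_bigcup. Qed.

HB.instance Definition _ := @isMeasurable.Build borel_mx_display 'M[R]_(m, n)
  borel_mx borel_mx0 borel_mxC borel_mx_bigcup.

Lemma open_measurable_mx (A : set 'M[R]_(m, n)) : open A -> measurable A.
Proof. exact: sub_gen_smallest. Qed.

End borel_mx.


Section measurable_rV.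
Context (R : realType) (n : nat).

Lemma measurable_coord_rV (j : 'I_n) :
  measurable_fun setT (fun x : 'rV[R]_n => x 0 j : R).
Proof.
apply: (measurability (@RGenOpens.G R)); first exact: RGenOpens.measurableE.
move=> _ [_ [a [b ->]] <-]; rewrite setTI; apply: open_measurable_mx.
by apply: open_comp => [A _|]; [exact: coord_continuous|exact: interval_open].
Qed.

Let rbox (ck : 'rV[rat]_n * nat) : set 'rV[R]_n :=
  [set x | forall j, `|x 0 j - ratr (ck.1 0 j)| < ck.2.+1%:R^-1].

Let open_rbox (A : set 'rV[R]_n) : open A ->
  A = \bigcup_(ck in [set ck | rbox ck `<=` A]) rbox ck.
Proof.
rewrite openE => oA; apply/seteqP; split=> [x /[dup] Ax /oA|x [ck]]; last exact.
rewrite /interior => /nbhs_ballP[e /= e0 xeA].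
have [k _ /(_ _ (leqnn _)) ke] :
    \forall k \near \oo, (k.+1%:R^-1 : R) < e / 2.
  by have := near_infty_natSinv_lt (PosNum (divr_gt0 e0 (ltr0n _ 2))).
have /choice[c cP] : forall j : 'I_n, exists q : rat,
    `|x 0 j - ratr q| < k.+1%:R^-1.
  move=> j; have : x 0 j - k.+1%:R^-1 < x 0 j + k.+1%:R^-1.
    by rewrite ltrD2l (@lt_trans _ _ 0) ?oppr_lt0 ?invr_gt0.
  move=> /rat_in_itvoo[q]; rewrite in_itv/= => /andP[q1 q2]; exists q.
  by rewrite distrC ltr_distl q1 q2.
exists (\row_j c j, k) => /=; last by move=> j /=; rewrite mxE.
move=> y /= yP; apply: xeA; split=> // i j; rewrite (ord1 i) /ball/=.
rewrite (le_lt_trans (ler_distD (ratr (c j)) _ _))// (splitr e) ltrD//.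
  exact: lt_trans (cP j) ke.
by have := yP j; rewrite mxE distrC => /lt_trans; apply.
Qed.

Lemma measurable_fun_rVP d (T : measurableType d) (D : set T)
    (f : T -> 'rV[R]_n) :
  measurable_fun D f <-> forall j, measurable_fun D (fun t => f t 0 j : R).
Proof.
split=> [mf j|mf]; first exact: measurableT_comp (measurable_coord_rV j) mf.
move=> mD; apply: (@measurability _ _ _ _ _ _ [set A : set 'rV[R]_n | open A]).
- by [].
- move=> _ [A /= oA <-].
  rewrite (open_rbox oA) preimage_bigcup setI_bigcupr bigcup_mkcond.
  apply: countable_bigcupT_measurable; first exact: countableP.
  move=> ck; case: ifPn => // _.
  have -> : D `&` f @^-1` rbox ck = D `&` \bigcap_(j in [set: 'I_n])
      (D `&` (fun t => f t 0 j : R) @^-1` ball (ratr (ck.1 0 j) : R) ck.2.+1%:R^-1).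
    apply/seteqP; split => t /= [Dt h]; split => // j.
    + by split=> //; rewrite /ball /= distrC; exact: h.
    + by have [//|_] := h j; rewrite /ball/= distrC.
  apply: measurableI => //; apply: fin_bigcap_measurable => // j _.
  by apply: mf => //; apply: measurable_ball.
- exact: mD.
Qed.
End measurable_rV.


Section lebesgue_rV_step.
Context (R : realType) (n : nat).

Definition rV_cons (p : R * 'rV[R]_n) : 'rV[R]_n.+1 :=
  \row_i oapp (p.2 0) p.1 (unlift ord0 i).

Definition rV_uncons (x : 'rV[R]_n.+1) : R * 'rV[R]_n :=
  (x 0 ord0, \row_j x 0 (lift ord0 j)).

Lemma rV_consK : cancel rV_cons rV_uncons.
Proof.
case=> r x; rewrite /rV_uncons /rV_cons !mxE unlift_none /=; congr pair.
by apply/rowP => j; rewrite !mxE liftK.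
Qed.

Lemma measurable_rV_cons : measurable_fun setT rV_cons.
Proof.
apply/measurable_fun_rVP => j; have [i ->|->] := unliftP ord0 j.
  rewrite (_ : (fun _ => _) = (fun x : 'rV[R]_n => x 0 i) \o snd); last first.
    by apply/funext => p; rewrite /rV_cons mxE liftK.
  exact: measurableT_comp (measurable_coord_rV i) measurable_snd.
rewrite (_ : (fun _ => _) = fst) ; first exact: measurable_fst.
by apply/funext => p; rewrite /rV_cons mxE unlift_none.
Qed.

Lemma measurable_rV_uncons : measurable_fun setT rV_uncons.
Proof.
apply/measurable_fun_pairP; split; first exact: measurable_coord_rV.
apply/measurable_fun_rVP => j.
rewrite (_ : (fun _ => _) = (fun x : 'rV[R]_n.+1 => x 0 (lift ord0 j))).
  exact: measurable_coord_rV.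
by apply/funext => x /=; rewrite mxE.
Qed.

Variable mu : {sigma_finite_measure set 'rV[R]_n -> \bar R}.

Definition rV_cons_measure : set 'rV[R]_n.+1 -> \bar R :=
  pushforward (lebesgue_measure \x mu)%E rV_cons.


Let mpreimage A : measurable A -> measurable (rV_cons @^-1` A).
Proof. by move=> mA; rewrite -[X in measurable X]setTI; exact: measurable_rV_cons. Qed.

Let rV_cons_measure0 : rV_cons_measure set0 = 0%E.
Proof. by rewrite /rV_cons_measure /pushforward preimage_set0 measure0. Qed.

Let rV_cons_measure_ge0 A : (0 <= rV_cons_measure A)%E.
Proof. by rewrite /rV_cons_measure /pushforward measure_ge0. Qed.

Let rV_cons_measure_sigma_additive : semi_sigma_additive rV_cons_measure.
Proof.
move=> F mF tF mUF; rewrite /rV_cons_measure /pushforward preimage_bigcup.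
apply: measure_semi_sigma_additive.
- by move=> i; exact: mpreimage.
- by apply/trivIsetP => i j _ _ ij; rewrite -preimage_setI;
    move/trivIsetP : tF => /(_ _ _ _ _ ij) ->//; rewrite preimage_set0.
- by rewrite -preimage_bigcup; exact: mpreimage.
Qed.

HB.instance Definition _ := isMeasure.Build _ _ _ rV_cons_measure
  rV_cons_measure0 rV_cons_measure_ge0 rV_cons_measure_sigma_additive.

Let rV_cons_measure_sigma_finite : sigma_finite setT rV_cons_measure.
Proof.
have /sigma_finiteP[F [TF ndF Foo]] := sigma_finiteT (@lebesgue_measure R).
have /sigma_finiteP[G [TG ndG Goo]] := sigma_finiteT mu.
exists (fun k => rV_uncons @^-1` (F k `*` G k)) => [|k].
  apply/esym; rewrite -subTset => x _.
  have [k _ Fk] : (\bigcup_k F k) (rV_uncons x).1 by rewrite -TF.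
  have [l _ Gl] : (\bigcup_k G k) (rV_uncons x).2 by rewrite -TG.
  exists (maxn k l) => //; split.
    by apply: (subsetPset _ _ (ndF _ _ (leq_maxl _ _))).
  by apply: (subsetPset _ _ (ndG _ _ (leq_maxr _ _))).
have [mF Fk] := Foo k; have [mG Gk] := Goo k; split.
  rewrite -[X in measurable X]setTI; apply: measurable_rV_uncons => //.
  exact: measurableX.
rewrite /rV_cons_measure /pushforward -comp_preimage.
rewrite (_ : rV_uncons \o rV_cons = id).
  by rewrite preimage_id product_measure1E// lte_mul_pinfty// ge0_fin_numE.
by apply/funext => p; exact: rV_consK.
Qed.

HB.instance Definition _ := Measure_isSigmaFinite.Build _ _ _ rV_cons_measure
  rV_cons_measure_sigma_finite.

End lebesgue_rV_step.

(* lebesgue_rV R n is the n-fold product of the one-dimensional Lebesgue measure,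
   transported to row vectors; see lebesgue_rV_box. *)
Fixpoint lebesgue_rV (R : realType) (n : nat) :
    {sigma_finite_measure set 'rV[R]_n -> \bar R} :=
  match n with
  | 0 => \d_(0 : 'rV[R]_0)
  | n'.+1 => rV_cons_measure (lebesgue_rV R n')
  end.

Lemma lebesgue_rV_box (R : realType) (n : nat) (a b : 'rV[R]_n) :
  (forall j, a 0 j <= b 0 j) ->
  lebesgue_rV R n [set x | forall j, a 0 j <= x 0 j <= b 0 j] =
  (\prod_j (b 0 j - a 0 j))%:E.
Proof.
elim: n a b => [|n IHn] a b ab.
  rewrite big_ord0 /= diracE mem_set//= => -[].
  by move=> j jn; have := ltn0 j; rewrite jn.
pose a' : 'rV[R]_n := \row_j a 0 (lift ord0 j).
pose b' : 'rV[R]_n := \row_j b 0 (lift ord0 j).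
have preE : @rV_cons R n @^-1` [set x | forall j, a 0 j <= x 0 j <= b 0 j] =
    `[a 0 ord0, b 0 ord0] `*` [set x : 'rV[R]_n | forall j, a' 0 j <= x 0 j <= b' 0 j].
  apply/seteqP; split=> -[r x] /=.
    move=> h; split=> [|j].
      by rewrite in_itv/=; have := h ord0; rewrite mxE unlift_none.
    by rewrite !mxE; have := h (lift ord0 j); rewrite mxE liftK.
  move=> [r0 h] j; rewrite mxE; have [i ->|->] := unliftP ord0 j => /=.
    by have := h i; rewrite !mxE.
  by move: r0; rewrite in_itv.
have mbox : measurable [set x : 'rV[R]_n | forall j, a' 0 j <= x 0 j <= b' 0 j].
  rewrite (_ : mkset _ = \bigcap_(j in [set: 'I_n])
    ((fun x : 'rV[R]_n => x 0 j : R) @^-1` `[a' 0 j, b' 0 j])).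
    apply: fin_bigcap_measurable => // j _; rewrite -[X in measurable X]setTI.
    exact: measurable_coord_rV.
  by apply/seteqP; split=> x /= h j => [_|]; [rewrite /= in_itv/=|
    have := h j I; rewrite /= in_itv/=].
change ((lebesgue_measure \x lebesgue_rV R n)%E (@rV_cons R n @^-1`
  [set x | forall j, a 0 j <= x 0 j <= b 0 j]) = (\prod_j (b 0 j - a 0 j))%:E).
rewrite preE product_measure1E// IHn; last by move=> j; rewrite !mxE.
rewrite big_ord_recl EFinM; congr (_ * _)%E; last first.
  by congr EFin; apply: eq_bigr => j _; rewrite !mxE.
have := lebesgue_measure_itv `[a 0 ord0, b 0 ord0]; rewrite /= => ->.
have := ab ord0; rewrite lte_fin le_eqVlt => /orP[/eqP ->|->//].
by rewrite ltxx subrr.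
Qed.

Section calculus.
Context {R : realType}.

Definition iter_derive (V : normedModType R) (vs : seq V) (f : V -> R) : V -> R :=
  foldr (fun v g => 'D_v g) f vs.

(* C^n on a finite-dimensional V, through iterated directional derivatives. *)
Definition class_C (V : normedModType R) (n : nat) (f : V -> R) : Prop :=
  (forall vs : seq V, (size vs <= n)%N -> continuous (iter_derive vs f)) /\
  (forall (vs : seq V) (v x : V), (size vs < n)%N ->
    derivable (iter_derive vs f) x v).

Definition smooth_bounded_derivatives (V : normedModType R) (f : V -> R) : Prop :=
  (forall n, class_C n f) /\
  (forall vs : seq V, exists M : R, forall x, `|iter_derive vs f x| <= M).

Variable d : nat.
Implicit Types x y : 'rV[R]_d.

Definition dotp x y : R := \sum_(l < d) x 0 l * y 0 l.

Definition enorm x : R := Num.sqrt (dotp x x).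

Definition grad (f : 'rV[R]_d -> R) x : 'rV[R]_d :=
  \row_l 'D_(delta_mx 0 l) f x.

Definition hess (f : 'rV[R]_d -> R) x : 'M[R]_d :=
  \matrix_(k, l) 'D_(delta_mx 0 k) ('D_(delta_mx 0 l) f) x.

End calculus.

Section wasserstein.
Context {R : realType} {d : nat}.

Record P1 := MkP1 {
  P1_prob :> probability 'rV[R]_d R ;
  P1_moment : (\int[P1_prob]_x (enorm x)%:E < +oo)%E }.

Definition coupling (mu nu : P1) (g : probability ('rV[R]_d * 'rV[R]_d)%type R) :
    Prop :=
  (forall A, measurable A -> g (A `*` setT) = mu A) /\
  (forall B, measurable B -> g (setT `*` B) = nu B).

Definition W1 (mu nu : P1) : \bar R :=
  ereal_inf [set (\int[g]_z (enorm (z.1 - z.2))%:E)%E | g in coupling mu nu].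

Definition supp (mu : P1) : set 'rV[R]_d :=
  [set x | forall U, open U -> U x -> (0 < mu U)%E].

(* mu represents an element of C([0, T]; P1); its values outside [0, T] are
   irrelevant. *)
Definition continuous_curve (T : R) (mu : R -> P1) : Prop :=
  forall t, t \in `[0, T] -> forall e : R, 0 < e -> exists2 r : R, 0 < r &
    forall s, s \in `[0, T] -> `|s - t| < r -> (W1 (mu s) (mu t) < e%:E)%E.

End wasserstein.
Arguments P1 : clear implicits.

Section data.
Context {R : realType} {d : nat}.

Definition lagrangian_assumption (L : 'rV[R]_d -> 'rV[R]_d -> R) : Prop :=
  [/\ class_C 2 (fun z : 'rV[R]_d * 'rV[R]_d => L z.1 z.2),
      exists m : R, forall x a, m <= L x a,
      exists2 C1 : R, 0 < C1 & exists2 C2 : R, 0 < C2 &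
        forall x a, L x a <= C1 * enorm a ^+ 2 + C2,
      exists2 C3 : R, 0 < C3 & forall x a,
        enorm (grad (fun y => L y a) x) <= C3 * (1 + enorm a ^+ 2) &
      (exists2 C4 : R, 0 < C4 & forall x a b,
        C4 * enorm b ^+ 2 <= dotp (b *m hess (L x) a) b) /\
      (exists2 C5 : R, 0 < C5 & forall x a y,
        dotp (y *m hess (fun x' => L x' a) x) y <=
          C5 * (1 + enorm a ^+ 2) * enorm y ^+ 2)].

Definition hamiltonian (L : 'rV[R]_d -> 'rV[R]_d -> R) (x p : 'rV[R]_d) : R :=
  sup [set dotp a p - L x a | a in [set: 'rV[R]_d]].

Definition continuous_Rd_P1 (h : 'rV[R]_d -> P1 R d -> R) : Prop :=
  forall x nu (e : R), 0 < e -> exists2 r : R, 0 < r &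
    forall y nu', enorm (y - x) < r -> (W1 nu' nu < r%:E)%E ->
      `|h y nu' - h x nu| < e.

Definition cost_assumption (h : 'rV[R]_d -> P1 R d -> R) : Prop :=
  [/\ continuous_Rd_P1 h,
      exists2 C1 : R, 0 < C1 & forall x nu, `|h x nu| <= C1,
      exists2 C2 : R, 0 < C2 & forall x y nu,
        `|h x nu - h y nu| <= C2 * enorm (x - y) &
      exists2 C3 : R, 0 < C3 & forall x y nu,
        h (x + y) nu - 2 * h x nu + h (x - y) nu <= C3 * enorm y ^+ 2].

Definition initial_assumption (pp : \bar R) (m0 : P1 R d)
    (m0d : 'rV[R]_d -> R) : Prop :=
  [/\ measurable_fun setT m0d, forall x, 0 <= m0d x,
      forall A, measurable A ->
        m0 A = (\int[lebesgue_rV R d]_(x in A) (m0d x)%:E)%E,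
      ('N[lebesgue_rV R d]_pp [EFin \o m0d] < +oo)%E &
      exists2 Cs : R, 0 < Cs & supp m0 `<=` [set x | `|x| <= Cs]].

Definition mollifier_assumption (rho : 'rV[R]_d -> R) : Prop :=
  [/\ smooth_bounded_derivatives rho, forall x, 0 <= rho x &
      (\int[lebesgue_rV R d]_x (rho x)%:E = 1)%E].

End data.

Section control.
Context {R : realType} {d : nat}.
Variables (T : R) (L : 'rV[R]_d -> 'rV[R]_d -> R) (F G : 'rV[R]_d -> P1 R d -> R).

Definition L2_control (t : R) (alpha : R -> 'rV[R]_d) : Prop :=
  measurable_fun `[t, T] alpha /\
  (\int[lebesgue_measure]_(s in `[t, T]) (enorm (alpha s) ^+ 2)%:E < +oo)%E.

Definition trajectory (t : R) (x : 'rV[R]_d) (alpha : R -> 'rV[R]_d) (s : R) :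
    'rV[R]_d :=
  x - \row_l \int[lebesgue_measure]_(r in `[t, s]) (alpha r 0 l).

Definition cost (mu : R -> P1 R d) (t : R) (x : 'rV[R]_d)
    (alpha : R -> 'rV[R]_d) : R :=
  let X := trajectory t x alpha in
  \int[lebesgue_measure]_(s in `[t, T]) (L (X s) (alpha s) + F (X s) (mu s)) +
  G (X T) (mu T).

Definition control_bound (Cb : R) : Prop :=
  forall mu, continuous_curve T mu -> forall (t : R) x, t \in `[0, T] ->
    exists alpha, [/\ L2_control t alpha,
      forall beta, L2_control t beta -> cost mu t x alpha <= cost mu t x beta &
      {ae lebesgue_measure, forall s, s \in `[t, T] -> enorm (alpha s) <= Cb}].

End control.

Section grid.
Context {R : realType} {d : nat}.
Variable dx : R.

Definition gridpt (i : 'rV[int]_d) : 'rV[R]_d := \row_l ((i 0 l)%:~R * dx).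

Definition beta1 (i : 'rV[int]_d) (z : 'rV[R]_d) : R :=
  \prod_(l < d) Num.max 0 (1 - `|z 0 l / dx - (i 0 l)%:~R|).

(* Sums over Z^d are sums over the support, which is finite in all uses below. *)
Definition interp1 (phi : 'rV[int]_d -> R) (x : 'rV[R]_d) : R :=
  \sum_(i \in [set: 'rV[int]_d]) phi i * beta1 i x.

Definition cell (i : 'rV[int]_d) : set 'rV[R]_d :=
  [set x | `|x - gridpt i| <= dx / 2].

Definition beta0 (i : 'rV[int]_d) (x : 'rV[R]_d) : R := \1_(cell i) x.

Definition grid_box (r : R) : set 'rV[int]_d := [set i | `|gridpt i| <= r].

End grid.

Section scheme.
Context {R : realType} {d : nat}.
Variables (T : R) (L : 'rV[R]_d -> 'rV[R]_d -> R) (F G : 'rV[R]_d -> P1 R d -> R).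
Variables (m0d rho : 'rV[R]_d -> R) (Cb : R).
Variables (N : nat) (dx eps : R).

Let dt : R := T / N%:R.
Let tk (k : nat) : R := k%:R * dt.

Section given_curve.
Variable mu : R -> P1 R d.

(* value_rev n is v_{N - n} *)
Fixpoint value_rev (n : nat) (i : 'rV[int]_d) : R :=
  match n with
  | 0 => G (gridpt dx i) (mu T)
  | n'.+1 =>
      inf [set dt * L (gridpt dx i) a +
               interp1 dx (value_rev n') (gridpt dx i - dt *: a)
          | a in [set a : 'rV[R]_d | enorm a <= Cb]] +
      dt * F (gridpt dx i) (mu (tk (N - n'.+1)))
  end.

Definition value (k : nat) : 'rV[int]_d -> R := value_rev (N - k).

(* v^{dt,dx}[mu](t_k, .); other times do not enter the discrete system, and
   likewise for mass_fun, whose affine interpolation in time is not needed. *)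
Definition value_fun (k : nat) : 'rV[R]_d -> R := interp1 dx (value k).

Definition rho_eps (x : 'rV[R]_d) : R := eps ^- d * rho (eps^-1 *: x).

Definition value_moll (k : nat) (x : 'rV[R]_d) : R :=
  \int[lebesgue_rV R d]_y (rho_eps (x - y) * value_fun k y).

Definition flow (k : nat) (x : 'rV[R]_d) : 'rV[R]_d :=
  x - dt *: grad (hamiltonian L x) (grad (value_moll k) x).

Fixpoint mass (k : nat) (i : 'rV[int]_d) : R :=
  match k with
  | 0 => dx ^- d * \int[lebesgue_rV R d]_(x in cell dx i) m0d x
  | k'.+1 => dx ^- d * \sum_(j \in [set: 'rV[int]_d]) mass k' j *
      \int[lebesgue_rV R d]_(x in cell dx j) beta0 dx i (flow k' x)
  end.

Definition mass_fun (k : nat) (x : 'rV[R]_d) : R :=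
  \sum_(j \in [set: 'rV[int]_d]) mass k j * beta0 dx j x.

End given_curve.

Variable Ct : R.

(* The set D^{dt,dx}; only the values of m at k <= N and i in grid_box dx Ct
   matter. *)
Definition discrete_densities (m : nat -> 'rV[int]_d -> R) : Prop :=
  forall k, (k <= N)%N ->
    (forall i, grid_box dx Ct i -> 0 <= m k i) /\
    \sum_(j \in grid_box dx Ct) m k j * dx ^+ d = 1.

Definition extension (m : nat -> 'rV[int]_d -> R) (mt : R -> P1 R d) : Prop :=
  continuous_curve T mt /\
  forall k t, (k < N)%N -> t \in `[tk k, tk k.+1] ->
    forall A, measurable A -> mt t A = (\int[lebesgue_rV R d]_(x in A)
      ((t - tk k) / dt * (\sum_(i \in grid_box dx Ct) m k.+1 i * beta0 dx i x) +
       (tk k.+1 - t) / dt * (\sum_(i \in grid_box dx Ct) m k i * beta0 dx i x))%:E)%E.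

Definition MFG_solution (m : nat -> 'rV[int]_d -> R) : Prop :=
  discrete_densities m /\
  exists2 mt : R -> P1 R d, extension m mt &
    forall k i, (k <= N)%N -> grid_box dx Ct i ->
      m k i = mass_fun mt k (gridpt dx i).

End scheme.

Definition support_bound {R : realType} {d : nat} (T : R)
    (L : 'rV[R]_d -> 'rV[R]_d -> R) (F G : 'rV[R]_d -> P1 R d -> R)
    (m0d rho : 'rV[R]_d -> R) (Cb c Ct : R) : Prop :=
  forall (mu : R -> P1 R d) (N : nat) (dx eps : R),
    continuous_curve T mu -> (0 < N)%N -> 0 < dx -> 0 < eps ->
    dx <= c * (T / N%:R) ->
    forall k i, (k <= N)%N -> ~ grid_box dx Ct i ->
      mass T L F G m0d rho Cb N dx eps mu k i = 0.

(* Main.v *)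
Require Import Defs.
From HB Require Import structures.
From mathcomp Require Import all_boot all_order all_algebra perm finmap.
From mathcomp Require Import all_classical all_reals all_analysis.
From mathcomp Require Import measurable_realfun.
From mathcomp Require Import ring lra zify.
Set Implicit Arguments.
Unset Strict Implicit.
Unset Printing Implicit Defensive.
Import Order.TTheory GRing.Theory Num.Theory.
Import numFieldNormedType.Exports.
Local Open Scope classical_set_scope.
Local Open Scope ring_scope.

(** A family m of cell densities determines a curve of measures (curve), the curve
    determines value functions, a flow and transported masses (mass), and m solves the
    discrete system exactly when these masses are m again. The masses are probability
    distributions on the finitely many nodes of the grid box, so a fixed point exists
    by Brouwer's theorem as soon as the masses depend continuously on m; the map
    normalized, from a cube to families of distributions, reduces the domain to a cube.

    Most of this dependence is continuous for simple reasons. Nearby densities are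
    close in W1, by a coupling which leaves most of the mass in place
    (W1_close_weights). The discrete value functions are uniformly bounded and
    Lipschitz (value_fun_bound, value_fun_lipschitz) and converge with the costs
    (value_fun_cvg). The derivative of the mollification may be put on rho
    (is_derive_smear), so mollified gradients converge by dominated convergence
    (smear_cvg). Finally D_pH (x, p) is the unique minimiser of L (x, a) - <a, p>
    (grad_hamiltonian), which is locally Lipschitz because L is uniformly convex in a
    (amin_lipschitz).

    The delicate step is the transport itself. The mass sent from cell j to cell i is
    the integral over cell j of the indicator of cell i composed with the flow, and
    this indicator jumps on the faces of the cell. Here the smallness of dt / eps
    enters: the gradient of the mollified value function has a Lipschitz constant of
    order 1 / eps, so for small dt / eps the flow differs from the identity by a map
    with Lipschitz constant at most 1 / 2 (flow_regular). Along each line parallel to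
    a coordinate axis that coordinate of the flow is then strictly increasing, and the
    preimage of a hyperplane carrying a face is a null set (near_id_hyperplane).
    Hence the indicators converge almost everywhere (transition_cvg). For the same
    reason cells, which overlap only in their faces, are not counted twice, and the
    total mass is preserved (transition_sum, mass_distributions).

    Brouwer's theorem on the cube is derived from Kuhn's cubical form of Sperner's
    lemma, where the parity count is carried by determinants over the field with two
    elements (kuhn_parity). *)

(** * Kuhn's combinatorial lemma *)

Section kuhn.

(** The vertices, for k from 0 to M, of the simplex of Kuhn's triangulation of
    the unit cube at x that belongs to the ordering s of the coordinates: one
    coordinate after the other is raised by one. *)
Definition kuhn_vertex M (x : 'I_M -> nat) (s : 'S_M) (k : nat) : 'I_M -> nat :=
  fun i => (x i + (s i < k))%N.

(** Over the field with two elements the determinant of this matrix is 1 exactly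
    when the p vertices carry the labels 0, ..., p - 1, each once; counting
    fully labelled simplices modulo 2 becomes summing determinants. *)
Definition label_mx M (l : ('I_M -> nat) -> nat) p (v : 'I_p -> 'I_M -> nat) :
    'M['F_2]_p := \matrix_(k, a) (l (v k) == a)%:R.

Lemma det_col0 (R : comPzRingType) p (A : 'M[R]_p) (j : 'I_p) :
  (forall i, A i j = 0) -> \det A = 0.
Proof.
move=> A0; rewrite (expand_det_col _ j) big1 // => i _.
by rewrite A0 mul0r.
Qed.

(** Adding all columns to the last one turns it into a column of ones, because
    each vertex has exactly one label. Expanding along it gives the sum, over
    the facets, of the determinants that test whether a facet carries all labels
    but the largest. *)
Lemma label_det_facets M (l : ('I_M -> nat) -> nat) p (v : 'I_p.+1 -> 'I_M -> nat) :
  (forall k, (l (v k) <= p)%N) ->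
  \det (label_mx l v) = \sum_j \det (label_mx l (fun k => v (lift j k))).
Proof.
move=> lp; pose U : 'M['F_2]_p.+1 := \matrix_(b, a) ((b == a) || (a == ord_max))%:R.
have dU : \det U = 1.
  rewrite -det_tr det_trig; last first.
    apply/is_trig_mxP => a b ab; rewrite !mxE; case: eqP => [e|_] /=.
      by rewrite e ltnn in ab.
    case: eqP => // e; move: (ltn_ord b); rewrite e /= in ab; lia.
  by apply: big1 => i _; rewrite !mxE eqxx.
have -> : \det (label_mx l v) = \det (label_mx l v *m U).
  by rewrite det_mulmx dU mulr1.
rewrite (expand_det_col _ ord_max); apply: eq_bigr => j _.
have -> : (label_mx l v *m U) j ord_max = 1.
  rewrite mxE (bigD1 (inord (l (v j)))) //= big1 => [|b bj].
    by rewrite !mxE eqxx orbT inordK ?ltnS ?lp // eqxx mulr1 addr0.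
  rewrite !mxE; case: eqP => [e|_]; last by rewrite mul0r.
  by move: bj; rewrite e inord_val eqxx.
have -> : forall B : 'M['F_2]_p.+1, cofactor B j ord_max =
    \det (row' j (col' ord_max B)).
  move=> B; rewrite /cofactor -signr_odd.
  by case: (odd _); rewrite ?expr0 ?expr1 ?mulN1r ?mul1r //; apply: val_inj;
    case: (\det _) => -[|[]].
rewrite mul1r; congr determinant; apply/matrixP => k a; rewrite !mxE.
rewrite (bigD1 (lift ord_max a)) //= big1 => [|b ba].
  by rewrite !mxE eqxx mulr1 addr0 lift_max.
by rewrite !mxE (negbTE ba) orFb [lift _ _ == _]eq_sym (negbTE (neq_lift _ _)) mulr0.
Qed.

Lemma F2_addrr (x : 'F_2) : x + x = 0.
Proof. by apply: val_inj; case: x => -[|[]]. Qed.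

(** The facet obtained by dropping an inner vertex j belongs to two simplices of
    the same cube, whose orderings differ by exchanging the ranks j - 1 and j.
    *)
Lemma inner_facets_cancel M (l : ('I_M -> nat) -> nat) (x : 'I_M -> nat) (j : 'I_M.+1) :
  (0 < j < M)%N ->
  \sum_(s : 'S_M) \det (label_mx l (fun k => kuhn_vertex x s (lift j k))) = 0.
Proof.
move=> /andP[j0 jM].
have j1M : (j.-1 < M)%N by lia.
pose t := tperm (Ordinal j1M) (Ordinal jM).
have oddt : odd_perm t.
  by rewrite odd_tperm; apply/eqP => -[]; lia.
rewrite (bigID (@odd_perm _)) /=.
rewrite (reindex_inj (mulIg t)) /=.
rewrite [X in X + _](_ : _ = \sum_(s : 'S_M | ~~ odd_perm s)
   \det (label_mx l (fun k => kuhn_vertex x s (lift j k)))) ?F2_addrr //.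
apply: eq_big => [s|s _]; first by rewrite odd_permM oddt addbT.
congr (\det (label_mx l _)); apply/funext => k; apply/funext => i.
rewrite /kuhn_vertex permM; congr (_ + nat_of_bool _)%N.
have kj : lift j k != j :> nat by rewrite /= /bump; case: leqP; lia.
by case: tpermP => [->|->|] //=; move: kj; rewrite /=; lia.
Qed.

(** Composing an ordering with this cyclic shift leads from a simplex to its
    neighbour across the facet that misses its first vertex; the neighbour lies
    in the next cube along the coordinate of rank 0. *)
Definition pred_perm M : 'S_M := perm (can_inj (@ord_predK M)).

Definition ext_top M n (z : 'I_M -> nat) : 'I_M.+1 -> nat :=
  fun i => oapp z n (unlift ord_max i).

Definition grid_pt M n (x : {ffun 'I_M -> 'I_n.+1}) : 'I_M -> nat := fun i => x i.

(** The number of fully labelled simplices is odd. By label_det_facets it has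
    the parity of the number of facets carrying all labels but M. Inner facets
    cancel by inner_facets_cancel; facets which drop the first or the last
    vertex lie in a face of a cube and cancel between neighbouring cubes. What
    is left lies on the boundary of the grid. A face y i = 0 has no vertex with
    label i, and a face y i = n with i not the last coordinate has only labels
    up to i, so neither contributes. The face where the last coordinate equals n
    is the same problem in one dimension less. *)
Lemma kuhn_parity M n (l : ('I_M -> nat) -> nat) : (0 < n)%N ->
  (forall y, (l y <= M)%N) ->
  (forall y (i : 'I_M), y i = 0%N -> l y != i) ->
  (forall y (i : 'I_M), y i = n -> (l y <= i)%N) ->
  \sum_(s : 'S_M) \sum_(x : {ffun 'I_M -> 'I_n.+1} | [forall i, (x i < n)%N])
    \det (label_mx l (fun k : 'I_M.+1 => kuhn_vertex (grid_pt x) s k)) = 1.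
Proof.
move=> n0; elim: M l => [|M IH] l lM lA lB.
  rewrite (big_pred1 (1%g : 'S_0)); last first.
    by move=> s; apply/esym/eqP/permP; case.
  rewrite (big_pred1 [ffun=> ord0]); last first.
    move=> x; transitivity true; first by apply/forallP; case.
    by apply/esym/eqP/ffunP; case.
  by rewrite det_mx11 !mxE; have := lM (kuhn_vertex (@grid_pt 0 n [ffun=> ord0]) 1%g 0%N); rewrite leqn0 => ->.
pose g (y : {ffun 'I_M.+1 -> 'I_n.+1}) (s : 'S_M.+1) :=
  \det (label_mx l (fun k : 'I_M.+1 => kuhn_vertex (grid_pt y) s k)).
pose C2 (s : 'S_M.+1) (y : {ffun 'I_M.+1 -> 'I_n.+1}) :=
  [forall i, (s i != ord_max) ==> (y i < n)%N].
have baseE s (y : {ffun 'I_M.+1 -> 'I_n.+1}) : [forall i, (y i < n)%N] =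
    C2 s y && (y ((s^-1)%g ord_max) < n)%N.
  apply/forallP/andP => [h|[/forallP h1 h2] i].
    by split=> //; apply/forallP => i; rewrite h implybT.
  have [e|] := eqVneq (s i) ord_max; first by rewrite -(permK s i) e.
  exact/implyP.
have eq1 : \sum_(s : 'S_M.+1) \sum_(x : {ffun 'I_M.+1 -> 'I_n.+1} | [forall i, (x i < n)%N])
    \det (label_mx l (fun k : 'I_M.+2 => kuhn_vertex (grid_pt x) s k)) =
    \sum_(s : 'S_M.+1) (\sum_(y | C2 s y && (y ((s^-1)%g ord_max) != ord0)) g y s +
    \sum_(y : {ffun 'I_M.+1 -> 'I_n.+1} | [forall i, (y i < n)%N]) g y s).
  rewrite exchange_big /=.
  under eq_bigr => x _.
    under eq_bigr => s _ do rewrite label_det_facets //.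
    rewrite exchange_big /= big_ord_recl big_ord_recr /=.
    rewrite (big1 _ _ (fun i : 'I_M => \sum__ _)); last first.
      by move=> i _; apply: (@inner_facets_cancel M.+1 l (grid_pt x) (lift ord0 (widen_ord (leqnSn M) i))); rewrite /= /bump /=; have := ltn_ord i; lia.
    rewrite add0r.
    over.
  rewrite big_split /= big_split /=; congr (_ + _); last first.
    rewrite exchange_big /=; apply: eq_bigr => s _; apply: eq_bigr => y _.
    congr (\det (label_mx l _)); apply/funext => k; apply/funext => i.
    by rewrite /kuhn_vertex /grid_pt /= /bump /=; have := ltn_ord k; case: leqP; lia.
  (* The facet without the first vertex is the facet without the last vertex of
     the neighbouring simplex: pred_perm changes the ordering and h the cube. *)
  rewrite exchange_big /= [RHS](reindex_inj (mulIg (pred_perm M.+1))) /=.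
  apply: eq_bigr => s _.
  pose h (x : {ffun 'I_M.+1 -> 'I_n.+1}) : {ffun 'I_M.+1 -> 'I_n.+1} :=
    [ffun i => if s i == ord0 then ordS (x i) else x i].
  pose h' (x : {ffun 'I_M.+1 -> 'I_n.+1}) : {ffun 'I_M.+1 -> 'I_n.+1} :=
    [ffun i => if s i == ord0 then ord_pred (x i) else x i].
  have spE i : ((s * pred_perm M.+1)%g i == ord_max) = (s i == ord0).
    rewrite permM permE; apply/eqP/eqP => [/(congr1 val)|->].
      rewrite /=; move: (ltn_ord (s i)) => sM e; apply: val_inj => /=.
      case: (s i) sM e => /= -[//|m] mM _; rewrite addSn /= modnDr modn_small; lia.
    by apply: val_inj; rewrite /= modn_small.
  rewrite [RHS](reindex h) /=; last first.
    apply: onW_bij; exists h' => x; apply/ffunP => i; rewrite !ffunE; case: eqP => //.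
      by rewrite ordSK.
    by rewrite ord_predK.
  apply: eq_big => [x|x /forallP xn].
    apply/forallP/andP => [xn|[/forallP C x0] i].
      split.
        by apply/forallP => i; rewrite spE ffunE; case: eqP => //= _; rewrite xn.
      rewrite ffunE -spE permKV eqxx; apply/eqP => /(congr1 val) /=.
      by rewrite modn_small // ltnS xn.
    have := C i; rewrite spE ffunE; case: eqP => //= si0 _.
    have ei : ((s * pred_perm M.+1)^-1)%g ord_max = i.
      by rewrite -[RHS](permK (s * pred_perm M.+1)%g); congr (_ _); apply/esym/eqP; rewrite spE si0.
    move: x0; rewrite ei ffunE si0 eqxx => /eqP x0.
    rewrite ltn_neqAle -ltnS ltn_ord andbT; apply/eqP => xin; apply: x0.
    by apply: val_inj; rewrite /= xin modnn.
  congr (\det (label_mx l _)); apply/funext => k; apply/funext => i.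
  rewrite /kuhn_vertex /grid_pt /= ffunE permM permE.
  case: eqP => [->|/eqP] /=.
    by rewrite modn_small ?ltnS ?xn // modn_small //= /bump /=; have := ltn_ord k; lia.
  rewrite -val_eqE /=; have := ltn_ord (s i); have := ltn_ord k.
  case: (s i) => /= -[|m] // _ kM mM _.
  by rewrite addSn /= modnDr modn_small /bump /=; lia.
(* At height 0 the label of that coordinate is missing; at heights strictly
   between 0 and n the facet is counted twice; only height n remains. *)
have eq2 s : \sum_(y | C2 s y && (y ((s^-1)%g ord_max) != ord0)) g y s +
    \sum_(y : {ffun 'I_M.+1 -> 'I_n.+1} | [forall i, (y i < n)%N]) g y s =
    \sum_(y | C2 s y && (y ((s^-1)%g ord_max) == ord_max)) g y s.
  under [X in _ + X]eq_bigl => y do rewrite (baseE s).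
  rewrite !big_mkcondr -big_split /=; apply: eq_bigr => y Cy.
  have [y0|y0] := eqVneq (y ((s^-1)%g ord_max)) ord0.
    rewrite y0 n0 /= add0r -val_eqE /= eq_sym (gtn_eqF n0).
    apply: (@det_col0 _ _ _ ((s^-1)%g ord_max)) => k; rewrite mxE.
    rewrite (negbTE (lA (kuhn_vertex (grid_pt y) s k) ((s^-1)%g ord_max) _)) //.
    by rewrite /kuhn_vertex /grid_pt y0 permKV /= add0n ltnNge -ltnS ltn_ord.
  have [->|yn] := eqVneq (y ((s^-1)%g ord_max)) ord_max; first by rewrite /= ltnn addr0.
  rewrite ltn_neqAle -[(_ <= n)%N]ltnS ltn_ord andbT.
  by rewrite -val_eqE /= in yn; rewrite yn F2_addrr.
(* On a face y i = n all labels are at most i, so the largest one is missing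
   unless i is the last coordinate. *)
have eq3 (s : 'S_M.+1) : s ord_max != ord_max ->
    \sum_(y | C2 s y && (y ((s^-1)%g ord_max) == ord_max)) g y s = 0.
  move=> smax; apply: big1 => y /andP[_ /eqP yn].
  apply: (@det_col0 _ _ _ ord_max) => k; rewrite mxE.
  have lk : (l (kuhn_vertex (grid_pt y) s k) <= (s^-1)%g ord_max)%N.
    by apply: lB; rewrite /kuhn_vertex /grid_pt yn permKV ltnNge -ltnS ltn_ord addn0.
  have sm : (s^-1)%g ord_max != ord_max.
    by apply: contraNneq smax => e; rewrite -{1}e permKV.
  rewrite (_ : _ == _ = false) //; apply/negbTE.
  rewrite neq_ltn (leq_ltn_trans lk) // ltn_neqAle -ltnS ltn_ord andbT.
  by rewrite -val_eqE in sm.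
rewrite eq1; under eq_bigr => s _ do rewrite eq2.
rewrite (bigID (fun s : 'S_M.+1 => s ord_max == ord_max)) /= [X in _ + X]big1 ?addr0; last first.
  by move=> s; exact: eq3.
rewrite -[RHS](IH (fun z => l (ext_top n z))); first last.
- move=> z i zi; have := lB (ext_top n z) (lift ord_max i).
  by rewrite /ext_top liftK lift_max; exact.
- move=> z i zi; have := lA (ext_top n z) (lift ord_max i).
  by rewrite /ext_top liftK lift_max; exact.
- by move=> z; have := lB (ext_top n z) ord_max; rewrite /ext_top unlift_none; apply.
rewrite (reindex (lift_perm ord_max ord_max)); last first.
  pose ulsf (s : 'S_M.+1) k := odflt k (unlift ord_max (s (lift ord_max k))).
  have ulsfK (s : 'S_M.+1) (k : 'I_M) : s ord_max = ord_max ->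
      lift ord_max (ulsf s k) = s (lift ord_max k).
    move=> sm; rewrite /ulsf; have : ord_max != s (lift ord_max k).
      by rewrite -{1}sm (inj_eq perm_inj) neq_lift.
    by case/unlift_some => k' e ->; rewrite e.
  have inj_ulsf (s : 'S_M.+1) : injective (if s ord_max == ord_max then ulsf s else id).
    case: eqP => [sm|_] k1 k2 //; move=> /(congr1 (lift ord_max)); rewrite !ulsfK //.
    by move=> /perm_inj; exact: lift_inj.
  exists (fun s => perm (inj_ulsf s)) => [s _|s /eqP sm].
    apply/permP => k; rewrite permE; case: eqP; rewrite lift_perm_id // => _.
    by rewrite /ulsf lift_perm_lift liftK.
  apply/permP => k; have [k' ->|->] := unliftP ord_max k; last by rewrite lift_perm_id sm.
  by rewrite lift_perm_lift permE ifT ?sm// ulsfK.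
have invmax (s : 'S_M) : ((lift_perm ord_max ord_max s)^-1)%g ord_max = ord_max.
  by apply: (canLR (permK _)); rewrite lift_perm_id.
apply: eq_big => [s|s _]; first by rewrite lift_perm_id eqxx.
rewrite (reindex (fun z : {ffun 'I_M -> 'I_n.+1} =>
   [ffun i => oapp z ord_max (unlift ord_max i)])) /=; last first.
  exists (fun y => [ffun i => y (lift ord_max i)]) => [z _|y].
    by apply/ffunP => i; rewrite !ffunE liftK.
  rewrite inE invmax => /andP[_ /eqP yn].
  apply/ffunP => i; rewrite !ffunE.
  by have [k ->|->] := unliftP ord_max i; rewrite /= ?ffunE.
apply: eq_big => [z|z _].
  rewrite invmax ffunE unlift_none eqxx andbT.
  apply/forallP/forallP => [h i|h i].
    have := h (lift ord_max i); rewrite lift_perm_lift eq_sym neq_lift /=.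
    by rewrite ffunE liftK.
  have [k ->|->] := unliftP ord_max i; last by rewrite lift_perm_id eqxx.
  by rewrite ffunE liftK /= h implybT.
congr determinant; apply/matrixP => k a; rewrite !mxE; congr ((l _ == _)%:R).
apply/funext => i; rewrite /kuhn_vertex /grid_pt /ext_top ffunE.
have [j ->|->] := unliftP ord_max i; first by rewrite lift_perm_lift lift_max.
by rewrite lift_perm_id /= ltnNge -ltnS ltn_ord addn0.
Qed.

(** A simplex with nonzero label determinant carries every label from 0 to M;
    its vertices are all vertices of one cube of the grid. *)
Lemma kuhn M n (l : ('I_M -> nat) -> nat) : (0 < n)%N ->
  (forall y, (l y <= M)%N) ->
  (forall y (i : 'I_M), y i = 0%N -> l y != i) ->
  (forall y (i : 'I_M), y i = n -> (l y <= i)%N) ->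
  exists x : 'I_M -> nat, (forall i, (x i < n)%N) /\
    forall a, (a <= M)%N -> exists y, l y = a /\ forall i, (x i <= y i <= (x i).+1)%N.
Proof.
move=> n0 lM lA lB; have := kuhn_parity n0 lM lA lB.
have [[s [x xn dn0]] _|nex] := pselect (exists s : 'S_M,
   exists2 x : {ffun 'I_M -> 'I_n.+1}, [forall i, (x i < n)%N] &
   \det (label_mx l (fun k : 'I_M.+1 => kuhn_vertex (grid_pt x) s k)) <> 0).
  exists (grid_pt x); split; first by apply/forallP.
  move=> a aM; apply: contrapT => na; apply: dn0.
  apply: (@det_col0 _ _ _ (Ordinal (aM : (a < M.+1)%N))) => k; rewrite mxE.
  case: eqP => //= e; exfalso; apply: na; exists (kuhn_vertex (grid_pt x) s k); split=> // i.
  by rewrite /kuhn_vertex /grid_pt; case: (_ < _)%N; lia.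
rewrite big1 => [/eqP|s _]; first by rewrite eq_sym oner_eq0.
apply: big1 => x xn; apply: contrapT => dn0; apply: nex; exists s; exists x => //.
Qed.
End kuhn.

(** * Brouwer's fixed point theorem on a cube *)

Section brouwer.
Variable R : realType.

Definition cube (J : Type) (u : J -> R) := forall j, 0 <= u j <= 1.

(** A grid point is labelled by the first positive coordinate that f does not
    increase, or by M if there is none. The boundary conditions of kuhn hold
    because f maps the cube to itself. In a fully labelled cube, the vertex with
    label i shows that coordinate i is not increased somewhere, and the vertex
    with label M that no coordinate is decreased there. *)
Lemma discrete_brouwer M (f : ('I_M -> R) -> 'I_M -> R) n :
  (forall u, cube u -> cube (f u)) ->
  exists2 x : 'I_M -> R, cube x & forall i,
    (exists u, [/\ cube u, forall j, `|u j - x j| <= n.+1%:R^-1 & f u i <= u i]) /\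
    (exists u, [/\ cube u, forall j, `|u j - x j| <= n.+1%:R^-1 & u i <= f u i]).
Proof.
move=> fc; pose sc (y : 'I_M -> nat) j : R := (y j)%:R / n.+1%:R.
pose decr (y : 'I_M -> nat) i := (0 < y i)%N && ((n.+1 <= y i)%N || (f (sc y) i <= sc y i)).
pose l y := find (decr y) (enum 'I_M).
have nthE (i : 'I_M) : nth i (enum 'I_M) i = i by apply: nth_ord_enum.
have n1 : (0 : R) < n.+1%:R by rewrite ltr0n.
have [||||x [xn xP]] := @kuhn M n.+1 l.
- by [].
- by move=> y; rewrite -[X in (_ <= X)%N]size_enum_ord find_size.
- move=> y i yi; apply/eqP => li.
  have : has (decr y) (enum 'I_M) by rewrite has_find size_enum_ord -/(l y) li.
  by move=> /(nth_find i); rewrite -/(l y) li nthE /decr yi.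
- move=> y i yi; rewrite leqNgt; apply/negP => /(before_find i).
  by rewrite nthE /decr yi leqnn.
have scc (y : 'I_M -> nat) : (forall i, (x i <= y i <= (x i).+1)%N) -> cube (sc y).
  move=> xy j; rewrite divr_ge0 //= ler_pdivrMr // mul1r ler_nat.
  by have := xy j; have := xn j; lia.
have scd (y : 'I_M -> nat) : (forall i, (x i <= y i <= (x i).+1)%N) ->
    forall j, `|sc y j - sc x j| <= n.+1%:R^-1.
  move=> xy j; rewrite /sc -mulrBl normrM ger0_norm; last first.
    by rewrite subr_ge0 ler_nat; case/andP: (xy j).
  rewrite ger0_norm ?invr_ge0 // ler_piMl ?invr_ge0 // lerBlDr [1 + _]addrC natr1 ler_nat.
  by case/andP: (xy j).
exists (sc x); first by apply: scc => i; rewrite leqnn leqnSn.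
move=> i; split.
  have [y [ly xy]] := xP i (ltnW (ltn_ord i)).
  exists (sc y); split; [exact: scc|exact: scd|].
  have : has (decr y) (enum 'I_M) by rewrite has_find size_enum_ord -/(l y) ly.
  move=> /(nth_find i); rewrite -/(l y) ly nthE => /andP[_ /orP[ny|//]].
  have /andP[_ /le_trans] := fc _ (scc _ xy) i; apply.
  by rewrite ler_pdivlMr // mul1r ler_nat.
have [y [ly xy]] := xP M (leqnn M).
exists (sc y); split; [exact: scc|exact: scd|].
have : decr y i = false.
  by rewrite -{1}(nthE i); apply: before_find; rewrite -/(l y) ly.
move=> /negbT; rewrite negb_and negb_or => /orP[|/andP[_]].
  by rewrite -leqNgt leqn0 /sc => /eqP ->; rewrite mul0r; case/andP: (fc _ (scc _ xy) i).
by rewrite -ltNge => /ltW.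
Qed.

Lemma cube_cluster M (x : nat -> 'I_M -> R) : (forall n, cube (x n)) ->
  exists2 p : 'I_M -> R, cube p & forall n, exists2 k, (n <= k)%N &
    forall j, `|x k j - p j| < n.+1%:R^-1.
Proof.
move=> xc; pose X (n : nat) : 'rV[R]_M := \row_j x n j.
have cpt : compact [set v : 'rV[R]_M | forall j, `[0, 1]%classic (v 0 j)].
  by apply: (@rV_compact R M (fun=> `[0, 1]%classic)) => j; exact: segment_compact.
have XP n : [set v : 'rV[R]_M | forall j, `[0, 1]%classic (v 0 j)] (X n).
  by move=> j; rewrite /= mxE in_itv /=; exact: xc.
have [] := cpt (X @ \oo) _ _; first by exists 0%N => // n _; exact: XP.
move=> p [pc clp]; exists (p 0) => [j|n].
  by have := pc j; rewrite /= in_itv.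
have := clp (X @` [set k | (n <= k)%N]) (ball p n.+1%:R^-1).
case=> [||v [[k nk <-] [_ pk]]].
- by exists n => // k nk; exists k.
- by apply: nbhsx_ballx; rewrite invr_gt0.
exists k => // j; have := pk 0 j; rewrite /ball /= mxE distrC; exact.
Qed.

Lemma cvg_of_close_seq (a b : nat -> R) (p : R) :
  (forall n, `|a n - b n| <= n.+1%:R^-1) -> (forall n, `|b n - p| < n.+1%:R^-1) ->
  a n @[n --> \oo] --> p.
Proof.
move=> ab bp; apply/cvgrPdist_le => e e0.
have [k _ /(_ _ (leqnn _)) ke] :
    \forall k \near \oo, (k.+1%:R^-1 : R) < e / 2.
  by have := near_infty_natSinv_lt (PosNum (divr_gt0 e0 (ltr0n _ 2))).
exists k => // n /= kn; rewrite distrC (le_trans (ler_distD (b n) _ _)) //.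
have nk : n.+1%:R^-1 <= k.+1%:R^-1 :> R by rewrite lef_pV2 ?posrE ?ltr0n // ler_nat.
have := ab n; have := bp n; rewrite [e]splitr => /ltW b1 a1.
by rewrite lerD // (le_trans _ (ltW ke)) // (le_trans _ nk).
Qed.

(** The approximate fixed points of discrete_brouwer accumulate at a point p;
    passing to the limit in both inequalities gives f p <= p and p <= f p in
    each coordinate. *)
Theorem brouwer_ord M (f : ('I_M -> R) -> 'I_M -> R) :
  (forall u, cube u -> cube (f u)) ->
  (forall (u_ : nat -> 'I_M -> R) u, (forall n, cube (u_ n)) -> cube u ->
    (forall j, u_ n j @[n --> \oo] --> u j) ->
    forall j, f (u_ n) j @[n --> \oo] --> f u j) ->
  exists2 u, cube u & forall j, f u j = u j.
Proof.
move=> fc fcont.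
have /choice[x xP] n : exists x : 'I_M -> R, cube x /\ forall i,
    (exists u, [/\ cube u, forall j, `|u j - x j| <= n.+1%:R^-1 & f u i <= u i]) /\
    (exists u, [/\ cube u, forall j, `|u j - x j| <= n.+1%:R^-1 & u i <= f u i]).
  by have [x] := @discrete_brouwer M f n fc; exists x.
have [] := @cube_cluster M x; first by move=> n; case: (xP n).
move=> p pc pP; exists p => // i.
have /choice[k kP] : forall n, exists k, (n <= k)%N /\ forall j, `|x k j - p j| < n.+1%:R^-1.
  by move=> n; have [k] := pP n; exists k.
have nk n : (k n).+1%:R^-1 <= n.+1%:R^-1 :> R.
  by rewrite lef_pV2 ?posrE ?ltr0n // ler_nat ltnS; case: (kP n).
have lim (P : ('I_M -> R) -> Prop) :
    (forall n, exists u, [/\ cube u, forall j, `|u j - x n j| <= n.+1%:R^-1 & P u]) ->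
    exists2 u_ : nat -> 'I_M -> R, (forall n, P (u_ n)) &
       (forall j, u_ n j @[n --> \oo] --> p j) /\ (forall j, f (u_ n) j @[n --> \oo] --> f p j).
  move=> h; have /choice[u uP] := fun n => h (k n); exists u; first by move=> n; case: (uP n).
  have up j : u n j @[n --> \oo] --> p j.
    apply: (@cvg_of_close_seq _ (fun n => x (k n) j)) => n.
      by case: (uP n) => _ ux _; rewrite (le_trans (ux j)).
    by case: (kP n) => _; exact.
  by split=> //; apply: fcont => // n; case: (uP n).
apply/eqP; rewrite eq_le; apply/andP; split.
  have [|u uP [up fp]] := lim (fun u => f u i <= u i).
    by move=> n; case: (xP n) => _ /(_ i) [].
  by apply: (ler_cvg_to (fp i) (up i)); apply: nearW.
have [|u uP [up fp]] := lim (fun u => u i <= f u i).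
  by move=> n; case: (xP n) => _ /(_ i) [].
by apply: (ler_cvg_to (up i) (fp i)); apply: nearW.
Qed.

Theorem brouwer (J : finType) (f : (J -> R) -> J -> R) :
  (forall u, cube u -> cube (f u)) ->
  (forall (u_ : nat -> J -> R) u, (forall n, cube (u_ n)) -> cube u ->
    (forall j, u_ n j @[n --> \oo] --> u j) ->
    forall j, f (u_ n) j @[n --> \oo] --> f u j) ->
  exists2 u, cube u & forall j, f u j = u j.
Proof.
move=> fc fcont.
have [||v vc vP] := @brouwer_ord #|J|
   (fun v => f (v \o enum_rank) \o enum_val).
- by move=> u uc j /=; apply: fc => i; exact: uc.
- by move=> u_ u uc_ uc uu j /=; apply: fcont => // [n i|i|i]; [exact: uc_|exact: uc|exact: uu].
exists (v \o enum_rank); first by move=> j; exact: vc.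
by move=> j; have /= := vP (enum_rank j); rewrite enum_rankK.
Qed.
End brouwer.

(** * Lebesgue measure on row vectors *)

Section affine1.
Variable R : realType.
Local Open Scope ereal_scope.

Lemma measurable_affine1 (a b : R) :
  measurable_fun setT (fun r : measurableTypeR R => (a + b * r)%R : measurableTypeR R).
Proof. by apply: measurable_funD => //; apply: measurable_funM. Qed.

(** The image of Lebesgue measure under an affine map, scaled by the slope,
    agrees with Lebesgue measure on intervals. *)
Lemma ge0_integral_affine1 (f : measurableTypeR R -> \bar R) (a b : R) : b != 0%R ->
  measurable_fun setT f -> (forall x, 0 <= f x) ->
  `|b|%:E * \int[lebesgue_measure]_r f (a + b * r)%R = \int[lebesgue_measure]_r f r.
Proof.
move=> b0 mf f0; pose phi := fun r : measurableTypeR R => (a + b * r)%R : measurableTypeR R.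
have mphi : measurable_fun setT phi := measurable_affine1 a b.
pose nb := NngNum (normr_ge0 b).
pose nu := mscale nb (measure_function_pushforward__canonical__measure_function_Measure lebesgue_measure mphi).
have nuE A : measurable A -> lebesgue_measure A = nu A.
  apply: lebesgue_measure_unique => _ [[x y] _ <-] /=.
  change (lebesgue_measure `]x, y]%classic = `|b|%:E * lebesgue_measure (phi @^-1` `]x, y]%classic)).
  rewrite lebesgue_measure_itv /= lte_fin.
  have [bp|bn] : (0 < b \/ b < 0)%R by case: (ltgtP 0%R b) b0; [left|right|].
    rewrite (_ : phi @^-1` _ = `]((x - a) / b)%R, ((y - a) / b)%R]%classic); last first.
      apply/seteqP; split=> r /=; rewrite !in_itv /= /phi.
        by rewrite ltr_pdivrMr // ler_pdivlMr // ltrBlDl lerBrDl mulrC.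
      by rewrite ltr_pdivrMr // ler_pdivlMr // ltrBlDl lerBrDl mulrC.
    rewrite lebesgue_measure_itv /= lte_fin ltr_pM2r ?invr_gt0 // ltrD2r.
    case: ifP => _; last by rewrite mule0.
    by rewrite -!EFinB -EFinM ger0_norm ?ltW //; congr (_%:E); field; exact: lt0r_neq0.
  rewrite (_ : phi @^-1` _ = `[((y - a) / b)%R, ((x - a) / b)%R[%classic); last first.
    apply/seteqP; split=> r /=; rewrite !in_itv /= /phi.
      by rewrite ltr_ndivlMr // ler_ndivrMr // ltrBlDl lerBrDl mulrC andbC.
    by rewrite ltr_ndivlMr // ler_ndivrMr // ltrBlDl lerBrDl mulrC andbC.
  rewrite lebesgue_measure_itv /= lte_fin ltr_nM2r ?invr_lt0 // ltrD2r.
  case: ifP => _; last by rewrite mule0.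
  by rewrite -!EFinB -EFinM ltr0_norm //; congr (_%:E); field; rewrite lt_eqF.
rewrite [RHS](eq_measure_integral nu); last by move=> A mA _; exact: nuE.
rewrite ge0_integral_mscale //; congr (_ * _).
by rewrite ge0_integral_pushforward // => x _.
Qed.
End affine1.

Section rV.
Variable R : realType.
Local Open Scope ereal_scope.

Lemma continuous_measurable_rV d (f : 'rV[R]_d -> R) :
  continuous f -> measurable_fun setT f.
Proof.
move=> /continuousP cf; apply: (measurability (@RGenOpens.G R)).
  exact: RGenOpens.measurableE.
move=> _ [_ [a [b ->]] <-]; rewrite setTI; apply: open_measurable_mx.
by apply: cf; exact: interval_open.
Qed.

Lemma ge0_integral_rV_cons n (f : 'rV[R]_n.+1 -> \bar R) :
  measurable_fun setT f -> (forall x, 0 <= f x) ->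
  \int[lebesgue_rV R n.+1]_x f x =
  \int[lebesgue_measure]_r \int[lebesgue_rV R n]_y f (rV_cons (r, y)).
Proof.
move=> mf f0.
transitivity (\int[(lebesgue_measure \x lebesgue_rV R n)]_p f (rV_cons p)).
  rewrite -[LHS]/(\int[pushforward (lebesgue_measure \x lebesgue_rV R n) (@rV_cons R n)]_x f x).
  rewrite ge0_integral_pushforward //; exact: measurable_rV_cons.
rewrite fubini_tonelli1 //.
apply: measurableT_comp => //; exact: measurable_rV_cons.
Qed.

Lemma measurable_fun_rV_cons2 n r : measurable_fun setT (fun y : 'rV[R]_n => rV_cons (r, y)).
Proof.
apply: measurableT_comp; first exact: measurable_rV_cons.
exact: measurable_pair1.
Qed.

Lemma measurable_affine_rV n (a : 'rV[R]_n) (b : R) :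
  measurable_fun setT (fun y : 'rV[R]_n => (a + b *: y)%R).
Proof.
apply/measurable_fun_rVP => j.
under eq_fun do rewrite !mxE.
apply: measurable_funD => //; apply: measurable_funM => //.
exact: measurable_coord_rV.
Qed.

(** Induction on the dimension: Tonelli separates the first coordinate, where
    ge0_integral_affine1 applies. *)
Lemma ge0_integral_affine_rV n (f : 'rV[R]_n -> \bar R) (a : 'rV[R]_n) (b : R) :
  b != 0%R -> measurable_fun setT f -> (forall x, 0 <= f x) ->
  (`|b| ^+ n)%:E * \int[lebesgue_rV R n]_x f (a + b *: x)%R =
  \int[lebesgue_rV R n]_x f x.
Proof.
move=> b0; elim: n f a => [|n IH] f a mf f0.
  rewrite expr0 mul1e; apply: eq_integral => x _; congr f; by apply/rowP; case.
pose a' : 'rV[R]_n := (\row_j a 0 (lift ord0 j))%R.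
have consE r y : (a + b *: rV_cons (r, y))%R = rV_cons ((a 0 ord0 + b * r)%R, (a' + b *: y)%R).
  apply/rowP => i; rewrite !mxE.
  by have [j ->|->] := unliftP ord0 i; rewrite ?liftK ?unlift_none /= ?mxE.
have mF : measurable_fun setT (fun r : measurableTypeR R => \int[lebesgue_rV R n]_y f (rV_cons (r, y))).
  apply: (@measurable_fun_fubini_tonelli_F _ _ (measurableTypeR R) 'rV[R]_n R (lebesgue_rV R n) (f \o @rV_cons R n)); last first.
    by move=> x; exact: f0.
  apply: measurableT_comp => //; exact: measurable_rV_cons.
rewrite !ge0_integral_rV_cons //; last first.
  by apply: measurableT_comp => //; exact: measurable_affine_rV.
under eq_integral => r _ do under eq_integral => y _ do rewrite consE.
have IH' r : \int[lebesgue_rV R n]_y f (rV_cons ((a 0 ord0 + b * r)%R, (a' + b *: y)%R)) =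
    (`|b| ^- n)%:E * \int[lebesgue_rV R n]_y f (rV_cons ((a 0 ord0 + b * r)%R, y)).
  rewrite -(IH (fun y => f (rV_cons ((a 0 ord0 + b * r)%R, y))) a') //; last first.
    by apply: measurableT_comp => //; exact: measurable_fun_rV_cons2.
  by rewrite muleA -EFinM mulVf ?mul1e // expf_neq0 // normr_eq0.
under eq_integral => r _ do rewrite IH'.
rewrite ge0_integralZl //; last 2 first.
- exact: (measurableT_comp mF (measurable_affine1 (a 0 ord0)%R b)).
- by move=> r _; apply: integral_ge0.
rewrite -(ge0_integral_affine1 (a 0 ord0)%R b0 mF); last by move=> r; apply: integral_ge0.
by rewrite muleA -EFinM exprSr mulrAC mulfV ?mul1r // expf_neq0 // normr_eq0.
Qed.

Lemma integrable_affine_rV n (f : 'rV[R]_n -> \bar R) (a : 'rV[R]_n) (b : R) :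
  b != 0%R -> (lebesgue_rV R n).-integrable setT f ->
  (lebesgue_rV R n).-integrable setT (fun x => f (a + b *: x)%R).
Proof.
move=> b0 /integrableP[mf fi]; apply/integrableP; split.
  by apply: measurableT_comp => //; exact: measurable_affine_rV.
have mnf : measurable_fun setT (fun x => `|f x|) by apply: measurableT_comp.
have := ge0_integral_affine_rV a b0 mnf (fun x => abse_ge0 _) => e.
move: fi; rewrite -e; set I := integral _ _ _ => fi.
have I0 : 0 <= I by apply: integral_ge0.
rewrite ltey; apply/eqP => Ioo; move: fi; rewrite Ioo mulry gtr0_sg ?mul1e ?ltxx //.
by rewrite exprn_gt0 // normr_gt0.
Qed.

Lemma integral_affine_rV n (f : 'rV[R]_n -> \bar R) (a : 'rV[R]_n) (b : R) :
  b != 0%R -> (lebesgue_rV R n).-integrable setT f ->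
  \int[lebesgue_rV R n]_x f (a + b *: x)%R =
  (`|b| ^- n)%:E * \int[lebesgue_rV R n]_x f x.
Proof.
move=> b0 fi; have b1 : (`|b| ^+ n != 0)%R by rewrite expf_neq0 // normr_eq0.
have aux g : measurable_fun setT g -> (forall x, 0 <= g x) ->
    \int[lebesgue_rV R n]_x g (a + b *: x)%R =
    (`|b| ^- n)%:E * \int[lebesgue_rV R n]_x g x.
  move=> mg g0; rewrite -(ge0_integral_affine_rV a b0 mg g0) muleA -EFinM.
  by rewrite mulVf ?mul1e.
have mf := measurable_int _ fi.
rewrite [in RHS]integralE muleBr //; last exact: integrable_add_def.
rewrite -!aux //.
- rewrite [LHS]integralE; congr (_ - _); by apply: eq_integral => x _; rewrite ?funeposE ?funenegE.
- exact: measurable_funeneg.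
- exact: measurable_funepos.
Qed.

(** By Fubini: when l is the first coordinate the sections of A along it have at
    most one point; otherwise the sections at fixed first coordinate are null by
    induction on the dimension. *)
Lemma null_of_thin_lines n (l : 'I_n) (A : set 'rV[R]_n) : measurable A ->
  (forall x s, A x -> A (x + s *: delta_mx 0 l)%R -> s = 0%R) ->
  lebesgue_rV R n A = 0.
Proof.
elim: n l A => [[] //|n IH] l A mA Al.
have mA' : measurable (@rV_cons R n @^-1` A).
  by rewrite -[X in measurable X]setTI; exact: measurable_rV_cons.
rewrite -[LHS]/((lebesgue_measure \x lebesgue_rV R n) (@rV_cons R n @^-1` A)).
have [j lE|lE] := unliftP ord0 l.
  rewrite /product_measure1 /=; under eq_integral => r _.
    rewrite (IH j); first over.
      exact: measurable_xsection.
    move=> x s; rewrite /xsection /= !inE /= => Ax Axs; apply: (Al _ _ Ax).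
    move: Axs; congr A; apply/rowP => i; rewrite !mxE lE.
    by have [k ->|->] := unliftP ord0 i; rewrite ?liftK ?unlift_none /= ?mxE ?(inj_eq lift_inj) ?(negbTE (neq_lift _ _)) /= ?mulr0 ?addr0.
  by rewrite integral0.
(* The product measure is now computed through sections along the first
   coordinate. *)
have -> : (lebesgue_measure \x lebesgue_rV R n) (@rV_cons R n @^-1` A) =
    (lebesgue_measure \x^ lebesgue_rV R n) (@rV_cons R n @^-1` A).
  by apply: product_measure_unique => //= *; rewrite product_measure2E.
rewrite /product_measure2 /=; under eq_integral => y _.
  rewrite (_ : lebesgue_measure _ = 0); first over.
  have cnt : countable (ysection (@rV_cons R n @^-1` A) y).
    have [->|/set0P[r0 r0A]] := eqVneq (ysection (@rV_cons R n @^-1` A) y) set0.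
      exact: countable0.
    apply: (@sub_countable _ _ _ [set r0]) => //; apply: subset_card_le => r rA.
    move: r0A rA; rewrite /ysection /= !inE /= => Ax Axs.
    suff : (r - r0)%R = 0%R by move/eqP; rewrite subr_eq0 => /eqP.
    apply: (Al _ _ Ax); move: Axs; congr A; apply/rowP => i; rewrite !mxE lE.
    by have [k ->|->] := unliftP ord0 i; rewrite ?liftK ?unlift_none /= ?mxE ?eqxx ?mulr0 ?addr0 // mulr1 subrKC.
  exact: countable_lebesgue_measure0.
by rewrite integral0.
Qed.

End rV.

(** * Directional derivatives *)

Section bigop_cvg.
Context {R : realType} {T : Type} {F : set_system T} {FF : Filter F}.

Lemma cvg_bigsum (I : Type) (s : seq I) (P : pred I) (f : I -> T -> R) (l : I -> R) :
  (forall i, P i -> f i t @[t --> F] --> l i) ->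
  (\sum_(i <- s | P i) f i t) @[t --> F] --> \sum_(i <- s | P i) l i.
Proof.
move=> H; elim: s => [|i s IH].
  under eq_cvg => t do rewrite big_nil.
  by rewrite big_nil; exact: cvg_cst.
under eq_cvg => t do rewrite big_cons.
rewrite big_cons; case: ifPn => // Pi.
by apply: cvgD => //; exact: H.
Qed.

End bigop_cvg.

Section directional.
Context {R : realType} {V : normedModType R}.
Implicit Types (f : V -> R) (x u v : V).

Lemma continuous_of_modulus f x :
  (forall e : R, 0 < e -> exists2 r : R, 0 < r &
    forall y, `|x - y| < r -> `|f x - f y| <= e) -> {for x, continuous f}.
Proof.
move=> H; apply/cvgrPdist_le => e /H[r r0 rP]; near=> y; apply: rP.
by near: y; apply: cvgr_dist_lt => //; exact: cvg_id.
Unshelve. all: by end_near. Qed.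

(** A form of the derivative without quotients, in which the increment need not
    be nonzero. *)
Lemma is_derive_approx f x v (c : R) :
  (forall e : R, 0 < e -> exists2 r : R, 0 < r & forall h, `|h| < r ->
    `|f (x + h *: v) - f x - h * c| <= e * `|h|) ->
  is_derive x v f c.
Proof.
move=> H; suff cv : (fun h => h^-1 *: ((f \o shift x) (h *: v) - f x)) @ 0^' --> c.
  by split; [apply/cvg_ex; exists c|exact: cvg_lim].
apply/cvgrPdist_le => e e0; have [r r0 rP] := H _ e0.
near=> h; have h0 : h != 0 by near: h; exact: nbhs_dnbhs_neq.
have hr : `|h| < r.
  near: h; apply: dnbhs0_lt => //.
rewrite distrC /= [h *: v + x]addrC.
have -> : h^-1 *: (f (x + h *: v) - f x) - c = h^-1 * (f (x + h *: v) - f x - h * c).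
  by rewrite [RHS]mulrBr mulKf.
by rewrite normrM normfV mulrC ler_pdivrMr ?normr_gt0 // rP.
Unshelve. all: by end_near. Qed.

Lemma is_derive_quadratic f x v (c C : R) : 0 <= C ->
  (forall h, `|f (x + h *: v) - f x - h * c| <= C * `|h| ^+ 2) ->
  is_derive x v f c.
Proof.
move=> C0 H; apply: is_derive_approx => e e0.
exists (e / (C + 1)); first by rewrite divr_gt0 // ltr_wpDl.
move=> h; rewrite ltr_pdivlMr ?ltr_wpDl // => he.
apply: (le_trans (H h)); rewrite expr2 mulrA ler_wpM2r //.
by have := normr_ge0 h; nra.
Qed.

Lemma is_derive_line f x v (t : R) : derivable f (x + t *: v) v ->
  is_derive t (1 : R) (fun s => f (x + s *: v)) ('D_v f (x + t *: v)).
Proof.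
move=> df.
have E : (fun h : R => h^-1 *: (((fun s => f (x + s *: v)) \o shift t) (h *: (1 : R)) - f (x + t *: v)))
  = (fun h : R => h^-1 *: ((f \o shift (x + t *: v)) (h *: v) - f (x + t *: v))).
  apply/funext => h /=; congr (_ *: (f _ - _)).
  by rewrite -[h *: 1]/(h * 1) mulr1 scalerDl addrCA.
by split; rewrite /derivable /derive E.
Qed.

Lemma derive_mvt f x v (h : R) : (forall y, derivable f y v) ->
  exists2 t : R, 0 <= t <= 1 &
    f (x + h *: v) - f x = h * 'D_v f (x + (t * h) *: v).
Proof.
move=> df; pose phi s := f (x + s *: v); pose dphi s := 'D_v f (x + s *: v).
have dp s : is_derive s (1 : R) phi (dphi s) by apply: is_derive_line.
have cp : continuous phi.
  by move=> s; apply: differentiable_continuous; apply/derivable1_diffP; case: (dp s).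
have mvt a b : a < b -> exists2 c, a < c < b & phi b - phi a = dphi c * (b - a).
  move=> ab; have [|c] := @MVT R phi dphi a b ab (fun s _ => dp s).
    exact: continuous_subspaceT.
  by rewrite in_itv /=; exists c.
have [h0|h0|->] := ltgtP h 0.
- have [c /andP[hc c0]] := mvt _ _ h0.
  rewrite /phi /dphi scale0r addr0 sub0r => e.
  exists (c / h); first by rewrite ler_ndivlMr // ler_ndivrMr // mul0r mul1r !ltW.
  by rewrite divfK ?lt_eqF // -opprB e mulrC mulNr opprK.
- have [c /andP[c0 ch]] := mvt _ _ h0.
  rewrite /phi /dphi scale0r addr0 subr0 => e.
  exists (c / h); first by rewrite ler_pdivlMr // ler_pdivrMr // mul0r mul1r !ltW.
  by rewrite divfK ?gt_eqF // e mulrC.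
- by exists 0; rewrite ?lexx ?ler01 // scale0r addr0 subrr mul0r.
Qed.

Lemma deriveScaledir f x v (k : R) : (forall y, derivable f y v) ->
  (forall y, {for y, continuous ('D_v f)}) ->
  is_derive x (k *: v) f (k * 'D_v f x).
Proof.
move=> df cf; apply: is_derive_approx => e e0.
have e1 : 0 < e / (`|k| + 1) by rewrite divr_gt0 // ltr_wpDl.
have /cvgrPdist_lt/(_ _ e1)/nbhs_ballP[r /= r0 rP] := cf x.
exists (r / (`|k| * `|v| + 1)).
  by rewrite divr_gt0 // ltr_wpDl // mulr_ge0.
move=> h; rewrite ltr_pdivlMr ?ltr_wpDl ?mulr_ge0 // => hr.
rewrite scalerA; have [t /andP[t0 t1] ->] := derive_mvt x (h * k) df.
rewrite -!mulrA -mulrBr -mulrBr !normrM mulrC ler_wpM2r //.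
set y := x + _; have /rP : ball x r y.
  rewrite -ball_normE /= /y opprD addrA subrr sub0r normrN normrZ !normrM ger0_norm //.
  have := normr_ge0 h; have := normr_ge0 k; have := normr_ge0 v.
  move=> v0 k0 h0; have : 0 <= `|h| * (`|k| * `|v|) by rewrite !mulr_ge0.
  nra.
rewrite distrC ltr_pdivlMr ?ltr_wpDl // => yP.
by have := normr_ge0 ('D_v f y - 'D_v f x); have := normr_ge0 k; nra.
Qed.

(** The derivatives are required to be continuous for each fixed direction,
    which is what iterated directional derivatives provide; linearity in the
    direction follows, see derive_sumdir. *)
Definition C1 f := (forall v x, derivable f x v) /\ (forall v, continuous ('D_v f)).

(** The increment along u + v is split into an increment along u followed by one
    along v; the mean value theorem evaluates both at nearby points, where the
    directional derivatives are close to their values at x. *)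
Lemma deriveDdir f x u v : C1 f -> 'D_(u + v) f x = 'D_u f x + 'D_v f x.
Proof.
move=> [df cf]; suff : is_derive x (u + v) f ('D_u f x + 'D_v f x).
  by move=> H; rewrite derive_val.
apply: is_derive_approx => e e0.
have e1 : 0 < e / 2 by lra.
have /cvgrPdist_lt/(_ _ e1)/nbhs_ballP[r1 /= r10 r1P] := cf u x.
have /cvgrPdist_lt/(_ _ e1)/nbhs_ballP[r2 /= r20 r2P] := cf v x.
have uv1 : 0 < `|u| + `|v| + 1 by have := normr_ge0 u; have := normr_ge0 v; lra.
pose r := Num.min r1 r2; have r0 : 0 < r by rewrite lt_min r10.
exists (r / (`|u| + `|v| + 1)); first by rewrite divr_gt0.
move=> h; rewrite ltr_pdivlMr // => hr.
have [t t01 e1t] := derive_mvt x h (df u).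
have [s s01 e1s] := derive_mvt (x + h *: u) h (df v).
set y := x + (t * h) *: u in e1t; set z := x + h *: u + (s * h) *: v in e1s.
have -> : f (x + h *: (u + v)) - f x - h * ('D_u f x + 'D_v f x) =
   h * ('D_u f y - 'D_u f x) + h * ('D_v f z - 'D_v f x).
  by rewrite [RHS]addrC !mulrBr -e1t -e1s scalerDr addrA; ring.
have bnd (w : V) (q : R) : 0 <= q <= 1 -> `|(q * h) *: w| <= `|h| * `|w|.
  move=> /andP[q0 q1]; rewrite normrZ normrM ger0_norm // -mulrA.
  by rewrite ler_piMl // mulr_ge0.
have := normr_ge0 h => hh0.
have yr : `|'D_u f x - 'D_u f y| < e / 2.
  apply: r1P; rewrite -ball_normE /= /y opprD addrA subrr sub0r normrN.
  apply: le_lt_trans (bnd u _ t01) _; move: hr; rewrite /r lt_min => /andP[hr _].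
  by have := normr_ge0 u; have := normr_ge0 v; nra.
have zr : `|'D_v f x - 'D_v f z| < e / 2.
  apply: r2P; rewrite -ball_normE /= /z -addrA opprD addrA subrr sub0r normrN.
  apply: le_lt_trans (ler_normD _ _) _; rewrite normrZ.
  apply: le_lt_trans (lerD (lexx _) (bnd v _ s01)) _.
  move: hr; rewrite /r lt_min => /andP[_ hr].
  by have := normr_ge0 u; have := normr_ge0 v; nra.
apply: le_trans (ler_normD _ _) _; rewrite !normrM -mulrDr mulrC ler_wpM2r //.
by rewrite distrC in yr; rewrite distrC in zr; lra.
Qed.

Lemma deriveZdir f x v (k : R) : C1 f -> 'D_(k *: v) f x = k * 'D_v f x.
Proof.
move=> [df cf]; have := deriveScaledir x k (df v) (cf v).
by move=> H; rewrite derive_val.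
Qed.

Lemma derive_sumdir f x (I : Type) (s : seq I) (c : I -> R) (v : I -> V) : C1 f ->
  'D_(\sum_(i <- s) c i *: v i) f x = \sum_(i <- s) c i * 'D_(v i) f x.
Proof.
move=> Cf; elim: s => [|i s IH]; first by rewrite !big_nil derive0.
by rewrite !big_cons deriveDdir // deriveZdir // IH.
Qed.

Lemma taylor2 f x v (k : R) : (forall y, derivable f y v) ->
  (forall y, derivable ('D_v f) y v) ->
  (forall y, k <= 'D_v ('D_v f) y) ->
  f x + 'D_v f x + k / 2 <= f (x + v).
Proof.
move=> df ddf kf.
pose psi s := f (x + s *: v) - s * 'D_v f x - k / 2 * s ^+ 2.
pose dpsi s := 'D_v f (x + s *: v) - 'D_v f x - k * s.
have dp (s : R) : is_derive s (1 : R) psi (dpsi s).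
  have H := is_derive_line (df (x + s *: v)).
  rewrite /psi /dpsi.
  apply: is_derive_eq; rewrite scaler0 add0r.
  rewrite -['D_v f x *: 1]/('D_v f x * 1) -[s *: 1]/(s * 1) !mulr1.
  by rewrite -[_ *: (s + s)]/((k / 2) * (s + s)); congr (_ - _); field.
have cp : continuous psi.
  by move=> s; apply: differentiable_continuous; apply/derivable1_diffP; case: (dp s).
have [|c] := @MVT R psi dpsi 0 1 ltr01 (fun s _ => dp s).
  exact: continuous_subspaceT.
rewrite in_itv /= => /andP[c0 c1]; rewrite subr0 mulr1 /psi /dpsi.
rewrite scale0r scale1r addr0 mul0r mul1r expr1n expr0n /= mulr0 mulr1 !subr0.
have [t t01 e] := derive_mvt x c ddf.
have := kf (x + (t * c) *: v); rewrite e; nra.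
Qed.

End directional.

(** * Euclidean and maximum norms *)

Section norms.
Context {R : realType} {d : nat}.
Implicit Types x y : 'rV[R]_d.

Lemma ler_coord_norm x j : `|x 0 j| <= `|x|.
Proof.
rewrite [leRHS]/Num.norm /= mx_normrE.
exact: (le_bigmax _ (fun ij : 'I_1 * 'I_d => `|x ij.1 ij.2|) (0, j)).
Qed.

Lemma norm_le_coord x (r : R) : 0 <= r -> (forall j, `|x 0 j| <= r) -> `|x| <= r.
Proof.
move=> r0 H; rewrite [leLHS]/Num.norm /=.
have [->//|/mx_norm_neq0[[i j] ->]] := eqVneq (mx_norm x) 0.
by rewrite (ord1 i) /=.
Qed.

Lemma dotp_ge0 x : 0 <= dotp x x.
Proof. by apply: sumr_ge0 => i _; rewrite -expr2 sqr_ge0. Qed.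

Lemma sqr_enorm x : enorm x ^+ 2 = dotp x x.
Proof. by rewrite /enorm sqr_sqrtr // dotp_ge0. Qed.

Lemma dotpC x y : dotp x y = dotp y x.
Proof. by apply: eq_bigr => i _; rewrite mulrC. Qed.

Lemma dotpDl x x' y : dotp (x + x') y = dotp x y + dotp x' y.
Proof. by rewrite -big_split; apply: eq_bigr => i _; rewrite mxE mulrDl. Qed.

Lemma dotpZl k x y : dotp (k *: x) y = k * dotp x y.
Proof. by rewrite mulr_sumr; apply: eq_bigr => i _; rewrite mxE mulrA. Qed.

Lemma dotpNl x y : dotp (- x) y = - dotp x y.
Proof. by rewrite -scaleN1r dotpZl mulN1r. Qed.

Lemma dotpBl x x' y : dotp (x - x') y = dotp x y - dotp x' y.
Proof. by rewrite dotpDl dotpNl. Qed.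

Lemma dotpDr x y y' : dotp x (y + y') = dotp x y + dotp x y'.
Proof. by rewrite dotpC dotpDl !(dotpC x). Qed.

Lemma dotpZr k x y : dotp x (k *: y) = k * dotp x y.
Proof. by rewrite dotpC dotpZl dotpC. Qed.

Lemma dotpNr x y : dotp x (- y) = - dotp x y.
Proof. by rewrite dotpC dotpNl dotpC. Qed.

Lemma dotpBr x y y' : dotp x (y - y') = dotp x y - dotp x y'.
Proof. by rewrite dotpDr dotpNr. Qed.

Lemma dotp_delta x j : dotp x (delta_mx 0 j) = x 0 j.
Proof.
rewrite /dotp (bigD1 j) //= mxE !eqxx mulr1 big1 ?addr0 // => i ij.
by rewrite mxE (negbTE ij) andbF mulr0.
Qed.

Lemma norm_dotp x y : `|dotp x y| <= d%:R * (`|x| * `|y|).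
Proof.
apply: le_trans (ler_norm_sum _ _ _) _.
rewrite -[d in d%:R]card_ord mulr_natl -sumr_const; apply: ler_sum => i _.
by rewrite normrM ler_pM // ler_coord_norm.
Qed.

Lemma norm_le_enorm x : `|x| <= enorm x.
Proof.
apply: norm_le_coord => [|j]; first exact: sqrtr_ge0.
rewrite -sqrtr_sqr ler_sqrt ?dotp_ge0 // /dotp (bigD1 j) //= -expr2 lerDl.
by apply: sumr_ge0 => i _; rewrite -expr2 sqr_ge0.
Qed.

Lemma enorm_le x : enorm x <= d%:R * `|x|.
Proof.
rewrite -[leRHS]ger0_norm ?mulr_ge0 // -sqrtr_sqr ler_sqrt ?sqr_ge0 //.
apply: le_trans (ler_norm _) _; apply: le_trans (norm_dotp x x) _.
rewrite exprMn -expr2 ler_wpM2r ?sqr_ge0 //.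
case: (d) => [|n]; first by rewrite expr0n.
by rewrite -natrX ler_nat -{1}[n.+1]expn1 leq_pexp2l.
Qed.

Lemma rV_sum_delta x : x = \sum_j x 0 j *: delta_mx 0 j.
Proof. exact: row_sum_delta. Qed.

End norms.

(** * The gradient of the Hamiltonian *)

Section hamiltonian.
Context {R : realType} {d : nat}.
Variable L : 'rV[R]_d -> 'rV[R]_d -> R.
Let U := fun z : 'rV[R]_d * 'rV[R]_d => L z.1 z.2.
Hypothesis LC2 : class_C 2 U.
Variable kap : R.
Hypothesis kap0 : 0 < kap.
Hypothesis Lcvx : forall x a b, kap * enorm b ^+ 2 <= dotp (b *m hess (L x) a) b.

Lemma lagrangian_C1 : C1 U.
Proof.
case: LC2 => cU dU; split=> v.
  by move=> x; exact: (dU [::] v x isT).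
exact: (cU [:: v] isT).
Qed.

Lemma lagrangian_derive_C1 v : C1 ('D_v U).
Proof.
case: LC2 => cU dU; split=> w.
  by move=> x; exact: (dU [:: v] w x isT).
exact: (cU [:: w; v] isT).
Qed.

Lemma derive_slice2 (g : 'rV[R]_d * 'rV[R]_d -> R) x a b :
  'D_b (fun a => g (x, a)) a = 'D_(0, b) g (x, a).
Proof.
have E : (fun h : R => h^-1 *: (((fun a => g (x, a)) \o shift a) (h *: b) - g (x, a))) =
    (fun h : R => h^-1 *: ((g \o shift (x, a)) (h *: (0, b)) - g (x, a))).
  apply/funext => h /=; congr (_ *: (g _ - _)); congr pair.
  by rewrite /= scaler0 add0r.
by rewrite /derive E.
Qed.

Lemma pair2_sum (b : 'rV[R]_d) :
  ((0, b) : 'rV[R]_d * 'rV[R]_d) = \sum_j b 0 j *: (0, delta_mx 0 j).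
Proof.
rewrite {1}(rV_sum_delta b).
elim/big_rec2: _ => // i y1 y2 _ <-; congr pair => /=.
by rewrite scaler0 add0r.
Qed.

Lemma pair1_sum (b : 'rV[R]_d) :
  ((b, 0) : 'rV[R]_d * 'rV[R]_d) = \sum_j b 0 j *: (delta_mx 0 j, 0).
Proof.
rewrite {1}(rV_sum_delta b).
elim/big_rec2: _ => // i y1 y2 _ <-; congr pair => /=.
by rewrite scaler0 add0r.
Qed.

Lemma lagrangian_derive_sum b z : 'D_(0, b) U z = \sum_l b 0 l * 'D_(0, delta_mx 0 l) U z.
Proof. by rewrite pair2_sum derive_sumdir //; exact: lagrangian_C1. Qed.

(** The Hessian in the control variable as a second directional derivative of L
    on the product space, so that the Taylor formula along lines applies. *)
Lemma hess_quad x a b :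
  dotp (b *m hess (L x) a) b = 'D_(0, b) ('D_(0, b) U) (x, a).
Proof.
rewrite {2}pair2_sum derive_sumdir; last exact: lagrangian_derive_C1.
rewrite /dotp.
under eq_bigr => l _ do rewrite mxE mulr_suml.
rewrite exchange_big /=; apply: eq_bigr => k _.
have -> : 'D_(0, b) U = \sum_(l < d) (b 0 l *: 'D_(0, delta_mx 0 l) U).
  apply/funext => z; rewrite lagrangian_derive_sum.
  by rewrite fct_sumE; apply: eq_bigr => l _.
rewrite derive_sum; last first.
  by move=> l; apply: derivableZ; case: (lagrangian_derive_C1 (0, delta_mx 0 l)).
rewrite mulr_sumr; apply: eq_bigr => l _.
rewrite deriveZ; last by case: (lagrangian_derive_C1 (0, delta_mx 0 l)).
have -> : hess (L x) a k l = 'D_(0, delta_mx 0 k) ('D_(0, delta_mx 0 l) U) (x, a).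
  have E : 'D_(delta_mx 0 l) (L x) = (fun a' => 'D_(0, delta_mx 0 l) U (x, a')).
    by apply/funext => a'; rewrite -(derive_slice2 U).
  by rewrite /hess mxE E (derive_slice2 ('D_(0, delta_mx 0 l) U)).
rewrite -mulrA; congr (_ * _).
rewrite mulrC; reflexivity.
Qed.

Lemma lagrangian_taylor x a v :
  L x a + 'D_(0, v) U (x, a) + kap * enorm v ^+ 2 / 2 <= L x (a + v).
Proof.
have := @taylor2 R _ U (x, a) (0, v) (kap * enorm v ^+ 2) _ _ _.
have -> : (x, a) + (0, v) = (x, a + v) :> 'rV[R]_d * 'rV[R]_d.
  by congr pair; rewrite addr0.
apply=> [y|y|[y b]]; first by case: lagrangian_C1.
  by case: (lagrangian_derive_C1 (0, v)).
by rewrite -hess_quad.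
Qed.

(** Uniform convexity: the Taylor lower bounds at the midpoint in two opposite
    directions are added, and the first order terms cancel. *)
Lemma lagrangian_midpoint (x a b : 'rV[R]_d) :
  L x (2^-1 *: (a + b)) <= (L x a + L x b) / 2 - kap / 8 * enorm (b - a) ^+ 2.
Proof.
set m : 'rV[R]_d := 2^-1 *: _; pose w : 'rV[R]_d := 2^-1 *: (b - a).
have aE : a = m + - w.
  by apply/rowP => j; rewrite !mxE; field.
have bE : b = m + w by apply/rowP => j; rewrite !mxE; field.
have h1 := lagrangian_taylor x m w; have h2 := lagrangian_taylor x m (- w).
rewrite -bE in h1; rewrite -aE in h2.
have -> : enorm (b - a) ^+ 2 = 4 * enorm w ^+ 2.
  by rewrite !sqr_enorm /w dotpZl dotpZr; field.
have e1 : enorm (- w) ^+ 2 = enorm w ^+ 2.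
  by rewrite !sqr_enorm -scaleN1r dotpZl dotpZr !mulN1r opprK.
have e2 : 'D_(0, - w) U (x, m) = - 'D_(0, w) U (x, m).
  rewrite -mulN1r -deriveZdir; last exact: lagrangian_C1.
  by congr ('D__ _ _); congr pair; rewrite /= ?scaler0 ?scaleN1r.
rewrite e1 e2 in h2; clear aE bE; lra.
Qed.

Lemma continuous_slice2 (g : 'rV[R]_d * 'rV[R]_d -> R) x :
  continuous g -> continuous (fun a => g (x, a)).
Proof.
move=> cg a; apply: (@continuous_comp _ _ _ (fun a => (x, a)) g); last exact: cg.
move=> P [[A B] /= [xA aB] ABP]; apply: filterS aB => b Bb.
by apply: ABP; split => //=; exact: nbhs_singleton xA.
Qed.

Lemma box_compact (r : R) : compact [set x : 'rV[R]_d | `|x| <= r].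
Proof.
have -> : [set x : 'rV[R]_d | `|x| <= r] = closed_ball_ Num.norm 0 r.
  by apply/seteqP; split=> x /=; rewrite /closed_ball_ /= sub0r normrN.
apply: bounded_closed_compact.
  exists r; split; first exact: num_real.
  by move=> s rs x; rewrite /= /closed_ball_ /= sub0r normrN => /le_trans; apply; exact: ltW.
exact: closed_closed_ball_.
Qed.

Lemma bounded_on_box2 (g : 'rV[R]_d * 'rV[R]_d -> R) (r s : R) : continuous g ->
  exists2 M : R, 0 <= M & forall x a, `|x| <= r -> `|a| <= s -> `|g (x, a)| <= M.
Proof.
move=> cg; have cpt := compact_setX (@box_compact r) (@box_compact s).
have : compact (g @` ([set x : 'rV[R]_d | `|x| <= r] `*` [set x : 'rV[R]_d | `|x| <= s])).
  by apply: continuous_compact => //; exact: continuous_subspaceT.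
move=> /compact_bounded/pinfty_ex_gt0[M M0 HM]; exists M; first exact: ltW.
by move=> x a xr as_; apply: HM; exists (x, a).
Qed.

(** The supremum defining the Hamiltonian at p is minus the infimum of this
    function of a. *)
Definition tilt x p a : R := L x a - dotp a p.

Definition is_min x p a := forall b, tilt x p a <= tilt x p b.

(** Compare the minimum with the value at the midpoint of a and b, and use
    lagrangian_midpoint. *)
Lemma min_growth x p a : is_min x p a -> forall b,
  tilt x p a + kap / 4 * enorm (b - a) ^+ 2 <= tilt x p b.
Proof.
move=> mina b; have := mina (2^-1 *: (a + b)); have := lagrangian_midpoint x a b.
by rewrite /tilt dotpZl dotpDl; lra.
Qed.

(** Since L grows quadratically in a, uniformly for x in a box, competitors
    outside a fixed box are worse than 0. *)
Lemma tilt_coercive (r P : R) : 0 <= P ->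
  exists2 A : R, 0 < A & forall x p a, `|x| <= r -> `|p| <= P -> A < `|a| ->
    tilt x p 0 < tilt x p a.
Proof.
move=> P0.
have /choice[B BP] : forall l : 'I_d, exists B : R, 0 <= B /\
    forall x, `|x| <= r -> `|'D_(0, delta_mx 0 l) U (x, 0)| <= B.
  move=> l; have [|M M0 H] := @bounded_on_box2 ('D_(0, delta_mx 0 l) U) r 0.
    by case: lagrangian_C1 => _; apply.
  by exists M; split=> // x xr; apply: H; rewrite ?normr0.
pose S := \sum_l B l + d%:R * P.
have S0 : 0 <= S.
  by rewrite addr_ge0 ?mulr_ge0 // sumr_ge0 // => l _; case: (BP l).
exists (2 * S / kap + 1); first by rewrite ltr_wpDl // divr_ge0 ?mulr_ge0 // ltW.
move=> x p a xr pP; rewrite -ltrBrDr ltr_pdivrMr // => aA.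
have := lagrangian_taylor x 0 a; rewrite add0r /tilt => h.
have d0 : dotp 0 p = 0 by rewrite -(scale0r 0) dotpZl mul0r.
rewrite d0 subr0.
have h1 : - (\sum_l B l * `|a|) <= 'D_(0, a) U (x, 0).
  rewrite lerNl; apply: le_trans (ler_norm _) _; rewrite normrN lagrangian_derive_sum.
  apply: le_trans (ler_norm_sum _ _ _) _; apply: ler_sum => l _.
  by rewrite normrM mulrC ler_pM // ?ler_coord_norm //; case: (BP l) => _; apply.
rewrite -mulr_suml in h1.
have h2 : dotp a p <= d%:R * P * `|a|.
  apply: le_trans (ler_norm _) _; apply: le_trans (norm_dotp a p) _.
  by rewrite -mulrA ler_wpM2l // mulrC ler_wpM2r.
have h3 : `|a| ^+ 2 <= enorm a ^+ 2 by rewrite lerXn2r ?nnegrE ?sqrtr_ge0 ?norm_le_enorm.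
have a0 := normr_ge0 a.
have h4 : kap * `|a| ^+ 2 <= kap * enorm a ^+ 2 by rewrite ler_pM2l.
have ap : 0 < `|a|.
  rewrite lt_neqAle a0 andbT; apply/eqP => e; move: aA; rewrite -e.
  by rewrite -{1}[0]addr0; have := kap0; nra.
have h5 : 2 * S * `|a| < kap * `|a| ^+ 2.
  by rewrite expr2 mulrA ltr_pM2r //; have := kap0; nra.
rewrite /S in h5; lra.
Qed.

Lemma exists_min x p : exists a, is_min x p a.
Proof.
have [A A0 HA] := @tilt_coercive `|x| `|p| (normr_ge0 p).
have ct : continuous (tilt x p).
  have cL : continuous (fun a => U (x, a)).
    by apply: continuous_slice2; case: LC2 => cU _; exact: (cU [::] isT).
  have cD : continuous (fun a => dotp a p).
    move=> a; apply: (@cvg_bigsum R _ (nbhs a) (nbhs_filter a)) => i _.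
    apply: cvgM; last exact: cvg_cst.
    exact: coord_continuous.
  by move=> a; exact: (cvgB (cL a) (cD a)).
have [|||a] := @compact_EVT_min _ R (tilt x p) [set a : 'rV[R]_d | `|a| <= A].
- by exists 0; rewrite /= normr0 ltW.
- exact: box_compact.
- exact: continuous_subspaceT.
rewrite inE /= => aA amin; exists a => b.
have [bA|bA] := leP `|b| A; first by apply: amin; rewrite inE.
apply: le_trans (ltW (HA x p b _ _ bA)) => //.
by apply: amin; rewrite inE /= normr0 ltW.
Qed.

Definition amin x p : 'rV[R]_d := sval (cid (exists_min x p)).

Lemma aminP x p : is_min x p (amin x p).
Proof. by rewrite /amin; case: cid. Qed.

(** Quadratic growth of both tilted functions around their minimisers, each
    tested at the other minimiser; in the sum only differences of L and of p
    remain. *)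
Lemma amin_cross x y p q :
  kap / 2 * enorm (amin x p - amin y q) ^+ 2 <=
  (L x (amin y q) - L x (amin x p) - L y (amin y q) + L y (amin x p)) +
  dotp (amin x p - amin y q) (p - q).
Proof.
have := min_growth (aminP x p) (amin y q); have := min_growth (aminP y q) (amin x p).
have -> : enorm (amin y q - amin x p) ^+ 2 = enorm (amin x p - amin y q) ^+ 2.
  by rewrite !sqr_enorm -opprB dotpNl dotpNr opprK.
rewrite /tilt dotpBl !dotpBr; lra.
Qed.

Lemma amin_bounded (r P : R) : 0 <= P ->
  exists2 A : R, 0 < A & forall x p, `|x| <= r -> `|p| <= P -> `|amin x p| <= A.
Proof.
move=> P0; have [A A0 HA] := tilt_coercive r P0; exists A => // x p xr pP.
by rewrite leNgt; apply/negP => /(HA x p _ xr pP); rewrite ltNge (aminP x p 0).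
Qed.

(** Two applications of the mean value theorem, along x - y in the first
    variable and along b - a in the second, express the difference through the
    mixed second derivatives, which are bounded on boxes. *)
Lemma mixed_difference_bound (r A : R) : exists2 M : R, 0 <= M & forall x y a b : 'rV[R]_d,
  `|x| <= r -> `|y| <= r -> `|a| <= A -> `|b| <= A ->
  `|L x b - L x a - L y b + L y a| <= M * (`|x - y| * `|a - b|).
Proof.
have /choice[B BP] : forall kl : 'I_d * 'I_d, exists B : R, 0 <= B /\
    forall x a : 'rV[R]_d, `|x| <= r -> `|a| <= A ->
    `|'D_(0, delta_mx 0 kl.2) ('D_(delta_mx 0 kl.1, 0) U) (x, a)| <= B.
  move=> [k l]; have [|M M0 H] := @bounded_on_box2 ('D_(0, delta_mx 0 l) ('D_(delta_mx 0 k, 0) U)) r A.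
    by case: (lagrangian_derive_C1 (delta_mx 0 k, 0)) => _; apply.
  by exists M.
pose M := \sum_k \sum_l B (k, l).
exists M; first by apply: sumr_ge0 => k _; apply: sumr_ge0 => l _; case: (BP (k, l)).
have seg (u v : 'rV[R]_d) (t s : R) : `|u| <= s -> `|v| <= s -> 0 <= t <= 1 ->
    `|u + t *: (v - u)| <= s.
  move=> us vs /andP[t0 t1].
  have -> : u + t *: (v - u) = (1 - t) *: u + t *: v.
    by apply/rowP => j; rewrite !mxE; ring.
  apply: le_trans (ler_normD _ _) _; rewrite !normrZ !ger0_norm ?subr_ge0 //.
  by nra.
move=> x y a b xr yr aA bA.
pose w := x - y; pose v := b - a.
pose W : 'rV[R]_d * 'rV[R]_d := (w, 0).
pose D := 'D_W U.
have DE z : D z = \sum_k w 0 k * 'D_(delta_mx 0 k, 0) U z.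
  by rewrite /D /W pair1_sum derive_sumdir //; exact: lagrangian_C1.
(* The mixed difference as an increment in x of the increment g from a to b. *)
pose g (z : 'rV[R]_d * 'rV[R]_d) : R := U (z.1, b) - U (z.1, a).
pose Da (z : 'rV[R]_d * 'rV[R]_d) := D (z.1, b) - D (z.1, a).
have dg (z : 'rV[R]_d * 'rV[R]_d) : is_derive z W g (Da z).
  have sl c : is_derive z W (fun z : 'rV[R]_d * 'rV[R]_d => U (z.1, c)) (D (z.1, c)).
    have E : (fun h : R => h^-1 *: (((fun z : 'rV[R]_d * 'rV[R]_d => U (z.1, c)) \o shift z) (h *: W) - U (z.1, c)))
     = (fun h : R => h^-1 *: ((U \o shift (z.1, c)) (h *: W) - U (z.1, c))).
      apply/funext => h /=; congr (_ *: (U _ - _)); congr pair => /=.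
      by rewrite scaler0 add0r.
    split; rewrite /derivable /D /derive E //.
    by case: lagrangian_C1 => H _; exact: H.
  by have := is_deriveB (sl b) (sl a).
have dgD z : derivable g z W by case: (dg z).
have [t t01] := derive_mvt (y, 0) 1 dgD.
have -> : g ((y, 0) + 1 *: W) - g (y, 0) = L x b - L x a - L y b + L y a.
  by rewrite /g /U /= scale1r /w addrCA subrr addr0; ring.
move=> ->; rewrite mul1r derive_val /Da.
set xi := (_ + _).1.
have xir : `|xi| <= r by rewrite /xi /= mulr1; apply: seg.
have [|s s01] := @derive_mvt _ _ D (xi, a) (0, v) 1.
  move=> z; by case: (lagrangian_derive_C1 W) => H _; exact: H.
have -> : (xi, a) + 1 *: (0, v) = (xi, b) :> 'rV[R]_d * 'rV[R]_d.
  by congr pair; rewrite /= scale1r ?addr0 // /v addrCA subrr addr0.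
move=> ->; rewrite mul1r mulr1.
have -> : (xi, a) + s *: (0, v) = (xi, a + s *: v) :> 'rV[R]_d * 'rV[R]_d.
  by congr pair; rewrite /= scaler0 addr0.
have etaA : `|a + s *: v| <= A by apply: seg.
have -> : D = \sum_(k < d) (w 0 k *: 'D_(delta_mx 0 k, 0) U).
  by apply/funext => z; rewrite DE fct_sumE; apply: eq_bigr => k _.
rewrite derive_sum; last first.
  by move=> k; apply: derivableZ; case: (lagrangian_derive_C1 (delta_mx 0 k, 0)) => H _; exact: H.
rewrite /M mulr_suml; apply: le_trans (ler_norm_sum _ _ _) _; apply: ler_sum => k _.
rewrite deriveZ; last by case: (lagrangian_derive_C1 (delta_mx 0 k, 0)) => H _; exact: H.
rewrite -[w 0 k *: _]/(w 0 k * _) pair2_sum derive_sumdir; last exact: lagrangian_derive_C1.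
rewrite mulr_suml mulr_sumr; apply: le_trans (ler_norm_sum _ _ _) _; apply: ler_sum => l _.
rewrite !normrM mulrA mulrC ler_pM ?mulr_ge0 //; first by case: (BP (k, l)) => _; apply.
by rewrite ler_pM // ?ler_coord_norm // distrC ler_coord_norm.
Qed.

(** In amin_cross the left side is quadratic in the distance of the minimisers,
    while the right side is linear in it by mixed_difference_bound; one factor
    cancels. *)
Lemma amin_lipschitz (r P : R) : 0 <= P ->
  exists2 K : R, 0 < K & forall x y p q,
    `|x| <= r -> `|y| <= r -> `|p| <= P -> `|q| <= P ->
    `|amin x p - amin y q| <= K * (`|x - y| + `|p - q|).
Proof.
move=> P0; have [A A0 HA] := amin_bounded r P0; have [M M0 HM] := mixed_difference_bound r A.
exists (2 * (M + d%:R + 1) / kap); first by rewrite divr_gt0 // mulr_gt0 // ltr_wpDl // addr_ge0.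
move=> x y p q xr yr pP qP; have := amin_cross x y p q.
set a := amin x p; set b := amin y q.
have := HM x y a b xr yr (HA _ _ xr pP) (HA _ _ yr qP).
have := norm_dotp (a - b) (p - q).
have : `|a - b| ^+ 2 <= enorm (a - b) ^+ 2 by rewrite lerXn2r ?nnegrE ?sqrtr_ge0 ?norm_le_enorm.
move=> h1 h2 h3 h4.
have h5 := le_trans (ler_norm _) h2; have h6 := le_trans (ler_norm _) h3.
have : kap / 2 * `|a - b| ^+ 2 <= M * (`|x - y| * `|a - b|) + d%:R * (`|a - b| * `|p - q|).
  apply: le_trans (le_trans h4 (lerD h6 h5)).
  by rewrite ler_wpM2l // divr_ge0 // ltW.
have n0 := normr_ge0 (x - y); have m0 := normr_ge0 (p - q).
have [->|ab0] := eqVneq `|a - b| 0.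
  by move=> _; rewrite mulr_ge0 ?addr_ge0 // divr_ge0 // ?mulr_ge0 ?addr_ge0 // ltW.
have abp : 0 < `|a - b| by rewrite lt_neqAle eq_sym ab0 normr_ge0.
have -> : M * (`|x - y| * `|a - b|) + d%:R * (`|a - b| * `|p - q|) =
  (M * `|x - y| + d%:R * `|p - q|) * `|a - b| by ring.
rewrite expr2 mulrA ler_pM2r // => h7.
rewrite [leRHS]mulrAC ler_pdivlMr //.
have d0 : 0 <= d%:R :> R by [].
have : d%:R * `|x - y| >= 0 by rewrite mulr_ge0.
have : M * `|p - q| >= 0 by rewrite mulr_ge0.
by nra.
Qed.

Lemma hamiltonianE x p : hamiltonian L x p = dotp (amin x p) p - L x (amin x p).
Proof.
apply/eqP; rewrite eq_le; apply/andP; split.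
  apply: ge_sup; first by exists (dotp (amin x p) p - L x (amin x p)); exists (amin x p).
  by move=> _ [a _ <-]; have := aminP x p a; rewrite /tilt; lra.
apply: ub_le_sup; last by exists (amin x p).
exists (dotp (amin x p) p - L x (amin x p)) => _ [a _ <-].
by have := aminP x p a; rewrite /tilt; lra.
Qed.

(** Envelope theorem. The increment of the Hamiltonian from p to q lies between
    the scalar products of q - p with the minimisers at p and at q, and these
    are close to each other by amin_lipschitz. *)
Lemma grad_hamiltonian x p : grad (hamiltonian L x) p = amin x p.
Proof.
apply/rowP => l; rewrite mxE.
have [K K0 HK] := @amin_lipschitz `|x| (`|p| + 1) (addr_ge0 (normr_ge0 p) ler01).
suff H : is_derive p (delta_mx 0 l) (hamiltonian L x) (amin x p 0 l) by rewrite derive_val.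
apply: is_derive_approx => e e0.
pose C := d%:R * (K + 1).
have C0 : 0 <= C by rewrite mulr_ge0 // addr_ge0 // ltW.
have nd : `|delta_mx 0 l : 'rV[R]_d| <= 1.
  by apply: norm_le_coord => // j; rewrite mxE; case: (_ && _); rewrite ?normr1 ?normr0.
exists (Num.min 1 (e / (C + 1))).
  by rewrite lt_min ltr01 /= divr_gt0 // ltr_wpDl.
move=> h; rewrite lt_min ltr_pdivlMr ?ltr_wpDl // => /andP[h1 he].
set q := p + _; set a := amin x p.
have hq : `|q - p| <= `|h|.
  by rewrite /q addrAC subrr add0r normrZ ler_piMr.
have qP : `|q| <= `|p| + 1.
  by rewrite -[q](subrK p) addrC (le_trans (ler_normD _ _)) // lerD2l (le_trans hq) // ltW.
have pP : `|p| <= `|p| + 1 by rewrite lerDl.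
have lip := HK x x q p (lexx _) (lexx _) qP pP.
rewrite subrr normr0 add0r -/a in lip; set b := amin x q in lip.
have e1 : hamiltonian L x q - hamiltonian L x p - h * a 0 l =
  dotp b q - L x b - dotp a q + L x a.
  rewrite !hamiltonianE -/a -/b /q dotpDr dotpZr dotpDr dotpZr !dotp_delta; ring.
have lo : 0 <= dotp b q - L x b - dotp a q + L x a.
  by have := aminP x q a; rewrite -/b /tilt; lra.
have up : dotp b q - L x b - dotp a q + L x a <= dotp (b - a) (q - p).
  have := aminP x p b; rewrite -/a /tilt.
  by rewrite dotpBl !dotpBr; lra.
rewrite e1 ger0_norm //; apply: le_trans up _.
apply: le_trans (ler_norm _) _; apply: le_trans (norm_dotp _ _) _.
have h0 := normr_ge0 h.
apply: (@le_trans _ _ (C * `|h| ^+ 2)); last first.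
  by rewrite expr2 mulrA ler_wpM2r //; nra.
rewrite /C -mulrA ler_wpM2l //.
apply: (@le_trans _ _ (K * `|h| * `|h|)); last by rewrite expr2; nra.
rewrite ler_pM //; apply: le_trans lip _; rewrite ler_wpM2l //; exact: ltW.
Qed.

End hamiltonian.

(** * Multilinear interpolation on the grid *)

Section coordwise.
Context {R : realType} {d : nat}.

(** Lipschitz bounds are kept along coordinate lines, because interpolation
    preserves the constant in this form; coord_lipschitz_norm recovers a bound
    in the maximum norm. *)
Definition coord_lipschitz (K : R) (f : 'rV[R]_d -> R) :=
  forall x l s, `|f (x + s *: delta_mx 0 l) - f x| <= K * `|s|.

Lemma coord_lipschitz_norm K f : 0 <= K -> coord_lipschitz K f ->
  forall x y, `|f x - f y| <= d%:R * K * `|x - y|.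
Proof.
move=> K0 fK x y.
have H (s : seq 'I_d) (c : 'I_d -> R) z :
    `|f (z + \sum_(l <- s) c l *: delta_mx 0 l) - f z| <= \sum_(l <- s) K * `|c l|.
  elim: s z => [|l s IH] z; first by rewrite !big_nil addr0 subrr normr0.
  rewrite !big_cons addrA.
  apply: le_trans (ler_distD (f (z + c l *: delta_mx 0 l)) _ _) _.
  by rewrite [leRHS]addrC lerD.
have -> : x = y + \sum_l (x - y) 0 l *: delta_mx 0 l.
  by rewrite -rV_sum_delta addrCA subrr addr0.
apply: le_trans (H _ _ _) _; rewrite [y + _ - y]addrAC subrr add0r -rV_sum_delta.
rewrite -mulrA -[d in d%:R]card_ord mulr_natl -sumr_const.
by apply: ler_sum => l _; rewrite ler_wpM2l // ler_coord_norm.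
Qed.

Lemma coord_lipschitz_continuous K f : 0 <= K -> coord_lipschitz K f -> continuous f.
Proof.
move=> K0 fK x; apply: continuous_of_modulus => e e0.
have dK : 0 <= d%:R * K by rewrite mulr_ge0.
exists (e / (d%:R * K + 1)); first by rewrite divr_gt0 // ltr_wpDl.
move=> y xy; apply: le_trans (coord_lipschitz_norm K0 fK x y) _.
move: xy; rewrite ltr_pdivlMr ?ltr_wpDl //; have := normr_ge0 (x - y); nra.
Qed.

End coordwise.

Section chain.
Context {R : realType}.

(** A Lipschitz bound on each interval between consecutive integers chains to a
    global one: the increments over the pieces of a segment add up to its
    length. *)
Lemma lipschitz_by_unit_steps (g : R -> R) (K : R) :
  (forall (m : int) s t, m%:~R <= s <= m%:~R + 1 -> m%:~R <= t <= m%:~R + 1 ->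
     `|g s - g t| <= K * `|s - t|) ->
  forall s t, `|g s - g t| <= K * `|s - t|.
Proof.
move=> H.
have A (k : nat) : forall s t, s <= t -> t <= (Num.floor s)%:~R + 1 + k%:R ->
    `|g s - g t| <= K * `|s - t|.
  elim: k => [|k IH] s t st tk.
    have /andP[f1 f2] := floor_itv s; rewrite intrD in f2.
    by apply: (H (Num.floor s)); apply/andP; split; lra.
  have [h|h] := leP t ((Num.floor s)%:~R + 1 + k%:R); first exact: IH.
  pose u : R := (Num.floor s)%:~R + 1 + k%:R.
  have /andP[f1 f2] := floor_itv s; rewrite intrD in f2.
  have k0 : 0 <= k%:R :> R by [].
  have su : s <= u by rewrite /u; lra.
  apply: le_trans (ler_distD (g u) _ _) _.
  have -> : `|s - t| = `|s - u| + `|u - t|.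
    have ut : u <= t by exact: ltW.
    by rewrite !ler0_norm ?subr_le0 //; lra.
  rewrite mulrDr lerD //; first by apply: IH.
  have mE : (Num.floor s + 1 + k%:Z)%:~R = u by rewrite !intrD.
  rewrite -/u in h; apply: (H (Num.floor s + 1 + k%:Z)); rewrite mE; apply/andP; split.
  - by [].
  - by rewrite lerDl.
  - exact: ltW.
  - by move: tk; rewrite -natr1 /u; lra.
have B s t : s <= t -> `|g s - g t| <= K * `|s - t|.
  move=> st; apply: (A (Num.truncn (t - (Num.floor s)%:~R)).+1) => //.
  by have := truncnS_gt (t - (Num.floor s)%:~R); lra.
move=> s t; have [st|ts] := leP s t; first exact: B.
by rewrite distrC (distrC s t); apply: B; exact: ltW.
Qed.
End chain.

Section interpolation.
Context {R : realType} {d : nat} (dx : R).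
Hypothesis dx0 : 0 < dx.
Implicit Types (phi : 'rV[int]_d -> R) (n : 'rV[int]_d) (t : 'I_d -> R).

Definition vertex n (e : {ffun 'I_d -> bool}) : 'rV[int]_d := \row_l (n 0 l + (e l)%:Z).

Definition weight (b : bool) (t : R) : R := if b then t else 1 - t.

Definition multilinear phi n t : R :=
  \sum_(e : {ffun 'I_d -> bool}) phi (vertex n e) * \prod_l weight (e l) (t l).

Definition cell_pt n t : 'rV[R]_d := \row_l (((n 0 l)%:~R + t l) * dx).

Lemma cell_coords x : exists n t, (forall l, 0 <= t l <= 1) /\ x = cell_pt n t.
Proof.
exists (\row_l Num.floor (x 0 l / dx)), (fun l => x 0 l / dx - (Num.floor (x 0 l / dx))%:~R).
split=> [l|].
  by have /andP[] := floor_itv (x 0 l / dx); rewrite intrD; lra.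
by apply/rowP => l; rewrite !mxE addrCA subrr addr0 divfK // gt_eqF.
Qed.

(** On one cell only the corners of the cell have nonzero weights, and these
    weights are products of the local coordinates or of their complements. *)
Lemma interp1_multilinear phi n t : (forall l, 0 <= t l <= 1) ->
  interp1 dx phi (cell_pt n t) = multilinear phi n t.
Proof.
move=> t01; rewrite /interp1 /multilinear.
have dxn : dx != 0 by rewrite gt_eqF.
have b1 i : beta1 dx i (cell_pt n t) =
    \prod_l Num.max 0 (1 - `|(n 0 l)%:~R + t l - (i 0 l)%:~R|).
  by apply: eq_bigr => l _; rewrite mxE mulfK.
have vinj : injective (vertex n).
  move=> e e' /rowP ee'; apply/ffunP => l; have := ee' l; rewrite !mxE.
  by move=> /addrI; case: (e l); case: (e' l).
rewrite -(fsbig_widen (range (vertex n))) //; last first.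
  move=> i [_ ni] /=; rewrite b1.
  have [l lP] : exists l, (i 0 l < n 0 l) || (n 0 l + 1 < i 0 l).
    apply: contrapT => /forallNP nl; apply: ni.
    exists [ffun l => i 0 l != n 0 l] => //; apply/rowP => l; rewrite !mxE ffunE.
    by have /negP := nl l; rewrite negb_or -!leNgt; case: eqP => [->|] /=; lia.
  rewrite (bigD1 l) //= (_ : Num.max _ _ = 0) ?mul0r ?mulr0 //.
  apply/max_idPl; rewrite subr_le0.
  have /andP[t0 t1] := t01 l.
  case/orP: lP => lP.
    have : (i 0 l)%:~R + 1 <= (n 0 l)%:~R :> R by rewrite -[1]/(1%:~R) -intrD ler_int; lia.
    by move=> h; rewrite ger0_norm; lra.
  have : (n 0 l)%:~R + 1 + 1 <= (i 0 l)%:~R :> R by rewrite -[1]/(1%:~R) -!intrD ler_int; lia.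
  by move=> h; rewrite ler0_norm; lra.
rewrite fsbig_image; last by move=> e e' _ _; exact: vinj.
rewrite (fsbig_fwiden (index_enum {ffun 'I_d -> bool})) //; last 3 first.
- by move=> e _ /=; rewrite mem_index_enum.
- exact: index_enum_uniq.
- by move=> e [_ []].
apply: eq_bigr => e _; rewrite b1; congr (_ * _); apply: eq_bigr => l _.
rewrite mxE intrD; have /andP[t0 t1] := t01 l.
case: (e l) => /=.
  rewrite (_ : _ + t l - _ = t l - 1); last by rewrite -[(1%:Z)%:~R]/(1:R); lra.
  by rewrite ler0_norm ?subr_le0 // opprB (_ : 1 - (1 - t l) = t l) ?(max_idPr t0) //; lra.
rewrite (_ : _ + t l - _ = t l); last by rewrite -[(0%:Z)%:~R]/(0:R); lra.
by rewrite ger0_norm // max_r // subr_ge0.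
Qed.

Lemma weight_ge0 b (t : R) : 0 <= t <= 1 -> 0 <= weight b t.
Proof. by move=> /andP[t0 t1]; case: b => //=; rewrite subr_ge0. Qed.

Lemma sum_weights t : \sum_(e : {ffun 'I_d -> bool}) \prod_l weight (e l) (t l) = 1 :> R.
Proof.
rewrite -(bigA_distr_bigA (fun l b => weight b (t l))) big1 // => l _.
by rewrite big_bool /= addrCA subrr addr0.
Qed.

Lemma multilinear_bound phi n t (C : R) : (forall l, 0 <= t l <= 1) ->
  (forall e, `|phi (vertex n e)| <= C) -> `|multilinear phi n t| <= C.
Proof.
move=> t01 pC; apply: le_trans (ler_norm_sum _ _ _) _.
rewrite -[leRHS](@mulr1 R C) -[in leRHS](sum_weights t) mulr_sumr; apply: ler_sum => e _.
have w0 : 0 <= \prod_l weight (e l) (t l) by apply: prodr_ge0 => l _; exact: weight_ge0.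
by rewrite normrM [X in _ * X]ger0_norm // ler_wpM2r.
Qed.

Lemma multilinearB phi psi n t :
  multilinear phi n t - multilinear psi n t = multilinear (fun i => phi i - psi i) n t.
Proof. by rewrite -sumrB; apply: eq_bigr => e _; rewrite mulrBl. Qed.

Lemma interp1_bound phi (C : R) x : (forall i, `|phi i| <= C) -> `|interp1 dx phi x| <= C.
Proof.
move=> pC; have [n [t [t01 ->]]] := cell_coords x.
by rewrite interp1_multilinear //; exact: multilinear_bound.
Qed.

Lemma interp1B phi psi x :
  interp1 dx phi x - interp1 dx psi x = interp1 dx (fun i => phi i - psi i) x.
Proof.
have [n [t [t01 ->]]] := cell_coords x.
by rewrite !interp1_multilinear // multilinearB.
Qed.

(** A bound on the values at the nodes near x suffices. This localisation makes
    convergence at finitely many nodes enough in value_rev_cvg. *)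
Lemma interp1_bound_near phi (C r : R) x :
  (forall i, `|gridpt dx i| <= r + dx -> `|phi i| <= C) -> `|x| <= r ->
  `|interp1 dx phi x| <= C.
Proof.
move=> pC; have [n [t [t01 ->]]] := cell_coords x => xr.
rewrite interp1_multilinear //; apply: multilinear_bound => // e; apply: pC.
have -> : gridpt dx (vertex n e) = cell_pt n t + \row_l (((e l)%:R - t l) * dx).
  by apply/rowP => l; rewrite !mxE intrD -pmulrn; ring.
apply: le_trans (ler_normD _ _) _; rewrite lerD //.
apply: norm_le_coord => [|l]; first exact: ltW.
rewrite mxE normrM (gtr0_norm dx0) ler_piMl ?(ltW dx0) // ler_norml.
by have /andP[] := t01 l; case: (e l) => /=; lra.
Qed.

Definition shift_idx l (i : 'rV[int]_d) : 'rV[int]_d := i + delta_mx 0 l.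

Lemma interp1_shift phi x l :
  interp1 dx phi (x + dx *: delta_mx 0 l) = interp1 dx (phi \o shift_idx l) x.
Proof.
have [n [t [t01 ->]]] := cell_coords x.
have -> : cell_pt n t + dx *: delta_mx 0 l = cell_pt (shift_idx l n) t.
  have bE (b : bool) : (b%:R : int)%:~R = b%:R :> R by case: b.
  by apply/rowP => k; rewrite !mxE eqxx /= intrD bE; ring.
rewrite !interp1_multilinear //; apply: eq_bigr => e _; congr (phi _ * _).
by apply/rowP => k; rewrite !mxE addrAC.
Qed.

Definition upd t l (s : R) : 'I_d -> R := fun k => if k == l then s else t k.

Lemma multilinear_affine phi n t l (s : R) :
  multilinear phi n (upd t l s) =
  (1 - s) * multilinear phi n (upd t l 0) + s * multilinear phi n (upd t l 1).
Proof.
rewrite /multilinear !mulr_sumr -big_split; apply: eq_bigr => e _ /=.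
have E (c : R) : \prod_(i < d) weight (e i) (upd t l c i) =
    weight (e l) c * \prod_(i < d | i != l) weight (e i) (t i).
  rewrite (bigD1 l) //= /upd eqxx; congr (_ * _).
  by apply: eq_bigr => i /negbTE ->.
by rewrite !E; case: (e l) => /=; ring.
Qed.

Lemma upd01 t l (s : R) : (forall k, 0 <= t k <= 1) -> 0 <= s <= 1 ->
  forall k, 0 <= upd t l s k <= 1.
Proof. by move=> t01 s01 k; rewrite /upd; case: eqP. Qed.

(** On a cell the interpolation is affine in each local coordinate. Its slope is
    the difference of interpolated values at two points that are one grid step
    apart, that is, the interpolation of the discrete increments. *)
Lemma interp1_step phi (K : R) n t l (s s' : R) :
  (forall i, `|phi (shift_idx l i) - phi i| <= K * dx) ->
  (forall k, 0 <= t k <= 1) -> 0 <= s <= 1 -> 0 <= s' <= 1 ->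
  `|interp1 dx phi (cell_pt n (upd t l s)) - interp1 dx phi (cell_pt n (upd t l s'))|
    <= K * dx * `|s - s'|.
Proof.
move=> pK t01 s01 s'01.
have i0 : 0 <= (0 : R) <= 1 by rewrite lexx ler01.
have i1 : 0 <= (1 : R) <= 1 by rewrite lexx ler01.
rewrite !interp1_multilinear; try exact: upd01.
rewrite (multilinear_affine _ _ _ _ s) (multilinear_affine _ _ _ _ s').
set A := multilinear phi n (upd t l 0); set B := multilinear phi n (upd t l 1).
have -> : (1 - s) * A + s * B - ((1 - s') * A + s' * B) = (B - A) * (s - s') by ring.
rewrite normrM ler_wpM2r //.
have -> : B = interp1 dx (phi \o shift_idx l) (cell_pt n (upd t l 0)).
  rewrite -interp1_shift /B -interp1_multilinear; last exact: upd01.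
  congr interp1; apply/rowP => k; rewrite !mxE eqxx /= /upd.
  by case: (k == l) => /=; ring.
have -> : A = interp1 dx phi (cell_pt n (upd t l 0)).
  by rewrite interp1_multilinear //; exact: upd01.
by rewrite interp1B; apply: interp1_bound.
Qed.

(** interp1_step bounds the increments inside a cell, and
    lipschitz_by_unit_steps chains the cells met by the line. *)
Lemma interp1_lipschitz phi (K : R) :
  (forall l i, `|phi (shift_idx l i) - phi i| <= K * dx) ->
  coord_lipschitz K (interp1 dx phi).
Proof.
move=> pK x l s.
pose g z := interp1 dx phi (\row_k (if k == l then z * dx else x 0 k)).
have gL : forall z z', `|g z - g z'| <= K * dx * `|z - z'|.
  apply: lipschitz_by_unit_steps => m z z' /andP[z0 z1] /andP[z'0 z'1].
  have [n [t [t01 xE]]] := cell_coords x.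
  have E u : \row_k (if k == l then u * dx else x 0 k) =
      cell_pt (\row_k (if k == l then m else n 0 k)) (upd t l (u - m%:~R)).
    apply/rowP => k; rewrite !mxE /upd; case: eqP => _; last by rewrite xE mxE.
    by rewrite addrCA subrr addr0.
  rewrite /g !E (_ : z - z' = (z - m%:~R) - (z' - m%:~R)); last by ring.
  by apply: interp1_step => //; apply/andP; split; lra.
have E u : \row_k (if k == l then (x 0 l + u) / dx * dx else x 0 k) = x + u *: delta_mx 0 l.
  apply/rowP => k; rewrite !mxE eqxx /=; case: eqP => [->|] /=; last by rewrite mulr0 addr0.
  by rewrite divfK ?gt_eqF // mulr1.
have := gL ((x 0 l + s) / dx) ((x 0 l + 0) / dx).
rewrite /g !E scale0r addr0 => /le_trans; apply.
rewrite -mulrBl [x 0 l + s]addrC addr0 addrK normrM normfV (gtr0_norm dx0).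
by rewrite -mulrA [dx * _]mulrC divfK ?gt_eqF.
Qed.

End interpolation.

(** * The discrete value function *)

Section infimum.
Context {R : realType} {I : Type}.
Implicit Types (S : set I) (f g : I -> R).

Lemma inf_image_dist S f g (e C : R) : S !=set0 ->
  (forall a, S a -> `|f a| <= C) -> (forall a, S a -> `|g a| <= C) ->
  (forall a, S a -> `|f a - g a| <= e) ->
  `|inf (f @` S) - inf (g @` S)| <= e.
Proof.
move=> [a0 Sa0] fC gC fg.
have lb (h : I -> R) : (forall a, S a -> `|h a| <= C) -> has_lbound (h @` S).
  by move=> hC; exists (- C) => _ [a Sa <-]; have := hC a Sa; rewrite ler_norml => /andP[].
have half (h k : I -> R) : (forall a, S a -> `|h a| <= C) ->
    (forall a, S a -> `|h a - k a| <= e) -> inf (h @` S) <= inf (k @` S) + e.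
  move=> hC hk; rewrite -lerBlDr; apply: lb_le_inf; first by exists (k a0); exists a0.
  move=> _ [a Sa <-]; rewrite lerBlDr.
  apply: (@le_trans _ _ (h a)); first by apply: inf_lbound; [exact: lb|exists a].
  by have := hk a Sa; rewrite ler_norml => /andP[_]; lra.
have h1 : inf (g @` S) <= inf (f @` S) + e.
  by apply: half => // a Sa; rewrite distrC; exact: fg.
have h2 : inf (f @` S) <= inf (g @` S) + e by exact: half.
by rewrite ler_norml; apply/andP; split; lra.
Qed.

Lemma inf_image_bound S f (C : R) : S !=set0 ->
  (forall a, S a -> `|f a| <= C) -> `|inf (f @` S)| <= C.
Proof.
move=> [a0 Sa0] fC; rewrite ler_norml; apply/andP; split.
  apply: lb_le_inf; first by exists (f a0); exists a0.
  by move=> _ [a Sa <-]; have := fC a Sa; rewrite ler_norml => /andP[].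
apply: (@le_trans _ _ (f a0)); last by have := fC a0 Sa0; rewrite ler_norml => /andP[].
apply: inf_lbound; last by exists a0.
by exists (- C) => _ [a Sa <-]; have := fC a Sa; rewrite ler_norml => /andP[].
Qed.

End infimum.

Lemma near_seq {T : Type} {F : set_system T} {FF : Filter F} (I : eqType) (s : seq I)
    (P : I -> T -> Prop) :
  (forall i, i \in s -> \forall x \near F, P i x) ->
  \forall x \near F, forall i, i \in s -> P i x.
Proof.
elim: s => [_|i s IH H]; first by apply: nearW.
have Pi := H i (mem_head _ _).
have {}IH : \forall x \near F, forall i, i \in s -> P i x.
  by apply: IH => j js; apply: H; rewrite inE js orbT.
apply: filterS2 Pi IH => x Pix Psx j; rewrite inE => /orP[/eqP ->//|]; exact: Psx.
Qed.

Section grid.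
Context {R : realType} {d : nat}.

Lemma finite_grid_box (dx r : R) : 0 < dx -> finite_set (@grid_box R d dx r).
Proof.
move=> dx0; pose M := Num.truncn (r / dx).
pose h (f : {ffun 'I_d -> 'I_(M + M).+1}) : 'rV[int]_d := \row_l ((f l)%:Z - M%:Z).
apply: (@sub_finite_set _ _ (h @` [set: {ffun 'I_d -> 'I_(M + M).+1}])); last first.
  by apply: finite_image; exact: finite_finset.
move=> i; rewrite /grid_box /= => ir.
have iM l : `|i 0 l| <= M%:Z.
  have : `|gridpt dx i 0 l| <= r by apply: le_trans ir; exact: ler_coord_norm.
  rewrite mxE normrM (gtr0_norm dx0) -ler_pdivlMr // => h1.
  have h2 := le_lt_trans h1 (truncnS_gt _).
  rewrite -/M -intr_norm -[M.+1%:R]/(M.+1%:Z%:~R) ltr_int in h2; lia.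
exists [ffun l => inord (absz (i 0 l + M%:Z))] => //.
apply/rowP => l; rewrite !mxE ffunE inordK; have := iM l; lia.
Qed.

Lemma gridpt_shift (dx : R) l (i : 'rV[int]_d) :
  gridpt dx (shift_idx l i) = gridpt dx i + dx *: delta_mx 0 l.
Proof.
have bE (b : bool) : (b%:R : int)%:~R = b%:R :> R by case: b.
by apply/rowP => k; rewrite !mxE eqxx /= intrD bE; ring.
Qed.

Lemma enorm_delta (s : R) (l : 'I_d) : enorm (s *: delta_mx 0 l : 'rV[R]_d) = `|s|.
Proof.
rewrite /enorm dotpZl dotpZr dotp_delta mxE !eqxx mulr1.
by rewrite -expr2 sqrtr_sqr.
Qed.

End grid.

Definition W1_cvg {R : realType} {d : nat} (mu_ : nat -> P1 R d) (mu : P1 R d) :=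
  forall e : R, 0 < e -> \forall n \near \oo, (W1 (mu_ n) mu < e%:E)%E.

Lemma cost_cvg {R : realType} {d : nat} (h : 'rV[R]_d -> P1 R d -> R) x mu_ mu :
  continuous_Rd_P1 h -> W1_cvg mu_ mu -> h x (mu_ n) @[n --> \oo] --> h x mu.
Proof.
move=> ch mc; apply/cvgrPdist_lt => e e0.
have [r r0 H] := ch x mu e e0; have := mc r r0; apply: filterS => n nr.
by rewrite distrC; apply: H => //; rewrite subrr /enorm /dotp big1 ?sqrtr0 // => l _; rewrite mxE mul0r.
Qed.

Section value.
Context {R : realType} {d : nat}.
Variables (T : R) (L : 'rV[R]_d -> 'rV[R]_d -> R) (F G : 'rV[R]_d -> P1 R d -> R).
Variables (Cb : R) (N : nat) (dx : R).
Variables (CL KL CF KF CG KG : R).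
Hypotheses (T0 : 0 < T) (N0 : (0 < N)%N) (dx0 : 0 < dx) (Cb0 : 0 < Cb).
Hypothesis LC : forall x a, enorm a <= Cb -> `|L x a| <= CL.
Hypothesis LK : forall x l s a, enorm a <= Cb -> `|L (x + s *: delta_mx 0 l) a - L x a| <= KL * `|s|.
Hypothesis FC : forall x nu, `|F x nu| <= CF.
Hypothesis FK : forall x y nu, `|F x nu - F y nu| <= KF * enorm (x - y).
Hypothesis GC : forall x nu, `|G x nu| <= CG.
Hypothesis GK : forall x y nu, `|G x nu - G y nu| <= KG * enorm (x - y).
Local Notation dt := (T / N%:R).
Local Notation vrev := (value_rev T L F G Cb N dx).

Let dt0 : 0 < dt. Proof. by rewrite divr_gt0 // ltr0n. Qed.

Let ball_ne : [set a : 'rV[R]_d | enorm a <= Cb] !=set0.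
Proof. by exists 0; rewrite /= /enorm /dotp big1 ?sqrtr0 ?ltW // => l _; rewrite mxE mul0r. Qed.

Let hamil (mu : R -> P1 R d) n (i : 'rV[int]_d) (a : 'rV[R]_d) : R :=
  dt * L (gridpt dx i) a + interp1 dx (vrev mu n) (gridpt dx i - dt *: a).

Let vrevS mu n i : vrev mu n.+1 i =
  inf (hamil mu n i @` [set a | enorm a <= Cb]) +
  dt * F (gridpt dx i) (mu ((N - n.+1)%:R * dt)).
Proof. by []. Qed.

Lemma value_rev_bound mu n i : `|vrev mu n i| <= CG + n%:R * (dt * (CL + CF)).
Proof.
elim: n i => [|n IH] i; first by rewrite mul0r addr0; exact: GC.
rewrite vrevS; apply: le_trans (ler_normD _ _) _.
have -> : CG + n.+1%:R * (dt * (CL + CF)) =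
    (dt * CL + (CG + n%:R * (dt * (CL + CF)))) + dt * CF by rewrite -natr1; ring.
rewrite lerD //; last by rewrite normrM (gtr0_norm dt0) ler_pM2l.
apply: inf_image_bound => // a aC; rewrite /hamil.
apply: le_trans (ler_normD _ _) _; rewrite lerD //.
  by rewrite normrM (gtr0_norm dt0) ler_pM2l //; exact: LC.
exact: interp1_bound.
Qed.

Let hamil_bound mu n i a : enorm a <= Cb ->
  `|hamil mu n i a| <= dt * CL + (CG + n%:R * (dt * (CL + CF))).
Proof.
move=> aC; apply: le_trans (ler_normD _ _) _; rewrite lerD //.
  by rewrite normrM (gtr0_norm dt0) ler_pM2l //; exact: LC.
by apply: interp1_bound => // j; exact: value_rev_bound.
Qed.

(** A shift of the node by one grid step shifts every term of the infimum by the
    same step while the set of controls does not move, so one backward step adds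
    dt times the Lipschitz constants of the running cost. *)
Lemma value_rev_lipschitz mu n l i :
  `|vrev mu n (shift_idx l i) - vrev mu n i| <= (KG + n%:R * (dt * (KL + KF))) * dx.
Proof.
have eg (s : R) (j : 'rV[int]_d) : enorm (gridpt dx (shift_idx l j) - gridpt dx j) = dx.
  by rewrite gridpt_shift addrAC subrr add0r enorm_delta gtr0_norm.
elim: n i => [|n IH] i.
  by rewrite mul0r addr0 /=; apply: le_trans (GK _ _ _) _; rewrite eg.
rewrite !vrevS opprD addrACA; apply: le_trans (ler_normD _ _) _.
have -> : (KG + n.+1%:R * (dt * (KL + KF))) * dx =
   (dt * (KL * dx) + (KG + n%:R * (dt * (KL + KF))) * dx) + dt * (KF * dx).
  by rewrite -natr1; ring.
rewrite lerD //; last first.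
  rewrite -mulrBr normrM (gtr0_norm dt0) ler_pM2l //.
  by apply: le_trans (FK _ _ _) _; rewrite eg.
apply: inf_image_dist => //; try by move=> a aC; exact: hamil_bound.
move=> a aC; rewrite /hamil opprD addrACA; apply: le_trans (ler_normD _ _) _.
rewrite lerD //.
  rewrite -mulrBr normrM (gtr0_norm dt0) ler_pM2l // gridpt_shift.
  by apply: le_trans (LK _ _ _ aC) _; rewrite gtr0_norm.
rewrite gridpt_shift addrAC interp1_shift // interp1B //.
by apply: interp1_bound => // j; exact: IH.
Qed.

(** The controls are bounded, so all feet of characteristics from a node stay in
    a box. Convergence at the finitely many nodes of a larger box is therefore
    uniform over the controls, and passes to the infimum. *)
Lemma value_rev_cvg (mu_ : nat -> R -> P1 R d) mu n i :
  (forall t, t \in `[0, T] -> W1_cvg (mu_^~ t) (mu t)) ->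
  continuous_Rd_P1 F -> continuous_Rd_P1 G ->
  (n <= N)%N ->
  vrev (mu_ m) n i @[m --> \oo] --> vrev mu n i.
Proof.
move=> mc cF cG; elim: n i => [|n IH] i nN.
  by apply: cost_cvg => //; apply: mc; rewrite in_itv /= lexx ltW.
rewrite vrevS; under eq_cvg => m do rewrite vrevS.
apply: cvgD; last first.
  apply: cvgM; first exact: cvg_cst.
  apply: cost_cvg => //; apply: (mc ((N - n.+1)%:R * dt)).
  rewrite in_itv /=; apply/andP; split; first by rewrite mulr_ge0 // ltW.
  rewrite mulrA ler_pdivrMr ?ltr0n //.
  by rewrite mulrC ler_pM2l // ler_nat leq_subr.
apply/cvgrPdist_le => e e0.
pose r := `|gridpt dx i| + dt * Cb.
have near_all : \forall m \near \oo, forall j : 'rV[int]_d, j \in enum_fset (fset_set (grid_box dx (r + dx))) ->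
    `|vrev mu n j - vrev (mu_ m) n j| <= e.
  apply: near_seq => j _; have /cvgrPdist_le := IH j (ltnW nN); exact.
apply: filterS near_all => m me.
apply: inf_image_dist => //; try by move=> a aC; exact: hamil_bound.
move=> a aC; rewrite /hamil addrAC opprD addrA subrr add0r addrC interp1B //.
apply: (@interp1_bound_near _ _ _ dx0 _ _ r) => [j jr|].
  have fin := @finite_grid_box R d dx (r + dx) dx0.
  by apply: me; rewrite in_fset_set //; apply/mem_set.
apply: le_trans (ler_normB _ _) _; rewrite lerD // normrZ (gtr0_norm dt0) ler_pM2l //.
exact: le_trans (norm_le_enorm _) aC.
Qed.

Let ndt (n : nat) : (n <= N)%N -> n%:R * dt <= T.
Proof.
by move=> nN; rewrite mulrA ler_pdivrMr ?ltr0n // mulrC ler_pM2l // ler_nat.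
Qed.

Lemma value_fun_bound mu k x : `|value_fun T L F G Cb N dx mu k x| <= CG + T * (CL + CF).
Proof.
apply: interp1_bound => // i; apply: le_trans (value_rev_bound _ _ _) _.
have C0 : 0 <= CL + CF.
  have [a aC] := ball_ne.
  by rewrite addr_ge0 // ?(le_trans (normr_ge0 _) (LC 0 aC)) ?(le_trans (normr_ge0 _) (FC 0 (mu 0))).
by rewrite lerD2l mulrA ler_wpM2r // ndt // leq_subr.
Qed.

Hypotheses (KL0 : 0 <= KL) (KF0 : 0 <= KF).

Lemma value_fun_lipschitz mu k :
  coord_lipschitz (KG + T * (KL + KF)) (value_fun T L F G Cb N dx mu k).
Proof.
apply: interp1_lipschitz => // l i; apply: le_trans (value_rev_lipschitz _ _ _ _) _.
rewrite ler_pM2r // lerD2l mulrA ler_wpM2r //; first by rewrite addr_ge0.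
by rewrite ndt // leq_subr.
Qed.

Lemma value_fun_cvg (mu_ : nat -> R -> P1 R d) mu k x :
  (forall t, t \in `[0, T] -> W1_cvg (mu_^~ t) (mu t)) ->
  continuous_Rd_P1 F -> continuous_Rd_P1 G ->
  value_fun T L F G Cb N dx (mu_ m) k x @[m --> \oo] --> value_fun T L F G Cb N dx mu k x.
Proof.
move=> mc cF cG; rewrite /value_fun; have [n [t [t01 ->]]] := cell_coords dx0 x.
rewrite interp1_multilinear //; under eq_cvg => m do rewrite interp1_multilinear //.
apply: cvg_bigsum => e _; apply: cvgM; last exact: cvg_cst.
by apply: value_rev_cvg => //; exact: leq_subr.
Qed.

End value.

(** * Mollification *)

Lemma Rintegral_dominated_cvg (R : realType) (disp : measure_display)
    (X : measurableType disp) (mu : {measure set X -> \bar R}) (D : set X)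
    (f_ : nat -> X -> R) (f g : X -> R) : measurable D ->
  (forall n, measurable_fun D (f_ n)) -> measurable_fun D f ->
  {ae mu, forall x, D x -> f_ n x @[n --> \oo] --> f x} ->
  mu.-integrable D (EFin \o g) ->
  (forall n x, D x -> `|f_ n x| <= g x) ->
  (\int[mu]_(x in D) f_ n x) @[n --> \oo] --> \int[mu]_(x in D) f x.
Proof.
move=> mD mf_ mf ff ig fg.
have [|||||fi _ H] := @dominated_convergence _ _ _ mu D mD
   (fun n x => (f_ n x)%:E) (EFin \o f) (EFin \o g).
- by move=> n; apply/measurable_EFinP.
- by apply/measurable_EFinP.
- by apply: filterS ff => x fx Dx; apply: cvg_EFin; [exact: nearW|exact: fx].
- exact: ig.
- by apply: aeW => x n Dx; rewrite lee_fin; exact: fg.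
- apply: fine_cvg; rewrite fineK //; exact: (integrable_fin_num mD fi).
Qed.

Section basics.
Context {R : realType} {d : nat}.
Local Notation leb := (lebesgue_rV R d).
Implicit Types (g h w : 'rV[R]_d -> R).

Definition integ g := leb.-integrable setT (EFin \o g).

Lemma integM g w (C : R) : integ g -> measurable_fun setT w -> (forall z, `|w z| <= C) ->
  integ (fun z => g z * w z).
Proof.
move=> ig mw wC; have := @integrableMl _ _ _ leb setT measurableT (EFin \o g) w ig mw.
apply; exists C; split; first exact: num_real.
by move=> M CM z _; apply: le_trans (wC z) (ltW CM).
Qed.

Lemma integ_affine g a b : b != 0 -> integ g -> integ (fun z => g (a + b *: z)).
Proof. by move=> b0 ig; exact: (integrable_affine_rV a b0 ig). Qed.

Lemma Rint_affine g a b : b != 0 -> integ g ->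
  \int[leb]_z g (a + b *: z) = `|b| ^- d * \int[leb]_z g z.
Proof.
move=> b0 ig; rewrite /Rintegral (integral_affine_rV a b0 ig).
by rewrite fineM // integrable_fin_num.
Qed.

Lemma Rint_translate g a : integ g -> \int[leb]_z g (a + z) = \int[leb]_z g z.
Proof.
move=> ig; have := Rint_affine a (@oner_neq0 R) ig.
rewrite normr1 expr1n invr1 mul1r => <-.
by apply: eq_Rintegral => z _; rewrite scale1r.
Qed.

Lemma integ_translate g a : integ g -> integ (fun z => g (a + z)).
Proof.
move=> ig; have := integ_affine a (@oner_neq0 R) ig.
by rewrite (_ : (fun z => g (a + 1 *: z)) = (fun z => g (a + z))) //; apply/funext => z; rewrite scale1r.
Qed.

Lemma integ_translater g a : integ g -> integ (fun z => g (z + a)).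
Proof.
move=> /(integ_translate a); rewrite (_ : (fun z => g (a + z)) = (fun z => g (z + a))) //.
by apply/funext => z; rewrite addrC.
Qed.

Lemma integ_norm g : integ g -> integ (fun z => `|g z|).
Proof. exact: integrable_norm. Qed.

Lemma integD g h : integ g -> integ h -> integ (fun z => g z + h z).
Proof. by move=> ig ih; exact: (@integrableD _ _ _ leb setT measurableT _ _ ig ih). Qed.

Lemma integB g h : integ g -> integ h -> integ (fun z => g z - h z).
Proof. by move=> ig ih; exact: (@integrableB _ _ _ leb setT measurableT _ _ ig ih). Qed.

Lemma integZ g c : integ g -> integ (fun z => c * g z).
Proof. by move=> ig; exact: (@integrableZl _ _ _ leb setT measurableT c _ ig). Qed.

Lemma Rintegral_mul_bound g w (C : R) : integ g -> measurable_fun setT w ->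
  (forall z, `|w z| <= C) -> `|\int[leb]_z (g z * w z)| <= C * \int[leb]_z `|g z|.
Proof.
move=> ig mw wC; have igw := integM ig mw wC.
apply: le_trans (le_normr_Rintegral measurableT igw) _.
rewrite -RintegralZl //; last exact: integ_norm.
apply: le_Rintegral => //.
- exact: (integ_norm igw).
- exact: (integZ C (integ_norm ig)).
by move=> z _; rewrite normrM mulrC ler_wpM2r.
Qed.

Lemma Rint_ge0 g : (forall z, 0 <= g z) -> 0 <= \int[leb]_z g z.
Proof. by move=> g0; apply: Rintegral_ge0. Qed.

End basics.

Section fubini_increment.
Context {R : realType} {d : nat}.
Local Notation leb := (lebesgue_rV R d).
Variables (g : 'rV[R]_d -> R) (e : 'rV[R]_d) (W : 'rV[R]_d -> R) (C B t : R).
Local Notation Dg := ('D_e g).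
Hypotheses (dg : forall z, derivable g z e) (cg : continuous Dg) (ig : integ g) (iDg : integ Dg).
Hypotheses (mW : measurable_fun setT W) (WC : forall z, `|W z| <= C) (t0 : 0 < t).
Hypothesis (HB : forall s, 0 <= s <= t ->
   `|\int[leb]_z ((Dg (z + s *: e) - Dg z) * W z)| <= B).

Let mDg : measurable_fun setT Dg := continuous_measurable_rV cg.

Let line_fun (z : 'rV[R]_d) (s : R) : R := Dg (z + s *: e) - Dg z.

Let line_cont z : continuous (line_fun z).
Proof.
move=> s; apply: cvgB; last exact: cvg_cst.
apply: (@continuous_comp _ _ _ (fun s : R => z + s *: e) Dg); last exact: cg.
apply: cvgD; first exact: cvg_cst.
by apply: cvgZr_tmp => //; exact: cvg_id.
Qed.

Let ftc z : (\int[lebesgue_measure]_(s in `[0%R, t]) (line_fun z s)%:E)%E =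
  (g (z + t *: e) - g z - t * Dg z)%:E.
Proof.
pose FF (s : R) := g (z + s *: e) - s * Dg z.
have dF (s : R) : is_derive s (1 : R) FF (line_fun z s).
  have H := is_derive_line (@dg (z + s *: e)).
  rewrite /FF /line_fun; apply: is_derive_eq; rewrite scaler0 add0r.
  by rewrite -[_ *: 1]/(_ * 1) mulr1.
have cF : continuous FF.
  by move=> s; apply: differentiable_continuous; apply/derivable1_diffP; case: (dF s).
rewrite (@continuous_FTC2 _ _ FF) //.
- by rewrite /FF scale0r addr0 mul0r subr0 -EFinB addrAC.
- exact: continuous_subspaceT.
- split=> [s _||]; first by case: (dF s).
  + by apply: cvg_at_right_filter; exact: cF.
  + by apply: cvg_at_left_filter; exact: cF.
- by move=> s _; rewrite derive1E; case: (dF s).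
Qed.

Let f (p : measurableTypeR R * 'rV[R]_d) : \bar R :=
  (line_fun p.2 p.1 * W p.2 * \1_(`[0%R, t]%classic : set R) p.1)%:E.

Let mf : measurable_fun setT f.
Proof.
apply/measurable_EFinP; apply: measurable_funM; last first.
  apply: measurableT_comp => //; exact: measurable_fst.
apply: measurable_funM; last first.
  by apply: measurableT_comp => //; exact: measurable_snd.
have ml : measurable_fun setT (fun p : measurableTypeR R * 'rV[R]_d => p.2 + p.1 *: e).
  apply/measurable_fun_rVP => j.
  rewrite (_ : (fun _ => _) = (fun p : measurableTypeR R * 'rV[R]_d => p.2 0 j + p.1 * e 0 j)).
    apply: measurable_funD; last by apply: measurable_funM => //; exact: measurable_fst.
    exact: (measurableT_comp (measurable_coord_rV j) measurable_snd).
  by apply/funext => p; rewrite !mxE.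
apply: measurable_funB; first exact: (measurableT_comp mDg ml).
exact: (measurableT_comp mDg measurable_snd).
Qed.

Let inner_s z : (\int[lebesgue_measure]_s f (s, z))%E =
  ((g (z + t *: e) - g z - t * Dg z) * W z)%:E.
Proof.
rewrite EFinM -ftc -integralZr //; last first.
  apply: continuous_compact_integrable; first exact: segment_compact.
  by apply: continuous_subspaceT; exact: line_cont.
rewrite [RHS]integral_mkcond; apply: eq_integral => s _.
rewrite /f patchE indicE /=.
by case: (_ \in _); rewrite ?mulr1 ?mulr0 ?EFinM.
Qed.

Let shift_integ s : integ (fun z => Dg (z + s *: e)).
Proof.
exact: integ_translater.
Qed.

Let diff_integ s : integ (fun z => (Dg (z + s *: e) - Dg z) * W z).
Proof.
apply: (@integM _ _ _ _ C) => //.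
exact: integB.
Qed.

Let inner_z s : (\int[leb]_z f (s, z))%E =
  ((\int[leb]_z ((Dg (z + s *: e) - Dg z) * W z)) * \1_(`[0%R, t]%classic : set R) s)%:E.
Proof.
rewrite /f /= EFinM /Rintegral fineK; last exact: integrable_fin_num (diff_integ s).
by rewrite -integralZr //; exact: diff_integ.
Qed.

Let abs_bound s : (\int[leb]_z `|f (s, z)| <=
   ((2 * C * \int[leb]_z `|Dg z|) * \1_(`[0%R, t]%classic : set R) s)%:E)%E.
Proof.
have C0 : 0 <= C by exact: le_trans (normr_ge0 _) (WC 0).
have I0 : 0 <= \int[leb]_z `|Dg z| by apply: Rint_ge0.
rewrite /f /= indicE; case: (_ \in _) => /=; last first.
  by under eq_integral do rewrite mulr0 normr0; rewrite integral0 mulr0.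
under eq_integral do rewrite mulr1.
have -> : (\int[leb]_z (`|line_fun z s * W z|%:E))%E = (\int[leb]_z `|line_fun z s * W z|)%:E.
  by rewrite /Rintegral fineK //; apply: integrable_fin_num (integ_norm (diff_integ s)).
rewrite lee_fin mulr1.
have -> : 2 * C * \int[leb]_z `|Dg z| =
    C * (\int[leb]_z `|Dg (s *: e + z)| + \int[leb]_z `|Dg z|).
  by rewrite (Rint_translate (s *: e) (integ_norm iDg)); ring.
have isum : integ (fun z => `|Dg (s *: e + z)| + `|Dg z|).
  by apply: integD; [exact: (integ_translate (s *: e) (integ_norm iDg))|exact: integ_norm].
rewrite -RintegralD //; first last.
- exact: integ_norm.
- exact: (integ_translate (s *: e) (integ_norm iDg)).
rewrite -RintegralZl //.
apply: le_Rintegral => //.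
- exact: integ_norm (diff_integ s).
- exact: (integZ C isum).
move=> z _; rewrite normrM mulrC ler_pM // addrC.
by apply: le_trans (ler_normB _ _) _; rewrite addrC [s *: e + z]addrC.
Qed.

Let ind_integral (c : R) :
  (\int[lebesgue_measure]_s (c * \1_(`[0%R, t]%classic : set R) s)%:E)%E = (c * t)%:E.
Proof.
under eq_integral do rewrite EFinM.
rewrite integralZl //; last exact: (integrable_indic_itv 0 t true false).
rewrite integral_indic // setIT.
have := lebesgue_measure_itv `[0%R, t]; rewrite /= lte_fin t0 oppr0 adde0 => ->.
by rewrite EFinM.
Qed.

Let fint : (lebesgue_measure \x leb)%E.-integrable setT f.
Proof.
apply/integrable12ltyP => //.
apply: (@le_lt_trans _ _ ((2 * C * \int[leb]_z `|Dg z|) * t)%:E); last exact: ltry.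
rewrite -ind_integral; apply: ge0_le_integral => //.
- by move=> s _; apply: integral_ge0 => z _; exact: abse_ge0.
- apply: (@measurable_fun_fubini_tonelli_F _ _ (measurableTypeR R) 'rV[R]_d R leb (fun p => `|f p|%E)) => //.
  by apply: measurableT_comp.
- by apply/measurable_EFinP; apply: measurable_funM.
Qed.

Let incr_integ : integ (fun z => (g (z + t *: e) - g z - t * Dg z) * W z).
Proof.
apply: (@integM _ _ _ _ C) => //; apply: integB; last exact: integZ.
by apply: integB => //; exact: integ_translater.
Qed.

(** The increment of g from z to z + t e minus its linear part is the integral
    over s in [0, t] of Dg (z + s e) - Dg z. Exchanging this integral with the
    one over z brings in the translates of Dg tested against W, on which the
    hypothesis bears. *)
Lemma fubini_increment :
  `|\int[leb]_z ((g (z + t *: e) - g z - t * Dg z) * W z)| <= B * t.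
Proof.
have mF := measurable_fubini_F fint.
rewrite -lee_fin.
have -> : (`|\int[leb]_z ((g (z + t *: e) - g z - t * Dg z) * W z)|%:E =
    `|\int[lebesgue_measure]_s \int[leb]_z f (s, z)|)%E.
  rewrite (Fubini fint).
  under [in RHS]eq_integral do rewrite inner_s.
  by rewrite -[in RHS](fineK (integrable_fin_num measurableT incr_integ)).
apply: le_trans (le_abse_integral _ _ _) _ => //.
rewrite -ind_integral; apply: ge0_le_integral => //.
- by apply: measurableT_comp.
- by apply/measurable_EFinP; apply: measurable_funM.
- move=> s _; rewrite /= inner_z lee_fin indicE; case: (boolP (_ \in _)) => [|_] /=.
    by rewrite inE /= in_itv /= !mulr1; exact: HB.
  by rewrite !mulr0 normr0.
Qed.

End fubini_increment.

Section mollification.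
Context {R : realType} {d : nat}.
Local Notation leb := (lebesgue_rV R d).
Variable eps : R.
Hypothesis eps0 : 0 < eps.
Implicit Types (g v : 'rV[R]_d -> R).

(** The convolution of v with the rescaled kernel, written so that the kernel
    does not depend on eps; see moll_smear. Here g stands for rho or for one of
    its derivatives. *)
Definition smear g v (x : 'rV[R]_d) : R :=
  \int[leb]_z (g z * v (x - eps *: z)).

Lemma measurable_reflect v x : measurable_fun setT v ->
  measurable_fun setT (fun z : 'rV[R]_d => v (x - eps *: z)).
Proof.
move=> mv; have := measurableT_comp mv (measurable_affine_rV x (- eps)).
by apply: eq_measurable_fun => z _ /=; rewrite scaleNr.
Qed.

Lemma smear_integ g v (C : R) x : integ g -> measurable_fun setT v ->
  (forall z, `|v z| <= C) -> integ (fun z => g z * v (x - eps *: z)).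
Proof. by move=> ig mv vC; apply: (@integM _ _ _ _ C) => //; exact: measurable_reflect. Qed.

Lemma smear_lipschitz g v (C K : R) : integ g -> measurable_fun setT v ->
  (forall z, `|v z| <= C) -> coord_lipschitz K v ->
  coord_lipschitz (K * \int[leb]_z `|g z|) (smear g v).
Proof.
move=> ig mv vC vK x l s; rewrite /smear -RintegralB //; last 2 first.
- exact: (smear_integ _ ig mv vC).
- exact: (smear_integ _ ig mv vC).
rewrite (@eq_Rintegral _ _ _ leb setT (fun z => g z * (v (x - eps *: z + s *: delta_mx 0 l) - v (x - eps *: z)))).
  rewrite mulrAC; apply: Rintegral_mul_bound => //; apply: measurable_funB; last exact: measurable_reflect.
  have := measurable_reflect (x + s *: delta_mx 0 l) mv.
  by apply: eq_measurable_fun => z _; rewrite addrAC.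
by move=> z _; rewrite mulrBr addrAC.
Qed.

(** The translation of the argument moves to the kernel by a change of
    variables; it can then be differentiated although v is merely Lipschitz. *)
Lemma smear_translate g v (C : R) x e s : integ g -> measurable_fun setT v ->
  (forall z, `|v z| <= C) ->
  smear g v (x + s *: e) = \int[leb]_z (g (z + (s / eps) *: e) * v (x - eps *: z)).
Proof.
move=> ig mv vC; rewrite /smear.
rewrite -(Rint_translate ((s / eps) *: e)); last exact: (smear_integ _ ig mv vC).
apply: eq_Rintegral => z _; rewrite [_ + z]addrC; congr (_ * v _).
rewrite scalerDr scalerA [eps * _]mulrC divfK ?gt_eqF // opprD addrACA.
by rewrite [s *: e - _]addrC -addrA addNr addr0.
Qed.

Lemma smear_cvg g (v_ : nat -> 'rV[R]_d -> R) v (C : R) x : integ g ->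
  (forall n, measurable_fun setT (v_ n)) -> measurable_fun setT v ->
  (forall n z, `|v_ n z| <= C) -> (forall z, v_ n z @[n --> \oo] --> v z) ->
  smear g (v_ n) x @[n --> \oo] --> smear g v x.
Proof.
move=> ig mv_ mv vC vv.
have mg : measurable_fun setT g by apply/measurable_EFinP; exact: measurable_int ig.
apply: (@Rintegral_dominated_cvg _ _ _ _ _ _ _ (fun z => C * `|g z|)) => //.
- by move=> n; apply: measurable_funM => //; exact: measurable_reflect.
- by apply: measurable_funM => //; exact: measurable_reflect.
- by apply: aeW => z _; apply: cvgM; [exact: cvg_cst|exact: vv].
- by apply: integZ; exact: integ_norm.
- by move=> n z _; rewrite normrM mulrC ler_wpM2r.
Qed.

Section gradient.
Variables (rho : 'rV[R]_d -> R) (v : 'rV[R]_d -> R) (C K : R) (l : 'I_d).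
Local Notation e := (delta_mx 0 l : 'rV[R]_d).
Hypotheses (drho : forall z, derivable rho z e) (cDrho : continuous ('D_e rho)).
Hypotheses (irho : integ rho) (iDrho : integ ('D_e rho)).
Hypotheses (mv : measurable_fun setT v) (vC : forall z, `|v z| <= C).
Hypotheses (K0 : 0 <= K) (vK : coord_lipschitz K v).

Let I : R := \int[leb]_z `|'D_e rho z|.
Let I0 : 0 <= I. Proof. exact: Rint_ge0. Qed.
Let G x : R := eps^-1 * smear ('D_e rho) v x.

Let G_lip x s : `|G (x + s *: e) - G x| <= eps^-1 * (K * I) * `|s|.
Proof.
rewrite /G -mulrBr normrM ger0_norm ?invr_ge0 ?(ltW eps0) // -mulrA ler_pM2l ?invr_gt0 //.
exact: (smear_lipschitz iDrho mv vC vK).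
Qed.

Let forward x s : 0 < s ->
  `|smear rho v (x + s *: e) - smear rho v x - s * G x| <= eps^-1 * (K * I) * s ^+ 2.
Proof.
move=> s0; pose t := s / eps; have t0 : 0 < t by rewrite divr_gt0.
pose W z := v (x - eps *: z).
have mW : measurable_fun setT W by exact: measurable_reflect.
have WC z : `|W z| <= C by exact: vC.
have HB u : 0 <= u <= t ->
    `|\int[leb]_z (('D_e rho (z + u *: e) - 'D_e rho z) * W z)| <= K * I * s.
  move=> /andP[u0 ut].
  have := smear_lipschitz iDrho mv vC vK x l (u * eps).
  rewrite (smear_translate _ _ _ iDrho mv vC) mulfK ?gt_eqF //.
  rewrite /smear -RintegralB //; last 2 first.
  - exact: (integM (integ_translater (u *: e) iDrho) mW WC).
  - exact: (smear_integ _ iDrho mv vC).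
  rewrite (@eq_Rintegral _ _ _ leb setT (fun z => ('D_e rho (z + u *: e) - 'D_e rho z) * W z)); last first.
    by move=> z _; rewrite mulrBl.
  move=> /le_trans; apply; rewrite ler_wpM2l ?mulr_ge0 //.
  rewrite ger0_norm ?mulr_ge0 // ?(ltW eps0) //.
  by rewrite -ler_pdivlMr.
have := fubini_increment drho cDrho irho iDrho mW WC t0 HB.
have -> : K * I * s * t = eps^-1 * (K * I) * s ^+ 2 by rewrite /t; ring.
apply: le_trans.
have ish : integ (fun z => rho (z + t *: e)).
  exact: integ_translater.
rewrite (smear_translate _ _ _ irho mv vC) -/t /smear /G /smear.
rewrite mulrA -/t -RintegralZl //; last exact: (smear_integ _ iDrho mv vC).
rewrite -RintegralB //; last 2 first.
- exact: integM ish mW WC.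
- exact: (smear_integ _ irho mv vC).
rewrite -RintegralB //; last 2 first.
- by apply: integB; [exact: integM ish mW WC|exact: (smear_integ _ irho mv vC)].
- by apply: integZ; exact: (smear_integ _ iDrho mv vC).
rewrite le_eqVlt; apply/orP; left; apply/eqP; congr Num.norm.
by apply: eq_Rintegral => z _; rewrite /W; ring.
Qed.

(** After smear_translate the difference quotient in x is a difference quotient
    of rho. The remainder is estimated by fubini_increment, with the bound that
    the Lipschitz continuity of smear ('D_e rho) v gives for translates of the
    derivative.  Negative increments follow by exchanging the two endpoints. *)
Lemma is_derive_smear x : is_derive x e (smear rho v) (eps^-1 * smear ('D_e rho) v x).
Proof.
pose B := eps^-1 * (K * I).
have B0 : 0 <= B by rewrite mulr_ge0 ?invr_ge0 ?(ltW eps0) // mulr_ge0.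
apply: (@is_derive_quadratic _ _ _ _ _ _ (2 * B)); first by rewrite mulr_ge0.
move=> h; rewrite -/(G x); have [h0|h0|->] := ltgtP h 0; last first.
- by rewrite scale0r addr0 subrr mul0r subrr normr0 expr0n mulr0.
- apply: le_trans (forward x h0) _; rewrite -/B gtr0_norm // ler_wpM2r ?sqr_ge0 //.
  by rewrite ler_peMl // ler1n.
have nh0 : 0 < - h by rewrite oppr_gt0.
have E : x + h *: e + (- h) *: e = x by rewrite -addrA -scalerDl subrr scale0r addr0.
have := forward (x + h *: e) nh0; rewrite E -/B => f1.
have f2 := G_lip x h; rewrite -/B in f2.
have -> : smear rho v (x + h *: e) - smear rho v x - h * G x =
  - (smear rho v x - smear rho v (x + h *: e) - - h * G (x + h *: e)) +
  h * (G (x + h *: e) - G x) by ring.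
apply: le_trans (ler_normD _ _) _; rewrite normrN normrM.
have -> : 2 * B * `|h| ^+ 2 = B * (- h) ^+ 2 + `|h| * (B * `|h|).
  by rewrite real_normK ?num_real //; rewrite ltr0_norm //; ring.
by rewrite lerD // ler_wpM2l.
Qed.

End gradient.

(** The substitution y = x - eps z. *)
Lemma moll_smear (rho v : 'rV[R]_d -> R) (C : R) x : integ rho -> measurable_fun setT v ->
  (forall z, `|v z| <= C) ->
  \int[leb]_y (rho_eps rho eps (x - y) * v y) = smear rho v x.
Proof.
move=> irho mv vC; pose f z := rho z * v (x - eps *: z).
have fi : integ f := smear_integ x irho mv vC.
have b0 : - eps^-1 != 0 by rewrite oppr_eq0 invr_eq0 gt_eqF.
have := Rint_affine (eps^-1 *: x) b0 fi.
rewrite normrN ger0_norm ?invr_ge0 ?(ltW eps0) // exprVn invrK => e.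
rewrite (@eq_Rintegral _ _ _ leb setT (fun y => eps ^- d * f (eps^-1 *: x + - eps^-1 *: y))); last first.
  move=> y _; rewrite /rho_eps /f -mulrA; congr (_ * (rho _ * v _)).
    by rewrite scalerBr scaleNr.
  rewrite scalerDr !scalerA mulrN mulfV ?gt_eqF // scale1r scaleN1r opprB.
  by rewrite addrCA subrr addr0.
rewrite RintegralZl //; last exact: integ_affine.
by rewrite e mulrA mulVf ?mul1r // expf_neq0 // gt_eqF.
Qed.

End mollification.

(** * Maps close to the identity *)

Section clamp.
Context {R : realType} {d : nat}.
Variable r : R.
Hypothesis r0 : 0 <= r.

(** The projection onto a box for the maximum norm. It extends maps defined on a
    box to the whole space without increasing distances. *)
Definition clamp (x : 'rV[R]_d) : 'rV[R]_d := \row_l Num.max (- r) (Num.min r (x 0 l)).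

Lemma clamp_box x : `|clamp x| <= r.
Proof.
apply: norm_le_coord => // l; rewrite mxE ler_norml.
by rewrite le_max lexx /= ge_max ge_min lexx /= andbT (le_trans _ r0) // oppr_le0.
Qed.

Lemma clamp_id x : `|x| <= r -> clamp x = x.
Proof.
move=> xr; apply/rowP => l; rewrite mxE.
have := le_trans (ler_coord_norm x l) xr; rewrite ler_norml => /andP[h1 h2].
by rewrite (min_idPr h2) (max_idPr h1).
Qed.

Lemma clamp_lip x y : `|clamp x - clamp y| <= `|x - y|.
Proof.
apply: norm_le_coord => // l; rewrite !mxE; apply: le_trans (ler_coord_norm _ l).
rewrite !mxE; move: (x 0 l) (y 0 l) => a b.
have := ler_norm (a - b); have := ler_norm (b - a); rewrite (distrC b a) => h1 h2.
have [ra|ra] := leP r a; have [rb|rb] := leP r b;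
  have [] := leP (- r) a; have [] := leP (- r) b; have [] := leP (- r) r => *;
  rewrite ler_norml; apply/andP; split; lra.
Qed.

End clamp.

Lemma negligible_countable disp (X : measurableType disp) (R : realType)
    (mu : {measure set X -> \bar R}) (I : countType) (F : I -> set X) :
  (forall i, mu.-negligible (F i)) -> mu.-negligible (\bigcup_(i in [set: I]) F i).
Proof.
move=> nF; apply: (@negligibleS _ _ _ mu
   (\bigcup_n (if choice.unpickle n is Some i then F i else set0))).
  by move=> x [i _ Fi]; exists (choice.pickle i) => //; rewrite choice.pickleK.
apply: negligible_bigcup => n; case: (choice.unpickle n) => [i|]; [exact: nF|exact: negligible_set0].
Qed.

Section near_identity.
Context {R : realType} {d : nat}.
Local Notation leb := (lebesgue_rV R d).

Lemma box_measurable (c : 'rV[R]_d) (r : R) : measurable [set x : 'rV[R]_d | `|x - c| <= r].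
Proof.
have m : measurable_fun setT (fun x : 'rV[R]_d => `|x - c|).
  apply: continuous_measurable_rV; apply: (@coord_lipschitz_continuous _ _ 1) => // x l s.
  rewrite mul1r; apply: le_trans (ler_dist_dist _ _) _.
  have -> : x + s *: delta_mx 0 l - c - (x - c) = s *: delta_mx 0 l.
    by rewrite opprB addrA subrK addrAC subrr add0r.
  rewrite normrZ ler_piMr // norm_le_coord // => j.
  by rewrite mxE; case: (_ && _); rewrite ?normr1 ?normr0.
have := m measurableT _ (measurable_itv `]-oo, r]); rewrite setTI.
by congr measurable; apply/seteqP; split=> x /=; rewrite in_itv.
Qed.

Lemma hyperplane_measurable (l : 'I_d) (c : R) : measurable [set x : 'rV[R]_d | x 0 l = c].
Proof.
have := measurable_coord_rV l measurableT (measurable_set1 c).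
by rewrite setTI.
Qed.

(** The displacement is a contraction on the box. Beyond continuity this makes the
    l-th coordinate of Phi strictly increasing in the l-th variable. *)
Definition near_id (r : R) (Phi : 'rV[R]_d -> 'rV[R]_d) := forall x y,
  `|x| <= r -> `|y| <= r -> `|(Phi x - x) - (Phi y - y)| <= 2^-1 * `|x - y|.

Variables (r : R) (Phi : 'rV[R]_d -> 'rV[R]_d).
Hypotheses (r0 : 0 <= r) (HPhi : near_id r Phi).

Definition clamped (x : 'rV[R]_d) : 'rV[R]_d := Phi (clamp r x).

Lemma clamped_measurable : measurable_fun setT clamped.
Proof.
apply/measurable_fun_rVP => j; apply: continuous_measurable_rV => x.
apply: continuous_of_modulus => e e0; exists (e / 2); first by rewrite divr_gt0.
move=> y xy.
have h := clamp_lip r x y; have := HPhi (clamp_box r0 x) (clamp_box r0 y).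
rewrite -/(clamped x) -/(clamped y) => h'.
have : `|clamped x - clamped y| <= e.
  have -> : clamped x - clamped y =
     (clamped x - clamp r x - (clamped y - clamp r y)) + (clamp r x - clamp r y).
    by apply/rowP => l; rewrite !mxE; ring.
  apply: le_trans (ler_normD _ _) _; lra.
by apply: le_trans; have := ler_coord_norm (clamped x - clamped y) j; rewrite !mxE.
Qed.

(** Phi agrees on the box with clamped, which is continuous everywhere. *)
Lemma near_id_measurable (D : set 'rV[R]_d) : measurable D ->
  (forall x, D x -> `|x| <= r) -> measurable_fun D Phi.
Proof.
move=> mD Dr; have := measurable_funTS (D := D) clamped_measurable.
by apply: eq_measurable_fun => x /set_mem/Dr xr; rewrite /clamped clamp_id.
Qed.

(** Along a line of direction e_l the l-th coordinate of Phi takes each value at most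
    once, so null_of_thin_lines applies. *)
Lemma near_id_hyperplane (l : 'I_d) (c : R) :
  leb ([set x | `|x| <= r] `&` clamped @^-1` [set y | y 0 l = c]) = 0%E.
Proof.
apply: (@null_of_thin_lines _ _ l).
  apply: measurableI.
    have := box_measurable 0 r; congr measurable; apply/seteqP; split=> x /=; by rewrite subr0.
  rewrite -[X in measurable X]setTI; apply: clamped_measurable => //.
  exact: hyperplane_measurable.
move=> x s [/= xr xc] [/= yr yc]; apply/eqP; rewrite -normr_le0.
have := HPhi yr xr; rewrite /clamped !clamp_id // in xc yc.
set y := x + _ in yr yc * => h.
have e1 : y - x = s *: delta_mx 0 l by rewrite /y addrAC subrr add0r.
have := ler_coord_norm (Phi y - y - (Phi x - x)) l.
rewrite !mxE xc yc !eqxx mulr1.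
have -> : c - (x 0 l + s) - (c - x 0 l) = - s by ring.
rewrite normrN => h2; have : `|y - x| <= `|s|.
  rewrite e1 normrZ ler_piMr // norm_le_coord // => j.
  by rewrite mxE; case: (_ && _); rewrite ?normr1 ?normr0.
by move: h h2; lra.
Qed.

End near_identity.

(** * Cells of the grid *)

Section cells.
Context {R : realType} {d : nat} (dx : R).
Hypothesis dx0 : 0 < dx.

Lemma cell_measurable (i : 'rV[int]_d) : measurable (@cell R d dx i).
Proof. exact: box_measurable. Qed.

Lemma cell_coord (i : 'rV[int]_d) (x : 'rV[R]_d) : cell dx i x <->
  forall l, (i 0 l)%:~R * dx - dx / 2 <= x 0 l <= (i 0 l)%:~R * dx + dx / 2.
Proof.
rewrite /cell /=; split=> [xi l|H].
  have := le_trans (ler_coord_norm _ l) xi; rewrite !mxE ler_norml => /andP[h1 h2].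
  by apply/andP; split; lra.
apply: norm_le_coord => [|l]; first by rewrite divr_ge0 // ltW.
by rewrite !mxE ler_norml; have /andP[h1 h2] := H l; apply/andP; split; lra.
Qed.

Lemma beta0_gridpt i j : beta0 dx j (gridpt dx i : 'rV[R]_d) = (i == j)%:R.
Proof.
rewrite /beta0 indicE; congr (nat_of_bool _)%:R; apply/idP/eqP => [/set_mem|->].
  move=> /cell_coord H; apply/rowP => l; have := H l; rewrite mxE.
  have e : dx / 2 = 2^-1 * dx by rewrite mulrC.
  rewrite e -mulrBl -mulrDl !ler_pM2r // => /andP[h1 h2].
  have h3 : ((i 0 l - j 0 l)%:~R : R) < 1%:~R by rewrite intrD intrN; lra.
  have h4 : ((j 0 l - i 0 l)%:~R : R) < 1%:~R by rewrite intrD intrN; lra.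
  by move: h3 h4; rewrite !ltr_int; move: (i 0 l) (j 0 l) => a b h3 h4; lia.
by apply/mem_set; rewrite /cell /= subrr normr0 divr_ge0 // ltW.
Qed.

(** Closed cells overlap along their faces. This rule assigns each point to one
    of the cells containing it, the one for which the point is not on an upper
    face. *)
Definition cell_idx (x : 'rV[R]_d) : 'rV[int]_d := \row_l Num.floor (x 0 l / dx + 2^-1).

Lemma cell_idxP x i : cell_idx x = i <->
  forall l, (i 0 l)%:~R * dx - dx / 2 <= x 0 l < (i 0 l)%:~R * dx + dx / 2.
Proof.
have E l : (Num.floor (x 0 l / dx + 2^-1) == i 0 l) =
    ((i 0 l)%:~R * dx - dx / 2 <= x 0 l < (i 0 l)%:~R * dx + dx / 2).
  rewrite floor_eq intrD -[1%:~R]/(1 : R); congr (_ && _).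
    by rewrite -lerBlDr ler_pdivlMr // mulrBl [2^-1 * _]mulrC.
  have -> : (i 0 l)%:~R * dx + dx / 2 = ((i 0 l)%:~R + 1 - 2^-1) * dx by field.
  by rewrite -ltr_pdivrMr // ltrBrDr.
split=> [e l|H].
  by rewrite -E -e mxE.
by apply/rowP => l; rewrite mxE; apply/eqP; rewrite E.
Qed.

Definition half_cell i : set 'rV[R]_d := cell_idx @^-1` [set i].

Lemma half_cell_measurable i : measurable (half_cell i).
Proof.
have -> : half_cell i = \bigcap_(l in [set: 'I_d])
    ((fun x : 'rV[R]_d => x 0 l) @^-1`
      `[(i 0 l)%:~R * dx - dx / 2, (i 0 l)%:~R * dx + dx / 2[).
  apply/seteqP; split=> x /=; first by move=> /cell_idxP H l _; rewrite /= in_itv; exact: H.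
  by move=> H; apply/cell_idxP => l; have := H l I; rewrite /= in_itv.
apply: fin_bigcap_measurable => // l _; rewrite -[X in measurable X]setTI.
exact: measurable_coord_rV.
Qed.

Variable nu : {measure set 'rV[R]_d -> \bar R}.
Hypothesis nu0 : forall l c, nu [set x | x 0 l = c] = 0%E.

(** The two sets differ by a subset of the upper faces, which lie in
    hyperplanes. *)
Lemma half_cell_full i : nu (half_cell i) = nu (cell dx i).
Proof.
have sub : half_cell i `<=` cell dx i.
  move=> x /cell_idxP H; apply/cell_coord => l.
  by have /andP[h1 h2] := H l; rewrite h1 ltW.
have mh := half_cell_measurable i; have mc := cell_measurable i.
pose Z : set 'rV[R]_d := cell dx i `\` half_cell i.
have mZ : measurable Z by apply: measurableD.
have Z0 : nu Z = 0%E.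
  apply: measure_negligible => //.
  apply: (@negligibleS _ _ _ nu (\bigcup_(l in [set: 'I_d])
      [set x | x 0 l = (i 0 l)%:~R * dx + dx / 2])); last first.
    apply: negligible_countable => l; apply/negligibleP; last exact: nu0.
    exact: hyperplane_measurable.
  move=> x [/cell_coord xi nx]; apply: contrapT => nZ; apply: nx; apply/cell_idxP => l.
  have /andP[h1 h2] := xi l; rewrite h1 lt_neqAle h2 andbT /=.
  by apply/eqP => e; apply: nZ; exists l.
by rewrite -(setDUK sub) measureU0.
Qed.

(** The half-open cells partition the space into countably many pieces; those
    outside S carry no mass. *)
Lemma cells_partition (S : set 'rV[int]_d) : finite_set S ->
  (forall i, ~ S i -> nu (cell dx i) = 0%E) ->
  nu setT = (\sum_(i \in S) nu (cell dx i))%E.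
Proof.
move=> fS nuS; have mh := half_cell_measurable.
have tS : trivIset S half_cell.
  by apply/trivIsetP => i j _ _ /eqP ij; apply/seteqP; split=> x // -[xi xj];
    by apply: ij; rewrite -[LHS]xi -[RHS]xj.
have mS : measurable (\bigcup_(i in S) half_cell i).
  by apply: fin_bigcup_measurable => // i _.
under eq_fsbigr => i _ do rewrite -half_cell_full.
rewrite -measure_fin_bigcup //.
pose N := ~` (\bigcup_(i in S) half_cell i).
have mN : measurable N by apply: measurableC.
have N0 : nu N = 0%E.
  apply: measure_negligible => //.
  apply: (@negligibleS _ _ _ nu (\bigcup_(i in [set: 'rV[int]_d])
      (if pselect (S i) then set0 else half_cell i))); last first.
    apply: negligible_countable => i; case: pselect => /= Si; first exact: negligible_set0.
    by apply/negligibleP => //; exact: (etrans (half_cell_full i) (nuS i Si)).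
  move=> x Nx; exists (cell_idx x) => //; case: pselect => //= Si.
  by apply: Nx; exists (cell_idx x).
by rewrite -(setUv (\bigcup_(i in S) half_cell i)) measureU0.
Qed.

End cells.

(** * Transition masses between cells *)

Section transition.
Context {R : realType} {d : nat}.
Local Notation leb := (lebesgue_rV R d).
Variables (dx r : R).
Hypotheses (dx0 : 0 < dx) (r0 : 0 <= r).
Implicit Types (Phi : 'rV[R]_d -> 'rV[R]_d) (i j : 'rV[int]_d).

(** The volume of the part of cell j that Phi maps into cell i. *)
Definition transition Phi j i : R :=
  \int[leb]_(x in cell dx j) beta0 dx i (Phi x).

Lemma transition_ge0 Phi j i : 0 <= transition Phi j i.
Proof. by apply: Rintegral_ge0 => x _; rewrite /beta0 indicE. Qed.

Lemma lebesgue_cell i : leb (cell dx i) = (dx ^+ d)%:E.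
Proof.
pose a : 'rV[R]_d := \row_l ((i 0 l)%:~R * dx - dx / 2).
pose b : 'rV[R]_d := \row_l ((i 0 l)%:~R * dx + dx / 2).
have -> : cell dx i = [set x | forall l, a 0 l <= x 0 l <= b 0 l].
  apply/seteqP; split=> x.
    by move=> /(cell_coord dx0) H l; rewrite !mxE; exact: H.
  by move=> H; apply/(cell_coord dx0) => l; have := H l; rewrite !mxE.
rewrite lebesgue_rV_box => [|l]; last by have := dx0; rewrite !mxE; lra.
congr (_%:E); rewrite -[in RHS](card_ord d) -prodr_const.
by apply: eq_bigr => l _; rewrite !mxE; field.
Qed.

Lemma null_hyperplane (l : 'I_d) (c : R) : leb [set x | x 0 l = c] = 0%E.
Proof.
apply: (@null_of_thin_lines _ _ l); first exact: hyperplane_measurable.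
by move=> x s /= xc; rewrite !mxE xc !eqxx mulr1 => sc; lra.
Qed.

Section one_map.
Variable Phi : 'rV[R]_d -> 'rV[R]_d.
Hypothesis HPhi : near_id r Phi.
Variable j : 'rV[int]_d.
Hypothesis jr : forall x, cell dx j x -> `|x| <= r.

Let mcl : measurable_fun setT (clamped r Phi) := clamped_measurable r0 HPhi.

(** The image under Phi of Lebesgue measure on cell j. By
    transported_hyperplane, cells_partition applies to it. *)
Definition transported : {measure set 'rV[R]_d -> \bar R} :=
  measure_function_pushforward__canonical__measure_function_Measure
    (mrestr leb (cell_measurable dx j)) mcl.

Lemma transportedE A : transported A = leb (clamped r Phi @^-1` A `&` cell dx j).
Proof. by []. Qed.

Let fin_cell A : measurable A -> leb (A `&` cell dx j) \is a fin_num.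
Proof.
move=> mA; rewrite ge0_fin_numE //; have mj := cell_measurable dx j.
have /le_lt_trans -> // : (leb (A `&` cell dx j) <= leb (cell dx j))%E.
  by apply: le_measure => [||x []//]; apply/mem_set => //; exact: measurableI.
by rewrite lebesgue_cell ltry.
Qed.

Let mpre i : measurable (clamped r Phi @^-1` cell dx i).
Proof. rewrite -[X in measurable X]setTI; apply: mcl => //; exact: cell_measurable. Qed.

Lemma transition_transported i : (transition Phi j i)%:E = transported (cell dx i).
Proof.
have mj := cell_measurable dx j.
rewrite transportedE -(fineK (fin_cell (mpre i))) /transition /Rintegral.
congr (fine _)%:E; apply: etrans (@integral_indic _ _ R leb (cell dx j) mj _ (mpre i)).
apply: eq_integral => x /set_mem xj; congr (_%:E); rewrite /beta0 !indicE; congr (_%:R).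
have E : clamped r Phi x = Phi x by rewrite /clamped clamp_id ?jr.
by congr (nat_of_bool _); apply/idP/idP => /set_mem H; apply/mem_set; move: H; rewrite /preimage /= E.
Qed.

(** This is where the smallness of the time step acts: a map close to the
    identity cannot send a set of positive measure into a face of a cell. *)
Lemma transported_hyperplane l c : transported [set x | x 0 l = c] = 0%E.
Proof.
rewrite transportedE; apply: (@subset_measure0 _ _ _ leb _
  ([set x | `|x| <= r] `&` clamped r Phi @^-1` [set y | y 0 l = c])).
- apply: measurableI; last exact: cell_measurable.
  by rewrite -[X in measurable X]setTI; apply: mcl => //; exact: hyperplane_measurable.
- apply: measurableI.
    have := box_measurable (0 : 'rV[R]_d) r; congr measurable.
    by apply/seteqP; split=> x /=; rewrite subr0.
  by rewrite -[X in measurable X]setTI; apply: mcl => //; exact: hyperplane_measurable.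
- by move=> x [xc xj]; split => //; exact: jr.
- exact: near_id_hyperplane.
Qed.

Lemma transition_sum (S : set 'rV[int]_d) : finite_set S ->
  (forall i, ~ S i -> transition Phi j i = 0) ->
  \sum_(i <- fset_set S) transition Phi j i = dx ^+ d.
Proof.
move=> fS tS.
have h := @cells_partition R d dx dx0 transported transported_hyperplane S fS.
apply: EFin_inj; rewrite -(lebesgue_cell j) -sumEFin.
have -> : leb (cell dx j) = transported setT by rewrite transportedE preimage_setT setTI.
rewrite h => [|i Si]; last by rewrite -transition_transported tS.
rewrite fsbig_finite //=; apply: eq_bigr => i _.
by rewrite transition_transported.
Qed.

End one_map.

(** The indicator of a cell is continuous away from the hyperplanes that carry
    its faces. *)
Lemma beta0_cvg (y_ : nat -> 'rV[R]_d) (y : 'rV[R]_d) i :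
  (forall l, y_ n 0 l @[n --> \oo] --> y 0 l) ->
  (forall l, y 0 l <> (i 0 l)%:~R * dx - dx / 2) ->
  (forall l, y 0 l <> (i 0 l)%:~R * dx + dx / 2) ->
  beta0 dx i (y_ n) @[n --> \oo] --> beta0 dx i y.
Proof.
move=> yy n1 n2; apply: cvg_near_cst; rewrite /beta0.
have [yi|nyi] := pselect (cell dx i y).
  have : \forall n \near \oo, forall l, l \in enum 'I_d ->
      (i 0 l)%:~R * dx - dx / 2 <= y_ n 0 l <= (i 0 l)%:~R * dx + dx / 2.
    apply: (@near_seq _ _ eventually_filter) => l _; have /(cell_coord dx0)/(_ l)/andP[h1 h2] := yi.
    have h1' : (i 0 l)%:~R * dx - dx / 2 < y 0 l.
      by rewrite lt_neqAle h1 andbT eq_sym; apply/eqP.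
    have h2' : y 0 l < (i 0 l)%:~R * dx + dx / 2 by rewrite lt_neqAle h2 andbT; apply/eqP.
    have g1 := cvgr_ge _ (yy l) _ h1'; have g2 := cvgr_le _ (yy l) _ h2'.
    have [k1 _ k1P] := g1; have [k2 _ k2P] := g2; exists (maxn k1 k2) => // n /=.
    by rewrite geq_max => /andP[n1' n2']; rewrite (k1P n n1') (k2P n n2').
  apply: filterS => n H; rewrite !indicE mem_set; last first.
    by apply/(cell_coord dx0) => l; apply: H; rewrite mem_enum.
  by rewrite mem_set.
have [l nl] : exists l, ~~ ((i 0 l)%:~R * dx - dx / 2 <= y 0 l <= (i 0 l)%:~R * dx + dx / 2).
  apply: contrapT => /forallNP H; apply: nyi; apply/(cell_coord dx0) => l.
  by have /negP := H l; rewrite negbK.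
have : \forall n \near \oo,
    ~~ ((i 0 l)%:~R * dx - dx / 2 <= y_ n 0 l <= (i 0 l)%:~R * dx + dx / 2).
  move: nl; rewrite negb_and -!ltNge => /orP[h|h].
    by have [k _ kP] := cvgr_lt _ (yy l) _ h; exists k => // n /kP /= hn; rewrite negb_and -!ltNge hn.
  by have [k _ kP] := cvgr_gt _ (yy l) _ h; exists k => // n /kP /= hn; rewrite negb_and -!ltNge hn orbT.
apply: filterS => n H; rewrite !indicE memNset; last by move=> /(cell_coord dx0)/(_ l); exact/negP.
by rewrite memNset.
Qed.

(** Dominated convergence: the integrands converge at every point of the cell
    whose image under Phi avoids the faces of cell i, hence almost everywhere by
    near_id_hyperplane. *)
Lemma transition_cvg (Phi_ : nat -> 'rV[R]_d -> 'rV[R]_d) Phi j i :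
  (forall n, near_id r (Phi_ n)) -> near_id r Phi ->
  (forall x, cell dx j x -> `|x| <= r) ->
  (forall x l, `|x| <= r -> Phi_ n x 0 l @[n --> \oo] --> Phi x 0 l) ->
  transition (Phi_ n) j i @[n --> \oo] --> transition Phi j i.
Proof.
move=> nid_ nid jr cv; have mj := cell_measurable dx j.
have mb Ps : near_id r Ps -> measurable_fun (cell dx j) (fun x => beta0 dx i (Ps x)).
  move=> nP; apply: (@measurable_comp _ _ _ _ _ _ setT) => //.
    by apply: measurable_indic; exact: cell_measurable.
  exact: near_id_measurable nP _ _ _.
apply: (@Rintegral_dominated_cvg _ _ _ _ _ _ _ (cst 1)) => //.
- by move=> n; exact: mb.
- exact: mb.
- pose Z (lb : 'I_d * bool) : set 'rV[R]_d := [set x | `|x| <= r] `&`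
    clamped r Phi @^-1` [set y | y 0 lb.1 = (i 0 lb.1)%:~R * dx + (-1) ^+ lb.2 * (dx / 2)].
  apply: (@negligibleS _ _ _ leb (\bigcup_(lb in [set: 'I_d * bool]) Z lb)); last first.
    apply: negligible_countable => lb; apply/negligibleP; last exact: near_id_hyperplane.
    apply: measurableI.
      have := box_measurable (0 : 'rV[R]_d) r; congr measurable.
      by apply/seteqP; split=> x /=; rewrite subr0.
    rewrite -[X in measurable X]setTI; apply: clamped_measurable => //.
    exact: hyperplane_measurable.
  move=> x /=; rewrite not_implyE => -[xj ncv]; apply: contrapT => nZ; apply: ncv.
  apply: beta0_cvg => l; first by apply: cv; exact: jr.
    move=> e; apply: nZ; exists (l, true) => //; split; first exact: jr.
    by rewrite /= /clamped clamp_id ?jr // e expr1 mulN1r.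
  move=> e; apply: nZ; exists (l, false) => //; split; first exact: jr.
  by rewrite /= /clamped clamp_id ?jr // e expr0 mul1r.
- apply/integrableP; split; first by apply/measurable_EFinP.
  have -> : (fun x : 'rV[R]_d => `|(EFin \o cst (1%R : R)) x|)%E = cst 1%E.
    by apply/funext => x; rewrite /= normr1.
  apply: (@le_lt_trans _ _ (dx ^+ d)%:E); last exact: ltry.
  by rewrite (@integral_cst _ _ _ leb _ mj) mul1e -(lebesgue_cell j).
- by move=> n x _; rewrite /beta0 indicE; case: (_ \in _); rewrite ?normr1 ?normr0.
Qed.

End transition.

Section mass_recursion.
Context {R : realType} {d : nat}.
Variables (dx r : R).
Hypotheses (dx0 : 0 < dx) (r0 : 0 <= r).
Variable S : set 'rV[int]_d.
Hypothesis fS : finite_set S.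
Hypothesis Sr : forall j, S j -> forall x : 'rV[R]_d, cell dx j x -> `|x| <= r.

Definition step (Phi : 'rV[R]_d -> 'rV[R]_d) (m : 'rV[int]_d -> R) i : R :=
  dx ^- d * \sum_(j \in [set: 'rV[int]_d]) m j * transition dx Phi j i.

Lemma step_fset Phi m i : (forall j, ~ S j -> m j = 0) ->
  step Phi m i = dx ^- d * \sum_(j <- fset_set S) m j * transition dx Phi j i.
Proof.
move=> mS; rewrite /step -(fsbig_widen S) ?fsbig_finite // => j [_ Sj] /=.
by rewrite mS ?mul0r.
Qed.

Lemma step_ge0 Phi m i : (forall j, 0 <= m j) -> 0 <= step Phi m i.
Proof.
move=> m0; rewrite mulr_ge0 ?invr_ge0 ?exprn_ge0 ?(ltW dx0) // fsumr_ge0 // => j _.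
by rewrite mulr_ge0 // transition_ge0.
Qed.

(** If no mass leaves S, then for every j that carries mass the image of cell j
    lies in the cells of S up to a null set, so its whole mass is redistributed.
    *)
Lemma step_sum Phi m : near_id r Phi -> (forall j, 0 <= m j) ->
  (forall j, ~ S j -> m j = 0) -> (forall i, ~ S i -> step Phi m i = 0) ->
  \sum_(i <- fset_set S) step Phi m i * dx ^+ d = \sum_(j <- fset_set S) m j * dx ^+ d.
Proof.
move=> nP m0 mS sS; have dxd : dx ^+ d != 0 by rewrite expf_neq0 // gt_eqF.
under eq_bigr => i _ do rewrite step_fset // mulrAC mulVf // mul1r.
rewrite exchange_big /=; apply: eq_big_seq => j.
rewrite in_fset_set // => /set_mem Sj; rewrite -mulr_sumr.
have [->|mj] := eqVneq (m j) 0; first by rewrite !mul0r.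
congr (_ * _); apply: (@transition_sum _ _ _ r) => //; first exact: Sr.
move=> i Si; have := sS i Si; rewrite step_fset // => /eqP.
rewrite mulf_eq0 invr_eq0 (negbTE dxd) /= psumr_eq0; last first.
  by move=> k _; rewrite mulr_ge0 // transition_ge0.
move=> /allP/(_ j); rewrite in_fset_set // mem_set // => /(_ isT) /=.
by rewrite mulf_eq0 (negbTE mj) /= => /eqP.
Qed.

Lemma step_cvg (Phi_ : nat -> 'rV[R]_d -> 'rV[R]_d) Phi (m_ : nat -> 'rV[int]_d -> R) m i :
  (forall n, near_id r (Phi_ n)) -> near_id r Phi ->
  (forall x l, `|x| <= r -> Phi_ n x 0 l @[n --> \oo] --> Phi x 0 l) ->
  (forall n j, ~ S j -> m_ n j = 0) -> (forall j, ~ S j -> m j = 0) ->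
  (forall j, m_ n j @[n --> \oo] --> m j) ->
  step (Phi_ n) (m_ n) i @[n --> \oo] --> step Phi m i.
Proof.
move=> nP_ nP cv mS_ mS mm; rewrite step_fset //.
have -> : (fun n => step (Phi_ n) (m_ n) i) = (fun n => dx ^- d *
    \sum_(j <- fset_set S | j \in fset_set S) m_ n j * transition dx (Phi_ n) j i).
  by apply/funext => n; rewrite step_fset ?big_seq //; exact: mS_.
rewrite big_seq; apply: cvgM; first exact: cvg_cst.
apply: cvg_bigsum => j; rewrite in_fset_set // => /set_mem Sj.
apply: cvgM; first exact: mm.
apply: (@transition_cvg _ _ dx r dx0 r0) => //; exact: Sr.
Qed.

End mass_recursion.

(** * The discrete flow *)

Lemma lipschitz_derive_bound {R : realType} {d : nat} (f : 'rV[R]_d -> R) x v (D K : R) :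
  is_derive x v f D -> (forall h, `|f (x + h *: v) - f x| <= K * `|h|) -> `|D| <= K.
Proof.
move=> dD HK; have dx := @ex_derive _ _ _ _ _ _ _ dD.
have <- : 'D_v f x = D by exact: derive_val.
have B : \forall h \near (0 : R)^', `|h^-1 *: ((f \o shift x) (h *: v) - f x)| <= K.
  near=> h; have h0 : h != 0 by near: h; exact: nbhs_dnbhs_neq.
  rewrite normrZ normfV ler_pdivrMl ?normr_gt0 // [X in _ <= X]mulrC /= [h *: v + x]addrC; exact: HK.
rewrite ler_norml; apply/andP; split.
  by apply: limr_ge => //; apply: filterS B => h; rewrite ler_norml => /andP[].
by apply: limr_le => //; apply: filterS B => h; rewrite ler_norml => /andP[].
Unshelve. all: by end_near. Qed.

Section lagrangian_bounds.
Context {R : realType} {d : nat}.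
Variables (L : 'rV[R]_d -> 'rV[R]_d -> R) (Cb : R).
Hypotheses (hL : lagrangian_assumption L) (Cb0 : 0 <= Cb).

Let sqr_le (a : 'rV[R]_d) : enorm a <= Cb -> enorm a ^+ 2 <= Cb ^+ 2.
Proof. by move=> aC; rewrite ler_sqr // nnegrE // sqrtr_ge0. Qed.

Lemma lagrangian_bound :
  exists2 CL : R, 0 <= CL & forall x a, enorm a <= Cb -> `|L x a| <= CL.
Proof.
have [_ [m mL] [C1 C10 [C2 C20 LC]] _ _] := hL.
exists (`|m| + C1 * Cb ^+ 2 + C2) => [|x a aC].
  by rewrite !addr_ge0 ?mulr_ge0 ?sqr_ge0 // ltW.
have h1 := mL x a; have h2 := LC x a.
have h3 : C1 * enorm a ^+ 2 <= C1 * Cb ^+ 2 by rewrite ler_pM2l // sqr_le.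
have h4 : 0 <= C1 * Cb ^+ 2 by rewrite mulr_ge0 ?sqr_ge0 // ltW.
have := ler_norm m; have := ler_norm (- m); rewrite normrN ler_norml => h5 h6.
by apply/andP; split; lra.
Qed.

Lemma lagrangian_lipschitz : exists2 KL : R, 0 <= KL &
  forall x l s a, enorm a <= Cb -> `|L (x + s *: delta_mx 0 l) a - L x a| <= KL * `|s|.
Proof.
have [[_ dL] _ _ [C3 C30 LC] _] := hL.
exists (C3 * (1 + Cb ^+ 2)) => [|x l s a aC].
  by rewrite mulr_ge0 ?addr_ge0 ?sqr_ge0 // ltW.
have dLa y : derivable (fun y => L y a) y (delta_mx 0 l).
  have H := dL [::] (delta_mx 0 l, 0) (y, a) isT.
  have E : (fun h : R => h^-1 *: (((fun y => L y a) \o shift y) (h *: delta_mx 0 l) - L y a)) =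
      (fun h : R => h^-1 *: (((fun z => L z.1 z.2) \o shift (y, a))
        (h *: (delta_mx 0 l : 'rV[R]_d, 0 : 'rV[R]_d)) - L y a)).
    by apply/funext => h /=; rewrite scaler0 add0r.
  by rewrite /derivable E.
have [t _ ->] := @derive_mvt _ _ (fun y => L y a) x (delta_mx 0 l) s dLa.
rewrite normrM mulrC ler_wpM2r //.
apply: le_trans (_ : enorm (grad (fun y => L y a) (x + (t * s) *: delta_mx 0 l)) <= _).
  apply: le_trans (norm_le_enorm _); apply: le_trans (ler_coord_norm _ l).
  by rewrite mxE.
apply: le_trans (LC _ _) _; rewrite ler_pM2l // lerD2l sqr_le //.
Qed.

End lagrangian_bounds.

Section mollifier.
Context {R : realType} {d : nat}.
Variable rho : 'rV[R]_d -> R.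
Hypothesis hrho : mollifier_assumption rho.

Lemma mollifier_derivable v z : derivable rho z v.
Proof. by have [[/(_ 1%N)[_ H] _] _ _] := hrho; exact: (H [::] v z isT). Qed.

Lemma mollifier_continuous_derive v : continuous ('D_v rho).
Proof. by have [[/(_ 1%N)[H _] _] _ _] := hrho; exact: (H [:: v] isT). Qed.

Lemma mollifier_integ : integ rho.
Proof.
have [[/(_ 1%N)[H _] _] rho0 I1] := hrho.
apply/integrableP; split.
  by apply/measurable_EFinP; apply: continuous_measurable_rV; exact: (H [::] isT).
under eq_integral do rewrite /= ger0_norm //.
by rewrite I1 ltry.
Qed.

Lemma mollifier_mass : \int[lebesgue_rV R d]_z `|rho z| = 1.
Proof.
have [_ rho0 I1] := hrho; rewrite /Rintegral.
by under eq_integral do rewrite ger0_norm //; rewrite I1.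
Qed.

Lemma mollifier_integ_derive v :
  (\int[lebesgue_rV R d]_x (`|'D_v rho x|)%:E < +oo)%E -> integ ('D_v rho).
Proof.
move=> I; apply/integrableP; split => //.
by apply/measurable_EFinP; apply: continuous_measurable_rV; exact: mollifier_continuous_derive.
Qed.

End mollifier.

Section flow.
Context {R : realType} {d : nat}.
Local Notation leb := (lebesgue_rV R d).
Variables (T : R) (L : 'rV[R]_d -> 'rV[R]_d -> R) (F G : 'rV[R]_d -> P1 R d -> R).
Variables (Cb : R) (rho : 'rV[R]_d -> R).
Hypotheses (T0 : 0 < T) (hL : lagrangian_assumption L).
Hypotheses (hF : cost_assumption F) (hG : cost_assumption G) (Cb0 : 0 < Cb).
Hypothesis hrho : mollifier_assumption rho.
Hypothesis hDrho : forall l : 'I_d, (\int[leb]_x (`|'D_(delta_mx 0 l) rho x|)%:E < +oo)%E.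

Let iDrho l : integ ('D_(delta_mx 0 l) rho).
Proof. exact: mollifier_integ_derive. Qed.

(** Bounds uniform in the curve, in the number of time steps and in the mesh;
    the threshold on dt / eps must not depend on them. *)
Lemma value_fun_regular : exists C K : R, [/\ 0 <= K,
  forall N dx mu k x, (0 < N)%N -> 0 < dx -> `|value_fun T L F G Cb N dx mu k x| <= C &
  forall N dx mu k, (0 < N)%N -> 0 < dx -> coord_lipschitz K (value_fun T L F G Cb N dx mu k)].
Proof.
have [CL CL0 LC] := lagrangian_bound hL (ltW Cb0).
have [KL KL0 LK] := lagrangian_lipschitz hL (ltW Cb0).
have [_ [CF CF0 FC] [KF KF0 FK] _] := hF; have [_ [CG CG0 GC] [KG KG0 GK] _] := hG.
exists (CG + T * (CL + CF)), (KG + T * (KL + KF)); split.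
- by rewrite addr_ge0 ?mulr_ge0 ?addr_ge0 // ltW.
- by move=> N dx mu k x N0 dx0; apply: value_fun_bound.
- by move=> N dx mu k N0 dx0; exact: (value_fun_lipschitz T0 N0 dx0 Cb0 LC LK FC FK GC GK KL0 (ltW KF0)).
Qed.

(** The gradient of the mollified value function is bounded by the Lipschitz
    constant of the value function and is itself Lipschitz with a constant of
    order 1 / eps. The drift dt D_pH therefore has a Lipschitz constant of order
    dt (1 + 1 / eps) on the box, at most dt / eps times a constant since eps is
    bounded; below the threshold it is at most 1 / 2. *)
Lemma flow_regular (r eps_max : R) : 0 < eps_max -> exists2 delta : R, 0 < delta &
  forall (N : nat) (dx eps : R), (0 < N)%N -> 0 < dx -> 0 < eps -> eps <= eps_max ->
    (T / N%:R) / eps <= delta -> forall k,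
    (forall mu, near_id r (flow T L F G rho Cb N dx eps mu k)) /\
    forall mu_ mu, (forall t, t \in `[0, T] -> W1_cvg (mu_^~ t) (mu t)) ->
      forall x l, `|x| <= r ->
      flow T L F G rho Cb N dx eps (mu_ n) k x 0 l @[n --> \oo] -->
        flow T L F G rho Cb N dx eps mu k x 0 l.
Proof.
move=> em0; have [C [K [K0 vC vK]]] := value_fun_regular.
have [LC2 _ _ _ [[kap kap0 Lcvx] _]] := hL.
pose am := amin LC2 kap0 Lcvx.
have [A A0 amK] := amin_lipschitz LC2 kap0 Lcvx r K0.
pose I := \sum_l \int[leb]_z `|'D_(delta_mx 0 l) rho z|.
have Il l : \int[leb]_z `|'D_(delta_mx 0 l) rho z| <= I.
  by rewrite /I (bigD1 l) //= lerDl sumr_ge0 // => j _; exact: Rint_ge0.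
have I0 : 0 <= I by apply: sumr_ge0 => l _; exact: Rint_ge0.
pose Q := d%:R * (K * I); have Q0 : 0 <= Q by rewrite mulr_ge0 // mulr_ge0.
exists (2 * A * (eps_max + Q))^-1.
  by rewrite invr_gt0 !mulr_gt0 // ltr_wpDr.
move=> N dx eps N0 dx0 eps0 epsm small k; set dt := T / N%:R in small.
have dt0 : 0 < dt by rewrite divr_gt0 ?ltr0n.
pose v mu := value_fun T L F G Cb N dx mu k.
have {}vC mu x : `|v mu x| <= C by exact: vC.
have {}vK mu : coord_lipschitz K (v mu) by exact: vK.
have mv mu : measurable_fun setT (v mu).
  by apply: continuous_measurable_rV; exact: coord_lipschitz_continuous (vK mu).
pose p mu x : 'rV[R]_d := \row_l (eps^-1 * smear eps ('D_(delta_mx 0 l) rho) (v mu) x).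
have dsm mu x l : is_derive x (delta_mx 0 l) (smear eps rho (v mu))
    (eps^-1 * smear eps ('D_(delta_mx 0 l) rho) (v mu) x).
  apply: (@is_derive_smear _ _ eps eps0 _ _ C K) => //.
  - by move=> z; exact: mollifier_derivable.
  - exact: mollifier_continuous_derive.
  - exact: mollifier_integ.
have pE mu x : grad (value_moll T L F G rho Cb N dx eps mu k) x = p mu x.
  apply/rowP => l; rewrite !mxE.
  have -> : value_moll T L F G rho Cb N dx eps mu k = smear eps rho (v mu).
    by apply/funext => y; apply: moll_smear (vC mu) => //; exact: mollifier_integ.
  have H := dsm mu x l.
  exact: derive_val.
have pK mu x : `|p mu x| <= K.
  apply: norm_le_coord => // l; rewrite mxE.
  have H := dsm mu x l.
  apply: (lipschitz_derive_bound H) => h.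
  have := smear_lipschitz eps (mollifier_integ hrho) (mv mu) (vC mu) (vK mu) x l h.
  by rewrite mollifier_mass // mulr1.
have pL mu x y : `|p mu x - p mu y| <= eps^-1 * Q * `|x - y|.
  apply: norm_le_coord => [|l].
    by rewrite !mulr_ge0 ?invr_ge0 ?(ltW eps0).
  rewrite !mxE -mulrBr normrM gtr0_norm ?invr_gt0 // -mulrA ler_pM2l ?invr_gt0 //.
  have J0 : 0 <= \int[leb]_z `|'D_(delta_mx 0 l) rho z| by exact: Rint_ge0.
  apply: le_trans (coord_lipschitz_norm _
    (smear_lipschitz eps (iDrho l) (mv mu) (vC mu) (vK mu)) _ _) _.
    by rewrite mulr_ge0.
  by rewrite ler_wpM2r // ler_wpM2l // ler_wpM2l.
have flowE mu x : flow T L F G rho Cb N dx eps mu k x = x - dt *: am x (p mu x).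
  by rewrite /flow pE (grad_hamiltonian LC2 kap0 Lcvx).
split=> [mu x y xr yr|mu_ mu mucv x l xr].
  rewrite !flowE.
  have -> : x - dt *: am x (p mu x) - x - (y - dt *: am y (p mu y) - y) =
      - (dt *: (am x (p mu x) - am y (p mu y))).
    by move: (am x _) (am y _) => u w; apply/rowP => j; rewrite !mxE; ring.
  rewrite normrN normrZ gtr0_norm //.
  apply: le_trans (_ : dt * (A * (`|x - y| + eps^-1 * Q * `|x - y|)) <= _).
    rewrite ler_pM2l //; apply: le_trans (amK _ _ _ _ xr yr (pK _ _) (pK _ _)) _.
    by rewrite ler_pM2l // lerD2l.
  have -> : dt * (A * (`|x - y| + eps^-1 * Q * `|x - y|)) =
      (dt / eps * (A * (eps + Q))) * `|x - y|.
    by field; rewrite gt_eqF.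
  apply: ler_wpM2r => //.
  have B0 : 0 < A * (eps_max + Q) by rewrite mulr_gt0 // ltr_wpDr.
  have h1 : dt / eps * (A * (eps + Q)) <= dt / eps * (A * (eps_max + Q)).
    by apply: ler_wpM2l; [rewrite ltW // divr_gt0|apply: ler_wpM2l; [exact: ltW|rewrite lerD2r]].
  apply: le_trans h1 _; rewrite -ler_pdivlMr //; apply: le_trans small _.
  by rewrite -mulrA invfM.
have pcv j : p (mu_ n) x 0 j @[n --> \oo] --> p mu x 0 j.
  rewrite mxE; under eq_cvg => n do rewrite mxE.
  apply: cvgM; first exact: cvg_cst.
  apply: (@smear_cvg _ _ eps _ _ _ C) => //.
  move=> z; have [cF _ _ _] := hF; have [cG _ _ _] := hG.
  have [CL _ LC] := lagrangian_bound hL (ltW Cb0).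
  have [_ [CF _ FC] _ _] := hF; have [_ [CG _ GC] _ _] := hG.
  exact: (value_fun_cvg T0 N0 dx0 Cb0 LC FC GC mucv cF cG).
have acv : am x (p (mu_ n) x) 0 l @[n --> \oo] --> am x (p mu x) 0 l.
  apply/cvgrPdist_le => e e0.
  have : \forall n \near \oo, forall j, j \in enum 'I_d ->
      `|p mu x 0 j - p (mu_ n) x 0 j| <= e / A.
    apply: (@near_seq _ _ eventually_filter) => j _.
    by have /cvgrPdist_le := pcv j; apply; rewrite divr_gt0.
  apply: filterS => n Hn.
  have := ler_coord_norm (am x (p mu x) - am x (p (mu_ n) x)) l; rewrite !mxE => /le_trans; apply.
  apply: le_trans (amK _ _ _ _ xr xr (pK _ _) (pK _ _)) _.
  rewrite subrr normr0 add0r -ler_pdivlMl // mulrC.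
  apply: norm_le_coord => [|j]; first by rewrite divr_ge0 // ltW.
  by have := Hn j; rewrite !mxE; apply; rewrite mem_enum.
have -> : (fun n => flow T L F G rho Cb N dx eps (mu_ n) k x 0 l) =
    (fun n => x 0 l - dt * am x (p (mu_ n) x) 0 l).
  by apply/funext => n; rewrite flowE !mxE.
rewrite flowE; have -> : (x - dt *: am x (p mu x)) 0 l = x 0 l - dt * am x (p mu x) 0 l.
  by rewrite !mxE.
by apply: cvgB; [exact: cvg_cst|apply: cvgM => //; exact: cvg_cst].
Qed.

End flow.

(** * A coupling bound for the Wasserstein distance *)

Section as_probability.
Context disp (X : measurableType disp) (R : realType).
Variable m : {measure set X -> \bar R}.
Hypothesis m1 : m setT = 1%E.

Definition as_probability of m setT = 1%E : set X -> \bar R := m.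

HB.instance Definition _ := Measure.copy (as_probability m1) m.
HB.instance Definition _ := Measure_isProbability.Build _ _ _ (as_probability m1) m1.

Lemma probability_of_mass1 : exists P : probability X R, forall A, P A = m A.
Proof. by exists (as_probability m1). Qed.

End as_probability.

Lemma measurable_enorm {R : realType} {d : nat} disp (X : measurableType disp)
    (f : X -> 'rV[R]_d) :
  measurable_fun setT f -> measurable_fun setT (fun z => enorm (f z)).
Proof.
move=> mf; apply: (@measurableT_comp _ _ _ _ _ _ (@Num.sqrt R)).
  exact: (continuous_measurable_fun (@sqrt_continuous R)).
apply: measurable_sum => l; apply: measurable_funM;
  by apply: measurableT_comp (measurable_coord_rV l) mf.
Qed.

Section coupling_bound.
Context {R : realType} {d : nat}.
Local Notation V := 'rV[R]_d.
Variables (nu' nu : P1 R d) (tau : {measure set V -> \bar R}) (eta r : R).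
Hypotheses (eta01 : 0 <= eta <= 1) (r0 : 0 <= r).
Hypothesis split_nu' : forall A, measurable A ->
  nu' A = ((1 - eta)%:E * nu A + tau A)%E.
Hypotheses (tau1 : tau setT = eta%:E).
Let K : set V := [set x | `|x| <= r].
Hypotheses (tauK : tau (~` K) = 0%E) (nuK : nu (~` K) = 0%E).

Let e1 : 0 <= 1 - eta. Proof. by rewrite subr_ge0; case/andP: eta01. Qed.

Let diag (x : V) : V * V := (x, x).
Let mdiag : measurable_fun setT diag.
Proof. by apply/measurable_fun_pairP; split; exact: measurable_id. Qed.

Let dnu : {measure set (V * V) -> \bar R} :=
  measure_function_pushforward__canonical__measure_function_Measure nu mdiag.

Let g : {measure set (V * V) -> \bar R} :=
  measure_add (mscale (NngNum e1) dnu) (tau \x nu)%E.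

Let gE A : g A = ((1 - eta)%:E * nu (diag @^-1` A) + (tau \x nu) A)%E.
Proof. exact: measure_addE. Qed.

Let mK : measurable K.
Proof.
have := box_measurable (0 : V) r; congr measurable.
by apply/seteqP; split=> x /=; rewrite subr0.
Qed.

Let pE A B : measurable A -> measurable B -> (tau \x nu)%E (A `*` B) = (tau A * nu B)%E.
Proof. by move=> mA mB; exact: product_measure1E. Qed.

Let nuT : nu setT = 1%E. Proof. exact: probability_setT. Qed.

Let gl A : measurable A -> g (A `*` setT) = nu' A.
Proof.
move=> mA; rewrite gE pE // nuT mule1 split_nu' //.
by congr ((_ * nu _) + _)%E; apply/seteqP; split=> x // [].
Qed.

Let gr B : measurable B -> g (setT `*` B) = nu B.
Proof.
move=> mB; rewrite gE pE // tau1.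
have -> : diag @^-1` (setT `*` B) = B by apply/seteqP; split=> x // [].
rewrite -(fineK (fin_num_measure nu B mB)) -!EFinM -EFinD; congr (_%:E); ring.
Qed.

Let off : set (V * V) := [set z | z.1 != z.2].

Let h (z : V * V) := enorm (z.1 - z.2).

Let mh : measurable_fun setT h.
Proof.
apply: measurable_enorm; apply/measurable_fun_rVP => l.
apply: eq_measurable_fun (_ : measurable_fun setT (fun z : V * V => z.1 0 l - z.2 0 l)).
  by move=> z _; rewrite !mxE.
apply: measurable_funB.
  exact: measurableT_comp (measurable_coord_rV l) measurable_fst.
exact: measurableT_comp (measurable_coord_rV l) measurable_snd.
Qed.

(** Couple by leaving the fraction 1 - eta of nu in place and distributing the
    rest independently: g is (1 - eta) times the diagonal image of nu plus the
    product of tau and nu. Mass moves only with probability at most eta, and by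
    at most the diameter of the box. *)
Lemma W1_of_splitting : (W1 nu' nu <= (d%:R * (2 * r) * eta)%:E)%E.
Proof.
have g1 : g setT = 1%E by rewrite -setXTT gr // nuT.
have [P PE] := probability_of_mass1 g1.
have PK : P (~` (K `*` K)) = 0%E.
  have -> : ~` (K `*` K) = (~` K `*` setT) `|` (setT `*` ~` K).
    apply/seteqP; split => -[x y] /=; first by move=> /not_andP[]; [left|right].
    by move=> [[nx _] [] //|[_ ny] []].
  apply/eqP; rewrite -measure_le0.
  have m1' : measurable (~` K `*` [set: V]) by apply: measurableX => //; exact: measurableC.
  have m2' : measurable ([set: V] `*` ~` K) by apply: measurableX => //; exact: measurableC.
  have U : (P ((~` K `*` setT) `|` (setT `*` ~` K)) <=
      P (~` K `*` setT) + P (setT `*` ~` K))%E by exact: measureU2.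
  apply: le_trans U _; rewrite !PE gl ?gr ?nuK ?adde0; try exact: measurableC.
  by rewrite split_nu' ?nuK ?tauK ?mule0 ?adde0 //; exact: measurableC.
pose Z := [set z | h z != 0].
have mZ : measurable Z.
  have -> : Z = h @^-1` (~` [set 0]).
    by apply/seteqP; split=> z /=; [move/eqP|move=> /eqP].
  rewrite -[X in measurable X]setTI; apply: mh => //; exact: measurableC.
have PZ : (P Z <= eta%:E)%E.
  rewrite PE gE.
  have -> : diag @^-1` Z = set0.
    apply/seteqP; split=> x //=; rewrite /Z /h /= subrr /enorm /dotp big1 ?sqrtr0 ?eqxx //.
    by move=> l _; rewrite mxE mul0r.
  rewrite measure0 mule0 add0e; apply: (@le_trans _ _ ((tau \x nu)%E setT)).
    by apply: le_measure => //; apply/mem_set.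
  by rewrite -setXTT pE // tau1 nuT mule1.
have Wle : (W1 nu' nu <= \int[P]_z (h z)%:E)%E.
  apply: ereal_inf_lbound; exists P => //; split=> A mA; rewrite PE; [exact: gl|exact: gr].
apply: le_trans Wle _.
have mKK : measurable (K `*` K) by exact: measurableX.
have mhE : measurable_fun setT (EFin \o h) by apply/measurable_EFinP.
rewrite (@ge0_negligible_integral _ _ _ P setT (~` (K `*` K))) //; last 2 first.
- exact: measurableC.
- by move=> z _; rewrite lee_fin sqrtr_ge0.
rewrite setTD setCK.
apply: (@le_trans _ _ (\int[P]_(z in K `*` K) ((d%:R * (2 * r))%:E * (\1_Z z)%:E))%E).
  apply: ge0_le_integral => //.
  - by move=> z _; rewrite lee_fin sqrtr_ge0.
  - by apply: measurable_funTS.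
  - apply: measurable_funTS; apply/measurable_EFinP; apply: measurable_funM => //.
  - move=> [x y] [/= xK yK]; rewrite -EFinM lee_fin indicE.
    have [zZ|] := boolP ((x, y) \in Z); last first.
      by move=> /negP H; rewrite mulr0; have [->//|hz] := eqVneq (h (x, y)) 0; case: H; exact/mem_set.
    rewrite mulr1; apply: le_trans (enorm_le _) _; rewrite ler_wpM2l //.
    by apply: le_trans (ler_normB _ _) _; rewrite mulr2n mulrDl !mul1r lerD.
have -> : (\int[P]_(z in K `*` K) ((d%:R * (2 * r))%:E * (\1_Z z)%:E) =
    (d%:R * (2 * r))%:E * \int[P]_(z in K `*` K) (\1_Z z)%:E)%E.
  apply: ge0_integralZl => //; last by rewrite lee_fin mulr_ge0 // mulr_ge0.
  by apply: measurable_funTS; apply/measurable_EFinP; exact: measurable_indic.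
rewrite integral_indic // [X in (_ <= X)%E]EFinM; apply: lee_wpmul2l; first by rewrite lee_fin !mulr_ge0.
apply: le_trans PZ; apply: le_measure => [||z []//]; apply/mem_set => //; exact: measurableI.
Qed.

End coupling_bound.

(** * Measures with piecewise constant density *)

Section cell_densities.
Context {R : realType} {d : nat}.
Local Notation V := 'rV[R]_d.
Local Notation leb := (lebesgue_rV R d).
Variables (dx r : R) (S : set 'rV[int]_d).
Hypotheses (dx0 : 0 < dx) (r0 : 0 <= r) (fS : finite_set S).
Hypothesis Sr : forall i, S i -> forall x : V, cell dx i x -> `|x| <= r.
Implicit Types (w : 'rV[int]_d -> R) (A : set V).

Local Notation s := (fset_set S : seq _).

Let memS i : i \in s -> S i. Proof. by rewrite in_fset_set // => /set_mem. Qed.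

Definition cell_volume i A : R := fine (leb (A `&` cell dx i)).

Lemma cell_volumeE i A : measurable A -> (cell_volume i A)%:E = leb (A `&` cell dx i).
Proof.
move=> mA; rewrite /cell_volume fineK // ge0_fin_numE //.
have mi := cell_measurable dx i.
have /le_lt_trans -> // : (leb (A `&` cell dx i) <= leb (cell dx i))%E.
  by apply: le_measure => [||x []//]; apply/mem_set => //; exact: measurableI.
by rewrite lebesgue_cell // ltry.
Qed.

Lemma cell_volumeT i : cell_volume i setT = dx ^+ d.
Proof. by rewrite /cell_volume setTI lebesgue_cell. Qed.

(** A finite real sum rather than an integral, so that decompositions of
    measures reduce to identities between reals. *)
Definition weighted_volume w A : R := \sum_(i <- s) w i * cell_volume i A.

Lemma weighted_volumeT w : weighted_volume w setT = \sum_(i <- s) w i * dx ^+ d.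
Proof. by apply: eq_bigr => i _; rewrite cell_volumeT. Qed.

Lemma weighted_volume_off w A : (forall x, `|x| <= r -> ~ A x) -> weighted_volume w A = 0.
Proof.
move=> Ar; rewrite /weighted_volume big1_seq // => i /andP[_ /memS Si].
rewrite /cell_volume (_ : A `&` _ = set0) ?measure0 ?mulr0 //.
by apply/seteqP; split=> // x [Ax /(Sr Si)/Ar].
Qed.

Lemma weighted_measure w : (forall i, S i -> 0 <= w i) ->
  exists m : {measure set V -> \bar R}, forall A, measurable A -> m A = (weighted_volume w A)%:E.
Proof.
move=> w0.
pose m := msum (fun n => mscale (NngNum (normr_ge0 (w (nth 0 s n))))
   (mrestr leb (cell_measurable dx (nth 0 s n)))) (size s).
exists m => A mA; rewrite /weighted_volume (big_nth 0) big_mkord -sumEFin.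
apply: eq_bigr => k _; have Sk : S (nth 0 s k) by apply: memS; exact: mem_nth.
by rewrite EFinM cell_volumeE // -[in RHS](ger0_norm (w0 _ Sk)).
Qed.

Lemma weighted_volume_integral w A : (forall i, S i -> 0 <= w i) -> measurable A ->
  (weighted_volume w A)%:E =
  (\int[leb]_(x in A) (\sum_(i \in S) w i * beta0 dx i x)%:E)%E.
Proof.
move=> w0 mA.
have E x : (\sum_(i \in S) w i * beta0 dx i x)%:E =
    (\sum_(i <- s) (`|w i|%:E * (\1_(cell dx i) x)%:E)%E).
  rewrite fsbig_finite // -sumEFin; apply: eq_big_seq => i /memS Si.
  by rewrite EFinM ger0_norm ?w0.
under eq_integral do rewrite E.
have mi i : measurable_fun A (fun x => (\1_(cell dx i) x)%:E : \bar R).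
  apply: measurable_funTS; apply/measurable_EFinP; apply: measurable_indic.
  exact: cell_measurable.
rewrite ge0_integral_sum //; last by move=> i; apply: emeasurable_funM.
rewrite -sumEFin; apply: eq_big_seq => i /memS Si.
rewrite ge0_integralZl // EFinM cell_volumeE // ger0_norm ?w0 //; congr (_ * _)%E.
by rewrite setIC; apply: esym; apply: integral_indic => //; exact: cell_measurable.
Qed.

Definition distribution_weights w :=
  (forall i, S i -> 0 <= w i) /\ \sum_(i <- s) w i * dx ^+ d = 1.

Definition has_weights (nu : P1 R d) w :=
  forall A, measurable A -> nu A = (weighted_volume w A)%:E.

Let K : set V := [set x | `|x| <= r].

Let mK : measurable K.
Proof.
have := box_measurable (0 : V) r; congr measurable.
by apply/seteqP; split=> x /=; rewrite subr0.
Qed.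

Lemma exists_weighted_P1 w : distribution_weights w -> exists nu, has_weights nu w.
Proof.
move=> [w0 w1]; have [m mE] := weighted_measure w0.
have m1 : m setT = 1%E by rewrite mE // weighted_volumeT w1.
have [P PE] := probability_of_mass1 m1.
suff PM : (\int[P]_x (enorm x)%:E < +oo)%E.
  by exists (MkP1 PM) => A mA; rewrite /= PE mE.
have menorm : measurable_fun setT (fun x : V => (enorm x)%:E).
  apply/measurable_EFinP; exact: (measurable_enorm (@measurable_id _ _ setT)).
have P0 : P (~` K) = 0%E.
  rewrite PE mE; last exact: measurableC.
  by rewrite weighted_volume_off // => x xr; apply.
rewrite (@ge0_negligible_integral _ _ _ P setT (~` K)) //; last 2 first.
- exact: measurableC.
- by move=> x _; rewrite lee_fin sqrtr_ge0.
rewrite setTD setCK.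
apply: (@le_lt_trans _ _ (\int[P]_(x in K) cst (d%:R * r)%:E x)%E).
  apply: ge0_le_integral => //.
  - by move=> x _; rewrite lee_fin sqrtr_ge0.
  - exact: measurable_funTS.
  - by move=> x xr; rewrite lee_fin (le_trans (enorm_le _)) // ler_wpM2l.
rewrite integral_cst // lte_mul_pinfty ?lee_fin ?mulr_ge0 //.
by rewrite (le_lt_trans (probability_le1 P mK)) // ltry.
Qed.

(** If w' is close to w on S then w' >= (1 - eta) w on S with a small eta: where
    w vanishes this is positivity of w', and elsewhere w is bounded below
    because S is finite. The difference w' - (1 - eta) w is then the weight of
    the measure tau of W1_of_splitting. *)
Lemma W1_close_weights w (e : R) : distribution_weights w -> 0 < e ->
  exists2 del : R, 0 < del & forall w' nu nu', distribution_weights w' ->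
    has_weights nu w -> has_weights nu' w' ->
    (forall i, S i -> `|w' i - w i| <= del) -> (W1 nu' nu < e%:E)%E.
Proof.
move=> [w0 w1] e0; pose C := d%:R * (2 * r).
have C0 : 0 <= C by rewrite !mulr_ge0.
have C1 : 0 < C + 1 by rewrite ltr_wpDl.
pose eta := Num.min 1 (e / (C + 1)).
have eta0 : 0 < eta by rewrite lt_min ltr01 divr_gt0.
have eta1 : eta <= 1 by rewrite ge_min lexx.
have Ceta : C * eta < e.
  apply: (@le_lt_trans _ _ (C * (e / (C + 1)))).
    by rewrite ler_wpM2l // ge_min lexx orbT.
  by rewrite mulrA ltr_pdivrMr // mulrC ltr_pM2l // ltrDl.
have [del del0 Hdel] : exists2 del : R, 0 < del &
    forall i, i \in s -> 0 < w i -> del <= eta * w i.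
  elim: (s : seq _) => [|j u [del del0 IH]]; first by exists 1.
  have [wj|wj] := ltP 0 (w j); last first.
    exists del => // i; rewrite in_cons => /orP[/eqP -> /lt_le_trans/(_ wj)|]; first by rewrite ltxx.
    exact: IH.
  exists (Num.min del (eta * w j)); first by rewrite lt_min del0 mulr_gt0.
  move=> i; rewrite in_cons => /orP[/eqP -> _|iu wi]; first by rewrite ge_min lexx orbT.
  by rewrite ge_min IH.
exists del => // w' nu nu' [w'0 w'1] nuw nuw' ww'.
pose u i := w' i - (1 - eta) * w i.
have u0 i : S i -> 0 <= u i.
  move=> Si; rewrite /u subr_ge0; have := w0 i Si; rewrite le_eqVlt => /orP[/eqP <-|wi].
    by rewrite mulr0 w'0.
  have := Hdel i; rewrite in_fset_set // mem_set // => /(_ isT wi).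
  by have := ww' i Si; rewrite ler_norml => /andP[]; lra.
have [tau tauE] := weighted_measure u0.
have split A : weighted_volume w' A = (1 - eta) * weighted_volume w A + weighted_volume u A.
  rewrite /weighted_volume mulr_sumr -big_split; apply: eq_bigr => i _ /=.
  by rewrite /u; ring.
have mKc : measurable (~` K) by exact: measurableC.
have off v : weighted_volume v (~` K) = 0.
  by apply: weighted_volume_off => x xr; apply.
have eta01 : 0 <= eta <= 1 by rewrite (ltW eta0).
apply: le_lt_trans (@W1_of_splitting R d nu' nu tau eta r eta01 r0 _ _ _ _) _.
- by move=> A mA; rewrite nuw' // nuw // tauE // -EFinM -EFinD split.
- have := split setT; rewrite !weighted_volumeT w1 w'1 tauE // => h.
  by congr (_%:E); rewrite weighted_volumeT; lra.
- by rewrite tauE // off.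
- by rewrite nuw // off.
- by rewrite lte_fin.
Qed.

End cell_densities.

(** * Interpolation in time *)

Section hat.
Context {R : realType}.
Implicit Types u v : R.

Lemma max_lipschitz c u v : `|Num.max c u - Num.max c v| <= `|u - v|.
Proof.
have := ler_norm (u - v); have := ler_norm (- (u - v)); rewrite normrN /Num.max.
by do 2 (case: ifPn; rewrite -?leNgt => ?); move=> h1 h2;
  rewrite ler_norml; apply/andP; split; lra.
Qed.

Lemma min_lipschitz c u v : `|Num.min c u - Num.min c v| <= `|u - v|.
Proof.
have := ler_norm (u - v); have := ler_norm (- (u - v)); rewrite normrN /Num.min.
by do 2 (case: ifPn; rewrite -?leNgt => ?); move=> h1 h2;
  rewrite ler_norml; apply/andP; split; lra.
Qed.

(** The profile of affine interpolation between integers. With it the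
    interpolated weights are one formula valid at all times, whose Lipschitz
    continuity needs no case distinction on time intervals. *)
Definition hat u : R := Num.max 0 (1 - `|u|).

Lemma hat_lipschitz u v : `|hat u - hat v| <= `|u - v|.
Proof.
have h1 := ler_distD 0 u v; have := lerB_dist u v; have := lerB_dist v u.
rewrite (distrC v u) /hat /Num.max; do 2 case: ifPn; rewrite -?leNgt => a b h2 h3;
  rewrite ler_norml; apply/andP; split; lra.
Qed.

Lemma hat_eq0 u : 1 <= `|u| -> hat u = 0.
Proof. by move=> h; rewrite /hat; apply/max_idPl; rewrite subr_le0. Qed.

Lemma hat_in u : `|u| <= 1 -> hat u = 1 - `|u|.
Proof. by move=> h; rewrite /hat; apply/max_idPr; rewrite subr_ge0. Qed.

Lemma sum_hat (N k : nat) (c : nat -> R) (u : R) : (k < N)%N -> k%:R <= u <= k.+1%:R ->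
  \sum_(j < N.+1) c j * hat (u - j%:R) = (u - k%:R) * c k.+1 + (k.+1%:R - u) * c k.
Proof.
move=> kN /andP[ku uk].
have k1 : (k < N.+1)%N by exact: ltnW.
rewrite (bigD1 (Ordinal k1)) //= (bigD1 (Ordinal (kN : k.+1 < N.+1)%N)) /=; last first.
  by apply/eqP => /(congr1 val) /= /eqP; rewrite eqn_leq ltnn.
rewrite big1 ?addr0 => [|j /andP[jk jk1]]; last first.
  have {}jk : (j != k :> nat) by apply: contra jk => /eqP h; apply/eqP/val_inj.
  have {}jk1 : (j != k.+1 :> nat) by apply: contra jk1 => /eqP h; apply/eqP/val_inj.
  rewrite hat_eq0 ?mulr0 //; move: jk; rewrite neq_ltn => /orP[jk|jk].
    have : (j.+1%:R : R) <= k%:R by rewrite ler_nat.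
    by rewrite -natr1 => h; rewrite ler_normr; apply/orP; left; lra.
  have : (k.+2%:R : R) <= j%:R by rewrite ler_nat ltn_neqAle eq_sym jk1.
  by rewrite -natr1 => h; rewrite ler_normr; apply/orP; right; lra.
have k1E : k.+1%:R = k%:R + 1 :> R by rewrite natr1.
have -> : hat (u - k%:R) = 1 - (u - k%:R) by rewrite hat_in ger0_norm; lra.
have -> : hat (u - k.+1%:R) = 1 + (u - k.+1%:R) by rewrite hat_in ler0_norm; lra.
by rewrite k1E; ring.
Qed.

End hat.

Section curve.
Context {R : realType} {d : nat}.
Local Notation V := 'rV[R]_d.
Variables (T : R) (N : nat) (dx Ct r : R) (nu0 : P1 R d).
Hypotheses (T0 : 0 < T) (N0 : (0 < N)%N) (dx0 : 0 < dx) (r0 : 0 <= r).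
Local Notation S := (@grid_box R d dx Ct).
Hypothesis Sr : forall i, S i -> forall x : V, cell dx i x -> `|x| <= r.
Local Notation dt := (T / N%:R).
Implicit Types (m : nat -> 'rV[int]_d -> R).

Let fS : finite_set S := @finite_grid_box R d dx Ct dx0.

Let dt0 : 0 < dt. Proof. by rewrite divr_gt0 ?ltr0n. Qed.

(** Time in units of the time step, constant outside [0, T], so that the curve
    takes its values among probability measures at all times. *)
Definition clamped_time (t : R) : R := Num.max 0 (Num.min N%:R (t / dt)).

Lemma clamped_time_lipschitz t u : `|clamped_time t - clamped_time u| <= `|t - u| / dt.
Proof.
have -> : `|t - u| / dt = `|t / dt - u / dt|.
  by rewrite -mulrBl normrM (gtr0_norm (_ : 0 < dt^-1)) // invr_gt0.
apply: le_trans (max_lipschitz _ _ _) _; exact: min_lipschitz.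
Qed.

Lemma clamped_time_cell t : exists2 k, (k < N)%N & k%:R <= clamped_time t <= k.+1%:R.
Proof.
set u := clamped_time t.
have u0 : 0 <= u by rewrite le_max lexx.
have uN : u <= N%:R by rewrite ge_max ler0n ge_min lexx.
have [->|uN'] := eqVneq u N%:R.
  exists N.-1; rewrite prednK //; by rewrite lexx ler_nat leq_pred.
exists (Num.truncn u); last by have /andP[-> /ltW ->] := truncn_itv u0.
rewrite -(ltr_nat R); apply: le_lt_trans (_ : u < _); last by rewrite lt_neqAle uN' uN.
by have /andP[] := truncn_itv u0.
Qed.

Definition curve_weights m t (i : 'rV[int]_d) : R :=
  \sum_(k < N.+1) m k i * hat (clamped_time t - k%:R).

Definition distributions m := forall k, (k <= N)%N -> distribution_weights dx S (m k).

Lemma curve_weights_interp m t k i : (k < N)%N -> k%:R <= clamped_time t <= k.+1%:R ->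
  curve_weights m t i = (clamped_time t - k%:R) * m k.+1 i + (k.+1%:R - clamped_time t) * m k i.
Proof. by move=> kN tk; rewrite /curve_weights (sum_hat (m^~ i) kN tk). Qed.

Lemma curve_weights_distribution m t : distributions m ->
  distribution_weights dx S (curve_weights m t).
Proof.
move=> mD; have [k kN tk] := clamped_time_cell t.
have [p0 p1] := mD _ kN; have [q0 q1] := mD _ (ltnW kN).
have /andP[h1 h2] := tk.
split=> [i Si|].
  by rewrite (curve_weights_interp _ _ kN tk) addr_ge0 // mulr_ge0 ?subr_ge0 ?p0 ?q0.
have -> : \sum_(i <- fset_set S) curve_weights m t i * dx ^+ d =
   (clamped_time t - k%:R) * (\sum_(i <- fset_set S) m k.+1 i * dx ^+ d) +
   (k.+1%:R - clamped_time t) * (\sum_(i <- fset_set S) m k i * dx ^+ d).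
  rewrite !mulr_sumr -big_split; apply: eq_bigr => i _ /=.
  by rewrite (curve_weights_interp _ _ kN tk) mulrDl !mulrA.
by rewrite p1 q1 -natr1; ring.
Qed.

Lemma curve_weights_modulus m t u i :
  `|curve_weights m t i - curve_weights m u i| <=
  (\sum_(k < N.+1) `|m k i|) * (`|t - u| / dt).
Proof.
rewrite -sumrB mulr_suml; apply: le_trans (ler_norm_sum _ _ _) _.
apply: ler_sum => k _; rewrite -mulrBr normrM ler_wpM2l //.
apply: le_trans (hat_lipschitz _ _) _.
by rewrite opprB addrA subrK clamped_time_lipschitz.
Qed.

(** The value nu0 is never taken when m consists of distributions, see
    curve_has_weights. *)
Definition curve m t : P1 R d :=
  if pselect (exists nu, has_weights dx S nu (curve_weights m t)) is left h
  then sval (cid h) else nu0.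

Lemma curve_has_weights m t : distributions m ->
  has_weights dx S (curve m t) (curve_weights m t).
Proof.
move=> mD; rewrite /curve; case: pselect => [h|]; first by case: cid.
by case; apply: (@exists_weighted_P1 _ _ dx r) => //; exact: curve_weights_distribution.
Qed.

Lemma curve_continuous m : distributions m -> continuous_curve T (curve m).
Proof.
move=> mD t _ e e0.
have [del del0 H] := W1_close_weights dx0 r0 fS Sr (curve_weights_distribution t mD) e0.
pose M := \sum_(i <- fset_set S) \sum_(k < N.+1) `|m k i|.
have M0 : 0 <= M by apply: sumr_ge0 => i _; exact: sumr_ge0.
have M1 : 0 < M + 1 by rewrite ltr_wpDl.
exists (del * dt / (M + 1)) => [|s _ st]; first by apply: divr_gt0 => //; exact: mulr_gt0.
apply: (H (curve_weights m s)); try exact: curve_has_weights.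
  exact: curve_weights_distribution.
move=> i Si; apply: le_trans (curve_weights_modulus _ _ _ _) _.
apply: (@le_trans _ _ (M * (`|s - t| / dt))).
  apply: ler_wpM2r; first by rewrite divr_ge0 // ltW.
  have iS : i \in (fset_set S : seq _) by rewrite in_fset_set // mem_set.
  by rewrite /M (big_rem i iS) /= lerDl; apply: sumr_ge0 => j _; exact: sumr_ge0.
rewrite mulrA ler_pdivrMr //; apply: (@le_trans _ _ ((M + 1) * `|s - t|)).
  by rewrite ler_wpM2r // lerDl.
by rewrite mulrC -ler_pdivlMr // ltW.
Qed.

Lemma curve_extension m : distributions m -> extension T N dx Ct m (curve m).
Proof.
move=> mD; split; first exact: curve_continuous.
move=> k t kN; rewrite in_itv /= => /andP[t1 t2] A mA.
have nz : (0 : R) < N%:R by rewrite ltr0n.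
have tdt : k%:R <= t / dt <= k.+1%:R by rewrite ler_pdivlMr // ler_pdivrMr // t1 t2.
have tE : clamped_time t = t / dt.
  have /andP[h1 h2] := tdt.
  have h3 : k.+1%:R <= N%:R :> R by rewrite ler_nat.
  have h4 : 0 <= k%:R :> R by [].
  rewrite /clamped_time (min_idPr _) ?(max_idPr _) //; lra.
rewrite (curve_has_weights t mD mA) weighted_volume_integral //; last first.
  by case: (curve_weights_distribution t mD).
apply: eq_integral => x _; congr (_%:E).
rewrite !fsbig_finite // !mulr_sumr -big_split; apply: eq_bigr => i _ /=.
rewrite (@curve_weights_interp m t k) ?tE // !mulrA -mulrDl; congr (_ * _).
by congr (_ * _ + _ * _); field; apply/andP; split; rewrite gt_eqF.
Qed.

Lemma curve_cvg (m_ : nat -> nat -> 'rV[int]_d -> R) m t :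
  (forall n, distributions (m_ n)) -> distributions m ->
  (forall k i, (k <= N)%N -> S i -> m_ n k i @[n --> \oo] --> m k i) ->
  W1_cvg (fun n => curve (m_ n) t) (curve m t).
Proof.
move=> mD_ mD mm e e0.
have [del del0 H] := W1_close_weights dx0 r0 fS Sr (curve_weights_distribution t mD) e0.
have wcv i : S i -> curve_weights (m_ n) t i @[n --> \oo] --> curve_weights m t i.
  move=> Si; apply: cvg_bigsum => k _; apply: cvgM; last exact: cvg_cst.
  by apply: mm => //; rewrite -ltnS.
have : \forall n \near \oo, forall i, i \in (fset_set S : seq _) ->
    `|curve_weights m t i - curve_weights (m_ n) t i| <= del.
  apply: (@near_seq _ _ eventually_filter) => i; rewrite in_fset_set // => /set_mem Si.
  by have /cvgrPdist_le := wcv i Si; apply.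
apply: filterS => n Hn; apply: (H (curve_weights (m_ n) t)); try exact: curve_has_weights.
  exact: curve_weights_distribution.
by move=> i Si; rewrite distrC; apply: Hn; rewrite in_fset_set // mem_set.
Qed.

End curve.

(** * The discrete masses *)

Section mass.
Context {R : realType} {d : nat}.
Local Notation V := 'rV[R]_d.
Local Notation leb := (lebesgue_rV R d).
Variables (T : R) (L : V -> V -> R) (F G : V -> P1 R d -> R) (m0d rho : V -> R).
Variables (Cb : R) (N : nat) (dx eps Ct r : R) (pp : \bar R) (m0 : P1 R d).
Hypotheses (dx0 : 0 < dx) (r0 : 0 <= r) (hm0 : initial_assumption pp m0 m0d).
Local Notation S := (@grid_box R d dx Ct).
Hypothesis Sr : forall i, S i -> forall x : V, cell dx i x -> `|x| <= r.
Local Notation mass := (mass T L F G m0d rho Cb N dx eps).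
Local Notation flow := (flow T L F G rho Cb N dx eps).
Implicit Types (mu : R -> P1 R d).

Let fS : finite_set S := @finite_grid_box R d dx Ct dx0.
Let dxd : dx ^+ d != 0. Proof. by rewrite expf_neq0 // gt_eqF. Qed.

Lemma massS mu k i : mass mu k.+1 i = step dx (flow mu k) (mass mu k) i.
Proof. by []. Qed.

Lemma mass0_ge0 mu i : 0 <= mass mu 0 i.
Proof.
have [_ m0d0 _ _ _] := hm0.
by rewrite mulr_ge0 ?invr_ge0 ?exprn_ge0 ?(ltW dx0) //; apply: Rintegral_ge0.
Qed.

Lemma mass_ge0 mu k i : 0 <= mass mu k i.
Proof.
elim: k i => [|k IH] i; first exact: mass0_ge0.
by rewrite massS step_ge0.
Qed.

Lemma initial_hyperplane l (c : R) : m0 [set x : V | x 0 l = c] = 0%E.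
Proof.
have [mm0 m0d0 mE _ _] := hm0; have mH := @hyperplane_measurable R d l c.
rewrite mE //; apply: null_set_integral => //; last exact: null_hyperplane.
by apply: measurable_funTS; apply/measurable_EFinP.
Qed.

Lemma mass0_cell mu i : (mass mu 0 i * dx ^+ d)%:E = m0 (cell dx i).
Proof.
have [_ _ mE _ _] := hm0; have mi := cell_measurable dx i.
rewrite /= mulrAC mulVf // mul1r /Rintegral -mE // fineK //.
exact: fin_num_measure.
Qed.

(** The initial measure is absolutely continuous, so the faces of the cells
    carry no mass. *)
Lemma mass0_sum mu : (forall i, ~ S i -> mass mu 0 i = 0) ->
  \sum_(i <- fset_set S) mass mu 0 i * dx ^+ d = 1.
Proof.
move=> supp; apply: EFin_inj; rewrite -sumEFin.
have h := @cells_partition R d dx dx0 m0 initial_hyperplane S fS.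
apply: (etrans _ (etrans (esym (h _)) (probability_setT m0))).
  by rewrite fsbig_finite //; apply: eq_bigr => i _; exact: mass0_cell.
by move=> i Si; have e := mass0_cell mu i; rewrite supp // mul0r in e; exact: esym e.
Qed.

(** The conclusion of support_bound for one curve. *)
Definition supported mu := forall k i, (k <= N)%N -> ~ S i -> mass mu k i = 0.

Lemma mass_distributions mu : supported mu -> (forall k, near_id r (flow mu k)) ->
  distributions N dx Ct (mass mu).
Proof.
move=> supp nid k kN; split=> [i _|]; first exact: mass_ge0.
elim: k kN => [|k IH] kN; first by apply: mass0_sum => i; exact: supp.
rewrite -(IH (ltnW kN)) (eq_bigr _ (fun i _ => congr1 (fun x => x * _) (massS mu k i))).
apply: (@step_sum R d dx r) => //.
- exact: mass_ge0.
- by move=> i; apply: supp => //; exact: ltnW.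
- by move=> i Si; rewrite -massS supp.
Qed.

Lemma mass_cvg (mu_ : nat -> R -> P1 R d) mu :
  (forall n, supported (mu_ n)) -> supported mu ->
  (forall n k, near_id r (flow (mu_ n) k)) -> (forall k, near_id r (flow mu k)) ->
  (forall k x l, `|x| <= r -> flow (mu_ n) k x 0 l @[n --> \oo] --> flow mu k x 0 l) ->
  forall k i, (k <= N)%N -> mass (mu_ n) k i @[n --> \oo] --> mass mu k i.
Proof.
move=> supp_ supp nid_ nid fcv k; elim: k => [|k IH] i kN; first exact: cvg_cst.
have s_ n j : ~ S j -> mass (mu_ n) k j = 0 by apply: supp_; exact: ltnW.
have s j : ~ S j -> mass mu k j = 0 by apply: supp; exact: ltnW.
have IH' j : mass (mu_ n) k j @[n --> \oo] --> mass mu k j by apply: IH; exact: ltnW.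
exact: (@step_cvg R d dx r dx0 r0 S fS Sr _ _ _ _ i (fun n => nid_ n k) (nid k) (fcv k) s_ s IH').
Qed.

(** A node lies in the interior of its own cell and in no other cell. *)
Lemma mass_fun_gridpt mu k i : supported mu -> (k <= N)%N -> S i ->
  mass_fun T L F G m0d rho Cb N dx eps mu k (gridpt dx i) = mass mu k i.
Proof.
move=> supp kN Si; rewrite /mass_fun -(fsbig_widen S) //; last first.
  by move=> j [_ Sj] /=; rewrite supp ?mul0r.
have iS : i \in (fset_set S : seq _) by rewrite in_fset_set // mem_set.
rewrite fsbig_finite //= (big_rem i iS) /= (beta0_gridpt dx0) eqxx mulr1.
rewrite big1_seq ?addr0 // => j /andP[_].
rewrite mem_rem_uniq ?fset_uniq // => /andP[/= ji _].
by rewrite (beta0_gridpt dx0) eq_sym (negbTE ji) mulr0.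
Qed.

End mass.

(** * The fixed point *)

Section normalization.
Context {R : realType} {d : nat}.
Variables (N : nat) (dx Ct : R).
Hypotheses (dx0 : 0 < dx) (Ct0 : 0 <= Ct).
Local Notation S := (@grid_box R d dx Ct).
Local Notation s := (fset_set S : seq _).
Local Notation J := ('I_N.+1 * fset_set S)%type.

Let fS : finite_set S := @finite_grid_box R d dx Ct dx0.

Let S0 : S 0.
Proof.
rewrite /grid_box /= (_ : gridpt dx 0 = 0) ?normr0 //.
by apply/rowP => l; rewrite !mxE mul0r.
Qed.

Definition entry (u : J -> R) k (i : 'rV[int]_d) : R :=
  if insub i is Some j then u (inord k, j) else 0.

Definition block_sum (u : J -> R) k : R := \sum_(i <- s) entry u k i.

(** A continuous map from the cube to families of distributions, equal to u
    divided by the volume of a cell on every block with sum 1: missing mass is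
    put at the node 0, and excess mass is removed by rescaling. It replaces the
    projection onto the product of simplices, on which the fixed point is
    sought. *)
Definition normalized (u : J -> R) k (i : 'rV[int]_d) : R :=
  dx ^- d * ((entry u k i + Num.max 0 (1 - block_sum u k) * (i == 0)%:R) /
             Num.max 1 (block_sum u k)).

Let max1_gt0 (a : R) : 0 < Num.max 1 a. Proof. by rewrite lt_max ltr01. Qed.

Lemma entryE u k j : entry u k (val j) = u (inord k, j).
Proof. by rewrite /entry valK. Qed.

Lemma entry_ge0 u k i : cube u -> 0 <= entry u k i.
Proof. by move=> uc; rewrite /entry; case: insub => // j; case/andP: (uc (inord k, j)). Qed.

Lemma normalized_distributions u : cube u -> distributions N dx Ct (normalized u).
Proof.
move=> uc k _; split=> [i _|].
  rewrite mulr_ge0 ?invr_ge0 ?exprn_ge0 ?(ltW dx0) // divr_ge0 ?(ltW (max1_gt0 _)) //.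
  by rewrite addr_ge0 ?entry_ge0 // mulr_ge0 // le_max lexx.
have dxd : dx ^+ d != 0 by rewrite expf_neq0 // gt_eqF.
under eq_bigr => i _ do rewrite /normalized mulrAC mulVf // mul1r.
rewrite -mulr_suml big_split /= -/(block_sum u k) -mulr_sumr.
have -> : \sum_(i <- s) ((i == 0)%:R : R) = 1.
  have s0 : (0 : 'rV[int]_d) \in s by rewrite in_fset_set // mem_set.
  rewrite (big_rem _ s0) /= eqxx big1_seq ?addr0 // => j /andP[_].
  by rewrite mem_rem_uniq ?fset_uniq // => /andP[/= /negbTE ->].
rewrite mulr1; move: (block_sum u k) => b.
have -> : b + Num.max 0 (1 - b) = Num.max 1 b.
  by rewrite maxEle [in RHS]maxEle; case: ifPn; case: ifPn; rewrite -?ltNge => h1 h2; lra.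
by rewrite mulfV // gt_eqF.
Qed.

Lemma normalized_id u k i : block_sum u k = 1 -> normalized u k i = dx ^- d * entry u k i.
Proof. by move=> s1; rewrite /normalized s1 subrr maxxx mul0r addr0 maxxx divr1. Qed.

Lemma normalized_cvg (u_ : nat -> J -> R) u k i :
  (forall j, u_ n j @[n --> \oo] --> u j) ->
  normalized (u_ n) k i @[n --> \oo] --> normalized u k i.
Proof.
move=> uu.
have ecv i' : entry (u_ n) k i' @[n --> \oo] --> entry u k i'.
  by rewrite /entry; case: insub => [j|]; [exact: uu|exact: cvg_cst].
have scv : block_sum (u_ n) k @[n --> \oo] --> block_sum u k by exact: cvg_bigsum.
have mcv (c : R) (f : nat -> R) (l : R) : f n @[n --> \oo] --> l ->
    Num.max c (f n) @[n --> \oo] --> Num.max c l.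
  move=> fl; apply/cvgrPdist_le => e e0; have /cvgrPdist_le/(_ e e0) := fl.
  by apply: filterS => n; apply: le_trans; exact: max_lipschitz.
apply: cvgM; first exact: cvg_cst.
apply: cvgM.
  apply: cvgD => //; apply: cvgM; last exact: cvg_cst.
  by apply: mcv; apply: cvgB => //; exact: cvg_cst.
apply: cvgV; last exact: mcv.
by rewrite gt_eqF.
Qed.

End normalization.

Theorem theorem5p1 (R : realType) (d : nat) (hd : (0 < d)%N) (T : R) (hT : 0 < T)
  (L : 'rV[R]_d -> 'rV[R]_d -> R) (hL : lagrangian_assumption L)
  (F G : 'rV[R]_d -> P1 R d -> R)
  (hF : cost_assumption F) (hG : cost_assumption G)
  (pp : \bar R) (hpp : (1 < pp)%E)
  (m0 : P1 R d) (m0d : 'rV[R]_d -> R) (hm0 : initial_assumption pp m0 m0d)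
  (Cb : R) (hCb : 0 < Cb) (hCbb : control_bound T L F G Cb)
  (rho : 'rV[R]_d -> R) (hrho : mollifier_assumption rho)
  (hDrho : forall l : 'I_d,
    (\int[lebesgue_rV R d]_x (`|'D_(delta_mx 0 l) rho x|)%:E < +oo)%E)
  (c : R) (hc : 0 < c)
  (Ct : R) (hCt : 0 < Ct) (hCtb : support_bound T L F G m0d rho Cb c Ct)
  (eps_max : R) (heps_max : 0 < eps_max) :
  exists2 delta : R, 0 < delta &
    forall (N : nat) (dx eps : R),
      (0 < N)%N -> 0 < dx -> 0 < eps -> eps <= eps_max ->
      dx <= c * (T / N%:R) ->
      (T / N%:R) / eps <= delta ->
      exists m : nat -> 'rV[int]_d -> R,
        MFG_solution T L F G m0d rho Cb N dx eps Ct m.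
Proof.
(* This box contains every cell of the grid box, as dx <= c T. *)
pose r := Ct + c * T / 2.
have r0 : 0 <= r by rewrite addr_ge0 ?divr_ge0 ?mulr_ge0 // ltW.
have [delta delta0 Hflow] := flow_regular hT hL hF hG hCb hrho hDrho r heps_max.
exists delta => // N dx eps N0 dx0 eps0 epsm dxc small.
have {}Hflow k := Hflow N dx eps N0 dx0 eps0 epsm small k.
pose S := @grid_box R d dx Ct.
have fS : finite_set S by exact: finite_grid_box.
have Sr i : S i -> forall x : 'rV[R]_d, cell dx i x -> `|x| <= r.
  move=> Si x xi; have -> : x = (x - gridpt dx i) + gridpt dx i by rewrite subrK.
  apply: le_trans (ler_normD _ _) _; rewrite addrC lerD //.
  apply: le_trans xi _; rewrite ler_pM2r //; apply: le_trans dxc _.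
  rewrite ler_pM2l // ler_pdivrMr ?ltr0n // ler_peMr ?(ltW hT) // ler1n //.
pose J := ('I_N.+1 * fset_set S)%type.
pose M (u : J -> R) := normalized u.
pose mu (u : J -> R) : R -> P1 R d := curve T N dx Ct m0 (M u).
pose p u := mass T L F G m0d rho Cb N dx eps (mu u).
have Mdist u : cube u -> distributions N dx Ct (M u).
  by apply: normalized_distributions => //; exact: ltW.
have ext u : cube u -> extension T N dx Ct (M u) (mu u).
  by move=> uc; exact: (curve_extension m0 hT N0 dx0 r0 Sr (Mdist u uc)).
have supp u : cube u -> supported T L F G m0d rho Cb N dx eps Ct (mu u).
  move=> uc k i kN Si; have [cu _] := ext u uc.
  exact: (hCtb (mu u) N dx eps cu N0 dx0 eps0 dxc k i kN Si).
have pdist u : cube u -> distributions N dx Ct (p u).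
  move=> uc; apply: (mass_distributions dx0 r0 hm0 Sr) => //; first exact: supp.
  by move=> k; have [H _] := Hflow k; exact: H.
pose f (u : J -> R) (j : J) : R := p u j.1 (val j.2) * dx ^+ d.
have dxd : 0 < dx ^+ d by rewrite exprn_gt0.
have [||u uc fu] := @brouwer R J f.
- move=> u uc j; have [p0 p1] := pdist u uc j.1 (ltn_ord j.1 : (j.1 <= N)%N).
  have jS : val j.2 \in (fset_set S : seq _) by exact: valP.
  have pos i : i \in (fset_set S : seq _) -> 0 <= p u j.1 i * dx ^+ d.
    by rewrite in_fset_set // => /set_mem Si; rewrite mulr_ge0 ?(ltW dxd) // p0.
  rewrite pos //= -p1 (big_rem _ jS) /= lerDl big_seq sumr_ge0 // => i /mem_rem; exact: pos.
- move=> u_ u uc_ uc uu j; apply: cvgM; last exact: cvg_cst.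
  have W t : W1_cvg (fun n => mu (u_ n) t) (mu u t).
    have Mcv k i : (k <= N)%N -> S i -> M (u_ n) k i @[n --> \oo] --> M u k i.
      by move=> _ _; exact: normalized_cvg.
    exact: (curve_cvg T m0 N0 dx0 r0 Sr t (fun n => Mdist _ (uc_ n)) (Mdist u uc) Mcv).
  apply: (mass_cvg dx0 r0 Sr) => //.
  + by move=> n; exact: supp.
  + exact: supp.
  + by move=> n k; have [H _] := Hflow k; exact: H.
  + by move=> k; have [H _] := Hflow k; exact: H.
  + by move=> k x l xr; have [_ H] := Hflow k; apply: H.
  + exact: (ltn_ord j.1).
have uE k i : (k <= N)%N -> S i -> entry u k i = p u k i * dx ^+ d.
  move=> kN Si; have iS : i \in fset_set S by rewrite in_fset_set // mem_set.
  have -> : i = val (Sub i iS : fset_set S) by [].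
  by rewrite entryE -fu /f /= inordK.
have ME k i : (k <= N)%N -> S i -> M u k i = p u k i.
  move=> kN Si; rewrite /M normalized_id.
    by rewrite uE // mulrCA mulVf ?mulr1 // gt_eqF.
  have [_ <-] := pdist u uc k kN; rewrite /block_sum; apply: eq_big_seq => j.
  by rewrite in_fset_set // => /set_mem Sj; exact: uE.
exists (M u); split.
  move=> k kN; have [h1 h2] := Mdist u uc k kN; split => //.
  by rewrite fsbig_finite.
exists (mu u); first exact: ext.
move=> k i kN Si; by rewrite ME // (mass_fun_gridpt dx0 (supp u uc)).
Qed.
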